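(* Let $t$ and $q$ be natural numbers and let $X$ be a hereditary class of graphs, each of which is $(K_t,K_{q,q})$-free (i.e., contains neither $K_t$ nor $K_{q,q}$ as an induced subgraph). If $X$ is well-quasi-ordered by the induced subgraph relation, then $X$ has bounded treewidth, i.e., there is a constant $c$ such that every graph in $X$ has treewidth at most $c$.
   Context: All graphs are finite, simple, undirected. A class of graphs is hereditary if it is closed under isomorphism and under taking induced subgraphs. A quasi-order is a well-quasi-order if it has no infinite strictly decreasing sequences and no infinite antichains (sets of pairwise incomparable elements). $K_n$ is the complete graph on $n$ vertices and $K_{n,m}$ the complete bipartite graph with parts of sizes $n$ and $m$. *)

(* Defs.v *)
From mathcomp Require Import all_boot.
From mathcomp Require Import boolp.

Set Implicit Arguments.
Unset Strict Implicit.
Unset Printing Implicit Defensive.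

Record sgraph := SGraph {
  vertex :> finType;
  adj : rel vertex;
  adj_sym : symmetric adj;
  adj_irr : irreflexive adj }.

Definition isomorphic (G H : sgraph) : Prop :=
  exists f : G -> H, bijective f /\ forall x y : G, adj (f x) (f y) = adj x y.

Section Induced.
Variables (G : sgraph) (S : {set G}).
Definition induced_adj : rel {x : G | x \in S} :=
  fun x y => adj (val x) (val y).
Fact induced_sym : symmetric induced_adj.
Proof. by move=> x y; apply: adj_sym. Qed.
Fact induced_irr : irreflexive induced_adj.
Proof. by move=> x; apply: adj_irr. Qed.
Definition induced : sgraph := SGraph induced_sym induced_irr.
End Induced.

Definition induced_subgraph (H G : sgraph) : Prop :=
  exists S : {set G}, isomorphic H (induced S).

Definition hereditary (X : sgraph -> Prop) : Prop :=
  (forall G H : sgraph, isomorphic G H -> X G -> X H) /\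
  (forall (G : sgraph) (S : {set G}), X G -> X (induced S)).

Section Complete.
Variable n : nat.
Definition complete_adj : rel 'I_n := fun x y => x != y.
Fact complete_sym : symmetric complete_adj.
Proof. by move=> x y; rewrite /complete_adj eq_sym. Qed.
Fact complete_irr : irreflexive complete_adj.
Proof. by move=> x; rewrite /complete_adj eqxx. Qed.
Definition complete : sgraph := SGraph complete_sym complete_irr.
End Complete.

Section CompleteBipartite.
Variables n m : nat.
Definition biclique_adj : rel ('I_n + 'I_m)%type := fun x y =>
  match x, y with
  | inl _, inr _ | inr _, inl _ => true
  | _, _ => false
  end.
Fact biclique_sym : symmetric biclique_adj.
Proof. by case=> x [] y. Qed.
Fact biclique_irr : irreflexive biclique_adj.
Proof. by case. Qed.
Definition biclique : sgraph := SGraph biclique_sym biclique_irr.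
End CompleteBipartite.

Section WellQuasiOrder.
Variables (T : Type) (R : T -> T -> Prop).

Definition infinite (A : T -> Prop) : Prop :=
  exists f : nat -> T, injective f /\ forall n, A (f n).

Definition antichain (A : T -> Prop) : Prop :=
  forall x y, A x -> A y -> x <> y -> ~ R x y /\ ~ R y x.

Definition strictly_decreasing (f : nat -> T) : Prop :=
  forall n, R (f n.+1) (f n) /\ ~ R (f n) (f n.+1).

(* R is meant to be a quasi-order; for induced_subgraph this is
   induced_subgraph_refl and induced_subgraph_trans below. *)
Definition well_quasi_ordered (X : T -> Prop) : Prop :=
  (~ exists f : nat -> T, (forall n, X (f n)) /\ strictly_decreasing f) /\
  (~ exists A : T -> Prop, [/\ forall x, A x -> X x, infinite A & antichain A]).
End WellQuasiOrder.

Lemma induced_subgraphP (H G : sgraph) : induced_subgraph H G <->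
  exists f : H -> G, injective f /\ forall x y : H, adj (f x) (f y) = adj x y.
Proof.
split=> [[S [f [bij_f adj_f]]] | [f [inj_f adj_f]]].
  exists (fun x => val (f x)); split=> [x y /val_inj|x y].
    exact: (bij_inj bij_f).
  by rewrite -adj_f.
have fS x : f x \in [set f y | y in H] by apply: imset_f.
exists [set f y | y in H], (fun x => exist _ (f x) (fS x)); split=> //.
have inj_g : injective (fun x => exist (fun z => z \in [set f y | y in H]) (f x) (fS x)).
  by move=> x y [] /inj_f.
by apply: (inj_card_bij inj_g); rewrite card_sig card_imset.
Qed.

Lemma induced_subgraph_refl (G : sgraph) : induced_subgraph G G.
Proof. by apply/induced_subgraphP; exists id; split. Qed.

Lemma induced_subgraph_trans (G H K : sgraph) :
  induced_subgraph G H -> induced_subgraph H K -> induced_subgraph G K.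
Proof.
move=> /induced_subgraphP[f [inj_f adj_f]] /induced_subgraphP[g [inj_g adj_g]].
apply/induced_subgraphP; exists (g \o f); split; first exact: inj_comp.
by move=> x y; rewrite /= adj_g adj_f.
Qed.

(* The null graph counts as connected here. *)
Definition connected (G : sgraph) : Prop :=
  forall x y : G, connect (@adj G) x y.

Definition acyclic (G : sgraph) : Prop :=
  forall s : seq G, ucycle (@adj G) s -> size s < 3.

Definition tree (G : sgraph) : Prop := [/\ 0 < #|G|, connected G & acyclic G].

Record tree_decomposition (G : sgraph) := TreeDecomposition {
  td_tree : sgraph;
  td_bag : td_tree -> {set G};
  td_treeP : tree td_tree;
  td_vertex : forall v : G, exists i, v \in td_bag i;
  td_edge : forall u v : G, adj u v ->
    exists i, (u \in td_bag i) && (v \in td_bag i);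
  td_connected : forall v : G, connected (induced [set i | v \in td_bag i]) }.

(* The predecessor is truncated, so the null graph gets treewidth 0, not -1. *)
Definition width (G : sgraph) (D : tree_decomposition G) : nat :=
  (\max_(i : td_tree D) #|td_bag i|).-1.

Lemma tree_complete1 : tree (complete 1).
Proof.
split=> [|x y|s /andP[_ /card_uniqP us]]; first by rewrite card_ord.
  by rewrite (ord1 x) (ord1 y) connect0.
by rewrite -us (leq_ltn_trans (max_card _)) // card_ord.
Qed.

Definition trivial_decomposition (G : sgraph) : tree_decomposition G.
Proof.
exists (complete 1) (fun=> [set: G]); first exact: tree_complete1.
- by move=> v; exists ord0; rewrite inE.
- by move=> u v _; exists ord0; rewrite !inE.
- move=> v x y; rewrite (_ : x = y) ?connect0 //.
  by apply: val_inj; rewrite (ord1 (val x)) (ord1 (val y)).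
Defined.

Lemma has_width (G : sgraph) :
  exists k, `[< exists D : tree_decomposition G, width D = k >].
Proof.
by exists (width (trivial_decomposition G)); apply/asboolP;
  exists (trivial_decomposition G).
Qed.

(* The minimum of the widths; asbool makes the predicate boolean for ex_minn. *)
Definition treewidth (G : sgraph) : nat := ex_minn (has_width G).

(* Main.v *)
(** Cycles of distinct lengths are pairwise incomparable, so the members of [X]
    have no induced cycle (hole) of length at least some [l]; by Ramsey's theorem
    they have no [K_{s,s}] subgraph either.  Let [G] be such a graph.

    - [G] is sparse.  If the pairs in [A x B] span many edges, some vertex is
      complete to [A'] or to [B'] for a still dense pair [A' <= A], [B' <= B];
      after [2 s] such steps a [K_{s,s}] appears.
    - Sparsity bounds distances between highly connected vertices: if [x] and [y]
      cannot be separated by few vertices, Menger's theorem gives many disjoint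
      induced [x]-[y] paths, and if these are all long then, holes being short,
      every stretch of length [l] of one path touches every other path, which is
      too many edges.
    - Hence a large set of pairwise highly connected vertices yields disjoint
      short paths between all of its pairs, and by sparsity a random cyclic tuple
      of its vertices gives a long hole.
    - If [G] had no small balanced separators, then assigning to each small set
      [S] the component of [G - S] carrying most of the weight would be a haven.
      The vertices that no small set separates from the haven are few by the
      previous point.  Once they are deleted, small separators play the role of
      neighbourhoods in a graph of bounded degree, and one can push a minimal
      separator towards the haven forever, a contradiction.

    So [G] has balanced separators of bounded size, and bounded treewidth. *)

Require Import Defs.
From mathcomp Require Import all_boot zify boolp.

Set Implicit Arguments.
Unset Strict Implicit.
Unset Printing Implicit Defensive.

(** * Connectivity and induced cycles *)

(** Paths are mostly replaced by connected sets: one side of a cycle, a linkage or a connector only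
    has to be connected, and every hole built below comes from [long_hole], which takes the shortest
    paths itself. A vertex complete to one side of a dense pair must exist because otherwise
    deleting a neighbourhood costs only a constant in density. Inside two consecutive distance
    layers one can then grow an induced path and keep a dense connected rest, and each parent that
    still sees the rest must see the path. After [s] such rounds the paths supply one side of a
    [K_{s,s}]. For the random tuple with [m] values, sparsity acts as follows: all connectors
    together have [O(m^2)] vertices, hence [O(m^2)] edges, while an unwanted edge between two of
    them pins at least three entries of the tuple. So this fails with probability [O(1 / m)].
    Pushing a separator towards the haven could make it grow at each step. It does not, because the
    old separator lies within distance [l] of any one of its vertices, and the new one cuts off that
    whole ball. *)

Lemma card_bigcup_le (I T : finType) (P : pred I) (F : I -> {set T}) :
  #|\bigcup_(i | P i) F i| <= \sum_(i | P i) #|F i|.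
Proof.
elim/big_rec2: _ => [|i m U _ Um]; first by rewrite cards0.
by apply: leq_trans (leq_card_setU _ _) _; rewrite leq_add2l.
Qed.

Lemma ordS_val n (i : 'I_n) : ordS i = (if i == n.-1 :> nat then 0 else i.+1) :> nat.
Proof.
have := ltn_ord i; case: n i => [|n] i; first by rewrite ltn0.
rewrite /= ltnS leq_eqVlt; case: eqP => [->|_ /= ni]; first by rewrite modnn.
by rewrite modn_small.
Qed.

Lemma ordS_neq n (i : 'I_n) : 2 <= n -> ordS i != i.
Proof.
move=> n2; apply/eqP=> /(congr1 (@nat_of_ord n)); rewrite ordS_val.
by have := ltn_ord i; case: eqP; lia.
Qed.

Lemma ordSS_neq n (i : 'I_n) : 3 <= n -> ordS (ordS i) != i.
Proof.
move=> n3; apply/eqP=> /(congr1 (@nat_of_ord n)); rewrite !ordS_val.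
by have := ltn_ord i; case: (nat_of_ord i =P n.-1); case: eqP; lia.
Qed.

(* Boolean hypotheses about sets and edges make [lia] case split needlessly. *)
Ltac nlia := repeat match goal with
  | H : is_true (in_mem _ _) |- _ => clear H
  | H : is_true (~~ _) |- _ => clear H
  | H : forall _, _ |- _ => clear H
  end; lia.

Section Connectivity.
Variables (T : finType) (e : rel T).
Hypothesis e_sym : symmetric e.
Implicit Types (A B C U V W : {set T}) (x y z : T).

(** An induction principle serves as definition: what holds at one vertex of [U] and spreads along
    the edges inside [U] holds on all of [U]. The empty set counts as connected. *)
Definition conn U := forall x A, x \in U -> x \in A ->
  (forall a b, a \in A -> a \in U -> b \in U -> e a b -> b \in A) -> U \subset A.

Definition nbhd U := [set y | y \notin U & [exists x in U, e x y]].

Definition rest V : rel T := fun x y => [&& x \in V, y \in V & e x y].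

(** The component of [x] in the subgraph induced by [V]. For [x] outside [V] it is just [{x}], hence
    the hypothesis [x \in V] in most lemmas on it. *)
Definition cmp V x := [set y | connect (rest V) x y].

Fixpoint ball V x i :=
  if i is j.+1 then ball V x j :|: [set y in V | [exists z in ball V x j, e z y]]
  else [set x].

Lemma nbhdP U y :
  reflect (y \notin U /\ exists2 x, x \in U & e x y) (y \in nbhd U).
Proof.
rewrite inE; apply: (iffP andP) => -[yU] => [/existsP[x /andP[xU exy]]|[x xU exy]].
  by split=> //; exists x.
by split=> //; apply/existsP; exists x; rewrite xU.
Qed.

Lemma connect_in_closed (r : rel T) x y A : connect r x y -> x \in A ->
  (forall a b, a \in A -> r a b -> b \in A) -> y \in A.
Proof.
move=> /connectP[p + ->]; elim: p x => //= z p IHp x /andP[rxz rp] xA clA.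
by apply: (IHp z) => //; apply: clA xA rxz.
Qed.

Lemma rest_sym V : symmetric (rest V).
Proof. by move=> x y; rewrite /rest e_sym andbCA. Qed.

Lemma cmp_id V x : x \in cmp V x.
Proof. by rewrite inE connect0. Qed.

Lemma cmp_sub V x : x \in V -> cmp V x \subset V.
Proof.
move=> xV; apply/subsetP=> y; rewrite inE => /connect_in_closed; apply=> //.
by move=> a b _ /and3P[].
Qed.

Lemma cmp_closed V x y z : x \in V -> y \in cmp V x -> z \in V -> e y z ->
  z \in cmp V x.
Proof.
move=> xV yC zV eyz; have yV := subsetP (cmp_sub xV) _ yC.
move: yC; rewrite !inE => /connect_trans; apply.
by apply: connect1; rewrite /rest yV zV.
Qed.

Lemma conn_cmp V x : x \in V -> conn (cmp V x).
Proof.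
move=> xV z A zC zA clA; apply/subsetP=> y yC.
have zy : connect (rest V) z y.
  move: zC yC; rewrite !inE => xz xy; apply: connect_trans xy.
  by rewrite (sym_connect_sym (@rest_sym V)).
suff: y \in A :&: cmp V x by rewrite inE => /andP[].
apply: (connect_in_closed zy); first by rewrite inE zA.
move=> a b; rewrite !in_setI => /andP[aA aC] /and3P[aV bV eab].
have bC := cmp_closed xV aC bV eab.
by rewrite bC andbT (clA a b).
Qed.

Lemma conn_sub_cmp U V x : conn U -> U \subset V -> x \in U -> U \subset cmp V x.
Proof.
move=> cU UV xU; have xV := subsetP UV _ xU.
apply: (cU x) => // [|a b aC _ bU eab]; first exact: cmp_id.
by apply: cmp_closed aC _ eab => //; apply: (subsetP UV).
Qed.

Lemma cmp_nbhd V x : x \in V -> [disjoint nbhd (cmp V x) & V].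
Proof.
move=> xV; rewrite disjoint_subset; apply/subsetP=> y /nbhdP[yC [z zC ezy]].
by rewrite !inE; apply: contra yC => yV; apply: cmp_closed zC yV ezy.
Qed.

Lemma conn1 x : conn [set x].
Proof. by move=> y A /set1P-> yA _; rewrite sub1set. Qed.

Lemma connU A B x y : conn A -> conn B -> x \in A -> y \in B ->
  x = y \/ e x y -> conn (A :|: B).
Proof.
move=> cA cB xA yB xy z C zAB zC clC.
have [xC|yC] : x \in C \/ y \in C.
  case/setUP: zAB => [zA|zB]; [left | right].
    apply: (subsetP (cA z C _ _ _)) => // a b aC aA bA.
    by apply: clC aC _ _; rewrite inE ?aA ?bA.
  apply: (subsetP (cB z C _ _ _)) => // a b aC aA bA.
  by apply: clC aC _ _; rewrite inE ?aA ?bA ?orbT.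
- have AC : A \subset C.
    apply: (cA x) => // a b aC aA bA; apply: clC aC _ _; by rewrite inE ?aA ?bA.
  have yC : y \in C.
    case: xy => [<-//|]; apply: clC; by rewrite // inE ?xA ?yB ?orbT.
  rewrite subUset AC; apply: (cB y) => // a b aC aB bB.
  by apply: clC aC _ _; rewrite inE ?aB ?bB ?orbT.
have BC : B \subset C.
  apply: (cB y) => // a b aC aB bB; apply: clC aC _ _; by rewrite inE ?aB ?bB ?orbT.
have xC : x \in C.
  case: xy => [->//|exy]; apply: (clC y) => //; by rewrite ?inE ?xA ?yB ?orbT // e_sym.
rewrite subUset BC andbT; apply: (cA x) => // a b aC aA bA.
by apply: clC aC _ _; rewrite inE ?aA ?bA.
Qed.

Lemma conn_add A x y : conn A -> x \in A -> e x y -> conn (y |: A).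
Proof.
move=> cA xA exy; rewrite setUC; apply: (connU cA (@conn1 y) xA (set11 y)).
by right.
Qed.

Lemma conn_cut U A x y : conn U -> x \in U -> x \in A -> y \in U -> y \notin A ->
  exists a b, [/\ a \in U, a \in A, b \in U, b \notin A & e a b].
Proof.
move=> cU xU xA yU yA; apply: contrapT => nex.
suff /subsetP/(_ y yU): U \subset A by apply/negP.
apply: (cU x) => // a b aA aU bU eab; apply: contrapT => /negP bA.
by apply: nex; exists a, b.
Qed.

Lemma ball_id V x i : x \in ball V x i.
Proof. by elim: i => [|i IHi] /=; rewrite inE ?IHi. Qed.

Lemma ball_mono V x i j : i <= j -> ball V x i \subset ball V x j.
Proof.
elim: j => [|j IHj]; first by rewrite leqn0 => /eqP->.
rewrite leq_eqVlt => /predU1P[->//|/IHj/subset_trans]; apply; exact: subsetUl.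
Qed.

Lemma ball_sub V x i : x \in V -> ball V x i \subset V.
Proof.
move=> xV; elim: i => [|i IHi] /=; first by rewrite sub1set.
by rewrite subUset IHi; apply/subsetP=> y; rewrite inE => /andP[].
Qed.

Lemma ball_step V x i y z : y \in ball V x i -> z \in V -> e y z ->
  z \in ball V x i.+1.
Proof.
move=> yB zV eyz /=; rewrite inE; apply/orP; right; rewrite inE zV.
by apply/existsP; exists y; rewrite yB.
Qed.

Lemma ballSP V x i y : y \in ball V x i.+1 ->
  y \in ball V x i \/ y \in V /\ exists2 z, z \in ball V x i & e z y.
Proof.
move=> /setUP[|]; [by left | rewrite inE => /andP[yV /existsP[z /andP[zB ezy]]]].
by right; split=> //; exists z.
Qed.

Lemma ball_ind V x (P : nat -> T -> Prop) : P 0 x ->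
  (forall i y, P i y -> P i.+1 y) ->
  (forall i y z, P i y -> z \in V -> e y z -> P i.+1 z) ->
  forall i y, y \in ball V x i -> P i y.
Proof.
move=> P0 Pmono PS; elim=> [|i IHi] y; first by move=> /set1P->.
case/ballSP=> [/IHi/Pmono//|[yV [z /IHi Pz ezy]]]; exact: PS Pz yV ezy.
Qed.

Lemma conn_ball V x i : conn (ball V x i).
Proof.
elim: i => [|i IHi] /=; first exact: conn1.
move=> z A zB zA clA.
have xA : x \in A.
  have clA' : ball V x i \subset A -> x \in A by move/subsetP; apply; apply: ball_id.
  case/setUP: (zB) => [zB'|].
    apply: clA'; apply: (IHi z) => // a b aA aB bB; apply: clA aA _ _; by rewrite inE ?aB ?bB.
  rewrite inE => /andP[zV /existsP[w /andP[wB ewz]]].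
  have wA : w \in A.
    by apply: (clA z) => //; [rewrite inE wB | rewrite e_sym].
  apply: clA'; apply: (IHi w) => // a b aA aB bB; apply: clA aA _ _; by rewrite inE ?aB ?bB.
have BA : ball V x i \subset A.
  apply: (IHi x) => // [|a b aA aB bB]; first exact: ball_id.
  by apply: clA aA _ _; rewrite inE ?aB ?bB.
rewrite subUset BA; apply/subsetP=> y yB; have := yB.
rewrite inE => /andP[_ /existsP[w /andP[wB ewy]]].
by apply: (clA w) => //; rewrite ?(subsetP BA) // inE ?wB // yB orbT.
Qed.

Lemma conn_ball_ex U x y : conn U -> x \in U -> y \in U ->
  exists i, y \in ball U x i.
Proof.
move=> cU xU yU; suff /subsetP/(_ y yU): U \subset [set z | `[< exists i, z \in ball U x i >]].
  by rewrite inE => /asboolP.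
apply: (cU x) => // [|a b]; rewrite !inE; first by apply/asboolP; exists 0; apply: ball_id.
move=> /asboolP[i aB] _ bU eab; apply/asboolP; exists i.+1; exact: ball_step aB bU eab.
Qed.

Definition ipath (f : nat -> T) d := forall i j, i < j <= d ->
  f i != f j /\ e (f i) (f j) = (j == i.+1).

Lemma geodesic V x y d : (forall i, i < d -> y \notin ball V x i) ->
  y \in ball V x d ->
  exists f : nat -> T, [/\ f 0 = x, f d = y,
    forall i, i <= d -> f i \in ball V x i,
    forall i j, i < j <= d -> f j \notin ball V x i &
    forall i, i < d -> e (f i) (f i.+1)].
Proof.
elim: d y => [|d IHd] y yN yB.
  move/set1P: yB => ->; exists (fun=> x); split=> //.
  - by move=> i _; apply: ball_id.
  - by move=> i j; lia.
case/ballSP: yB => [yB|[yV [z zB ezy]]]; first by rewrite (negPf (yN d _)) in yB.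
have [|f [f0 fd fB fN fe]] := IHd z _ zB.
  move=> i id; apply/negP=> zB'; have /negP[] := yN i.+1 id.
  exact: ball_step zB' yV ezy.
have fE i : i <= d -> (if i == d.+1 then y else f i) = f i.
  by case: eqP => // ->; rewrite ltnn.
exists (fun i => if i == d.+1 then y else f i); split; rewrite ?eqxx //.
- move=> i; rewrite leq_eqVlt => /predU1P[->|id]; last by rewrite fE // fB.
  by rewrite eqxx; apply: ball_step zB yV ezy.
- move=> i j /andP[ij]; rewrite leq_eqVlt => /predU1P[jd|jd].
    by rewrite jd eqxx yN // -jd.
  by rewrite fE // fN // ij.
- move=> i; rewrite ltnS leq_eqVlt => /predU1P[->|id]; last by rewrite !fE ?fe // ltnW.
  by rewrite eqxx fE // fd.
Qed.

Lemma ball_ipath V x y d : x \in V -> (forall i, i < d -> y \notin ball V x i) ->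
  y \in ball V x d ->
  exists f : nat -> T, [/\ f 0 = x, f d = y, ipath f d &
    forall i, i <= d -> f i \in V].
Proof.
move=> xV yN yB; have [f [f0 fd fB fN fe]] := geodesic yN yB.
have fV i : i <= d -> f i \in V by move=> id; apply: (subsetP (ball_sub i xV)); apply: fB.
exists f; split=> // i j /andP[ij jd]; have idd := leq_trans (ltnW ij) jd; split.
  by apply: contraNneq (fN i j _) => [<-|]; rewrite ?fB ?ij.
apply/idP/eqP=> [efij|ji]; last by rewrite ji in jd *; apply: fe.
apply/eqP; rewrite eqn_leq ij andbT leqNgt; apply/negP=> ij2.
have /negP[] : f j \notin ball V x i.+1 by rewrite fN // ij2.
exact: ball_step (fB i idd) (fV j jd) efij.
Qed.

Lemma conn_ipath U x y : conn U -> x \in U -> y \in U ->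
  exists d (f : nat -> T), [/\ f 0 = x, f d = y, ipath f d,
    forall i, i <= d -> f i \in U & forall i, i < d -> y \notin ball U x i].
Proof.
move=> cU xU yU; have [i0 yB0] := conn_ball_ex cU xU yU.
have exB : exists i, y \in ball U x i by exists i0.
have yN i : i < ex_minn exB -> y \notin ball U x i.
  by case: ex_minnP => m _ mmin im; apply/negP=> /mmin; rewrite leqNgt im.
exists (ex_minn exB).
have yB : y \in ball U x (ex_minn exB) by case: ex_minnP.
have [f [f0 fd fp fU]] := ball_ipath xU yN yB.
by exists f.
Qed.

(** An induced cycle for [n >= 3]. Smaller values are degenerate: the condition is void for
    [n <= 1], and [hole 2] is an edge. *)
Definition hole n := exists c : nat -> T, forall i j, i < j < n ->
  c i != c j /\ e (c i) (c j) = (j == i.+1) || ((i == 0) && (j == n.-1)).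

Definition hole_free l := forall n, l <= n -> ~ hole n.

(* Two geodesics, one through each side, close up to an induced cycle. *)
Lemma long_hole U W x y l : conn (x |: (y |: U)) -> conn W ->
  x != y -> ~~ e x y -> x \notin U -> y \notin U -> x \in nbhd W -> y \in nbhd W ->
  (forall u w, u \in U -> w \in W -> (u != w) && ~~ e u w) ->
  y \notin ball (x |: (y |: U)) x l ->
  exists2 n, l + 3 <= n & hole n.
Proof.
move=> cU cW xy nexy xU yU /nbhdP[xW [wx wxW ewx]] /nbhdP[yW [wy wyW ewy]] UW yl.
have xV : x \in x |: (y |: U) by rewrite !inE eqxx.
have yV : y \in x |: (y |: U) by rewrite !inE eqxx orbT.
have [a [f [f0 fa fp fV fB]]] := conn_ipath cU xV yV.
have fball i : i <= a -> f i \in ball (x |: (y |: U)) x i.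
  elim: i => [|i IHi] ia; first by rewrite f0 ball_id.
  apply: ball_step (IHi (ltnW ia)) (fV _ ia) _.
  by have [_ ->] := fp i i.+1 (introT andP (conj (ltnSn i) ia)).
have la : l < a.
  rewrite ltnNge; apply: contra yl => al.
  by apply: (subsetP (ball_mono _ _ al)); rewrite -{1}fa fball.
have cW' : conn (x |: (y |: W)).
  apply: (@conn_add _ wx); rewrite ?inE ?wxW ?orbT // 1?e_sym //.
  by apply: (@conn_add _ wy) => //; rewrite e_sym.
have xV' : x \in x |: (y |: W) by rewrite !inE eqxx.
have yV' : y \in x |: (y |: W) by rewrite !inE eqxx orbT.
(* The second path runs back from [y] to [x], so that [f] followed by [g] enumerates the cycle. *)
have [b [g [g0 gb gp gV _]]] := conn_ipath cW' yV' xV'.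
have b2 : 2 <= b.
  case: b gb gp {gV} => [|[|b]] // gb gp; first by rewrite -gb g0 eqxx in xy.
  have [_] := gp 0 1 isT; rewrite g0 gb eqxx e_sym => exy.
  by rewrite exy in nexy.
have fU i : 0 < i < a -> f i \in U.
  move=> /andP[i0 ia]; have := fV i (ltnW ia); rewrite !inE.
  have [] := fp 0 i; first by rewrite i0 ltnW.
  rewrite f0 eq_sym => /negPf-> _ /=.
  by have [] := fp i a; [rewrite ia leqnn | rewrite fa => /negPf->].
have gW i : 0 < i < b -> g i \in W.
  move=> /andP[i0 ib]; have := gV i (ltnW ib); rewrite !inE.
  have [] := gp 0 i; first by rewrite i0 ltnW.
  rewrite g0 eq_sym => /negPf-> _ /=.
  by have [] := gp i b; [rewrite ib leqnn | rewrite gb => /negPf->].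
exists (a + b); first nlia.
exists (fun i => if i <= a then f i else g (i - a)) => i j /andP[ij jn].
have [ja|ja] := leqP j a.
  have ia := leq_trans (ltnW ij) ja; rewrite ia.
  have [ne ->] := fp i j (introT andP (conj ij ja)); split=> //.
  suff -> : (j == (a + b).-1) = false by rewrite andbF orbF.
  nlia.
have [ia|ia] := leqP i a; last first.
  have [|ne ->] := gp (i - a) (j - a); first nlia.
  split=> //; apply/eqP/orP; [move=> ?; left; nlia | by case; nlia].
have [i_eq|ai] := eqVneq i a.
  rewrite i_eq fa -g0; have [|ne ->] := gp 0 (j - a); first nlia.
  split=> //; apply/eqP/orP; [move=> ?; left; nlia | by case; nlia].
have [i_eq|i0] := eqVneq i 0.
  rewrite i_eq f0 -gb; have [|ne gE] := gp (j - a) b; first nlia.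
  rewrite eq_sym e_sym gE; split=> //.
  by apply/eqP/orP; [move=> ?; right; nlia | by case; nlia].
have {}ai : i < a by rewrite ltn_neqAle ai.
have {}i0 : 0 < i by rewrite lt0n.
have fiU : f i \in U by apply: fU; nlia.
have gjW : g (j - a) \in W by apply: gW; nlia.
have /andP[-> /negPf->] := UW _ _ fiU gjW; split=> //; symmetry; nlia.
Qed.

End Connectivity.

(** * Sparsity of graphs without long holes and bicliques *)

Section Density.
Variables (T : finType) (e : rel T).
Hypotheses (e_sym : symmetric e) (e_irr : irreflexive e).
Implicit Types (A B C U V W Y : {set T}) (x y z v : T).

Lemma conn_ipathU (p : nat -> T) n : (forall i, i < n -> e (p i) (p i.+1)) ->
  conn e [set z | [exists i : 'I_n.+1, z == p i]].
Proof.
elim: n => [|n IHn] pe.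
  rewrite (_ : [set _ | _] = [set p 0]); first exact: conn1.
  apply/setP=> z; rewrite !inE; apply/existsP/eqP=> [[i /eqP->]|->]; first by rewrite ord1.
  by exists ord0.
rewrite (_ : [set _ | _] = p n.+1 |: [set z | [exists i : 'I_n.+1, z == p i]]).
  apply: (@conn_add _ _ e_sym _ (p n)); last exact: pe.
    by apply: IHn => i ni; apply: pe; apply: ltnW.
  by rewrite inE; apply/existsP; exists ord_max.
apply/setP=> z; rewrite !inE; apply/existsP/orP=> [[i /eqP->]|[/eqP->|/existsP[i zi]]].
- have [->|ni] := eqVneq i ord_max; [by left | right].
  have lin : i < n.+1.
    by rewrite ltn_neqAle -ltnS ltn_ord andbT; apply: contra ni => /eqP E; apply/eqP/val_inj.
  by apply/existsP; exists (Ordinal lin).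
- by exists ord_max.
- by exists (widen_ord (leqnSn _) i).
Qed.

(** This is [long_hole] with the interior of the path as one side. As the path is induced, [p n] is
    not in the ball of radius [n - 1] around [p 0], and [n - 1 + 3 = n + 2]. *)
Lemma ipath_hole (p : nat -> T) n W : ipath e p n -> 2 <= n -> conn e W ->
  p 0 \in nbhd e W -> p n \in nbhd e W ->
  (forall i w, 0 < i < n -> w \in W -> (p i != w) && ~~ e (p i) w) ->
  exists2 m, n + 2 <= m & hole e m.
Proof.
move=> ip n2 cW p0 pn pW.
pose U := [set z | [exists i : 'I_n, (0 < i) && (z == p i)]].
have UP z : reflect (exists2 i, 0 < i < n & z = p i) (z \in U).
  rewrite inE; apply: (iffP existsP) => [[i /andP[i0 /eqP->]]|[i /andP[i0 ni] ->]].
    by exists i; rewrite // i0 ltn_ord.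
  by exists (Ordinal ni); rewrite /= i0 eqxx.
have n0 : 0 < n by apply: ltnW.
have inj i j : i < j <= n -> p i <> p j by move=> /ip[/eqP].
have [|||||||m lm hm] := @long_hole _ _ e_sym U W (p 0) (p n) n.-1 _ cW _ _ _ _ p0 pn _ _.
8: by exists m => //; lia.
- rewrite (_ : _ |: _ = [set z | [exists i : 'I_n.+1, z == p i]]).
    apply: conn_ipathU => i ni; have [|_ ->] := ip i i.+1; last exact: eqxx.
    by rewrite ltnSn.
  apply/setP=> z; rewrite !inE; apply/idP/existsP=> [|[i /eqP->]].
    case/or3P=> [/eqP->|/eqP->|]; [by exists ord0 | by exists ord_max | ].
    move=> /existsP[i /andP[_ zi]]; by exists (widen_ord (leqnSn _) i).
  have [->|i0] := posnP i; first by rewrite eqxx.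
  have [->|ni] := eqVneq (i : nat) n; first by rewrite eqxx orbT.
  have lin : i < n by have := ltn_ord i; rewrite ltnS leq_eqVlt (negPf ni).
  apply/orP; right; apply/orP; right; apply/existsP; exists (Ordinal lin).
  by rewrite /= i0 eqxx.
- by apply/eqP/inj; rewrite n0 leqnn.
- have [|_ ->] := ip 0 n; first by rewrite n0 leqnn.
  by rewrite neq_ltn n2 orbT.
- by apply/UP=> -[i /andP[i0 ni]]; apply: inj; rewrite i0 ltnW.
- by apply/UP=> -[i /andP[i0 ni] /esym]; apply: inj; rewrite ni leqnn.
- by move=> u w /UP[i i0n ->] wW; apply: pW.
- apply/negP=> pB; have : exists2 i, i <= n.-1 & p n = p i.
    move: pB; apply: (ball_ind (P := fun k z => exists2 i, i <= k & z = p i)).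
    + by exists 0.
    + by move=> k z [i ik ->]; exists i => //; apply: leq_trans ik _.
    + move=> k z w [i ik ->] wV eiw.
      have [j jn wj] : exists2 j, j <= n & w = p j.
        move: wV; rewrite !inE => /or3P[/eqP->|/eqP->|]; [by exists 0 | by exists n | ].
        by move=> /existsP[j /andP[_ /eqP->]]; exists j => //; apply: ltnW.
      exists j => //; have [//|kj] := leqP j k.+1.
      have [|_] := ip i j; first by rewrite jn andbT; apply: leq_ltn_trans ik (ltnW kj).
      by rewrite -wj eiw => /esym/eqP jE; move: kj; rewrite jE ltnS ltnNge ik.
  case=> i ni /esym; apply: inj; rewrite leqnn andbT; clear -n0 ni; lia.
Qed.

(** * Dense pairs of vertex sets *)

Definition cnt A B := #|[set p : T * T | [&& p.1 \in A, p.2 \in B & e p.1 p.2]]|.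

Lemma cntC A B : cnt A B = cnt B A.
Proof.
have swap_inj : injective (fun p : T * T => (p.2, p.1)).
  by move=> [a b] [c d] /= [-> ->].
rewrite /cnt -(card_imset _ swap_inj); congr #|pred_of_set _|.
apply/setP=> -[a b]; rewrite !inE /=; apply/imsetP/idP=> [[[c d]]|].
  by rewrite inE /= => /and3P[cA dB ecd] [-> ->]; rewrite cA dB e_sym.
by move=> /and3P[aB bA eab]; exists (b, a); rewrite // inE /= bA aB e_sym.
Qed.

Lemma cnt_cover (I : finType) (P : pred I) A B (A_ B_ : I -> {set T}) :
  (forall a b, a \in A -> b \in B -> e a b ->
    exists i, [/\ P i, a \in A_ i & b \in B_ i]) ->
  cnt A B <= \sum_(i | P i) cnt (A_ i) (B_ i).
Proof.
move=> cov; pose E A' B' := [set p : T * T | [&& p.1 \in A', p.2 \in B' & e p.1 p.2]].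
apply: (@leq_trans #|\bigcup_(i | P i) E (A_ i) (B_ i)|).
  apply/subset_leq_card/subsetP=> -[a b]; rewrite inE /= => /and3P[aA bB eab].
  have [i [Pi aA' bB']] := cov a b aA bB eab.
  by apply/bigcupP; exists i; rewrite // inE /= aA' bB'.
exact: card_bigcup_le.
Qed.

Lemma cnt_cover2 A B A1 B1 A2 B2 :
  (forall a b, a \in A -> b \in B -> e a b ->
    (a \in A1) && (b \in B1) || (a \in A2) && (b \in B2)) ->
  cnt A B <= cnt A1 B1 + cnt A2 B2.
Proof.
move=> cov; have := @cnt_cover bool xpredT A B (fun b => if b then A1 else A2)
  (fun b => if b then B1 else B2); rewrite big_bool; apply=> a b aA bB eab.
by case/orP: (cov a b aA bB eab) => /andP[]; [exists true | exists false].
Qed.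

Lemma cnt_leM A B : cnt A B <= #|A| * #|B|.
Proof.
rewrite -cardsX; apply/subset_leq_card/subsetP=> -[a b]; rewrite !inE /=.
by move=> /and3P[-> ->].
Qed.

(** Ordered pairs are counted and the sets may overlap. Comparing with the union makes this a
    condition on the average degree, which survives in some component. *)
Definition dense q A B := q * #|A :|: B| < cnt A B.

Definition biclique_free s := forall S1 S2 : {set T}, s <= #|S1| -> s <= #|S2| ->
  ~ (forall a b, a \in S1 -> b \in S2 -> e a b).

Definition mu A B V := cnt (A :&: V) (B :&: V).

Lemma mu_split A B V W1 W2 : V \subset W1 :|: W2 ->
  (forall a b, a \in W1 -> b \in W2 -> a \in V -> b \in V -> ~~ e a b) ->
  mu A B V <= mu A B (V :&: W1) + mu A B (V :&: W2).
Proof.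
move=> VW nW; apply: cnt_cover2 => a b; rewrite !inE => /andP[aA aV] /andP[bB bV] eab.
rewrite aA aV bB bV /=; have := subsetP VW a aV; have := subsetP VW b bV; rewrite !inE.
case: (boolP (a \in W1)) => aW1 /=; case: (boolP (b \in W1)) => bW1 //=.
- by move=> bW2; have := nW a b aW1 bW2 aV bV; rewrite eab.
- by move=> _ aW2; have := nW b a bW1 aW2 bV aV; rewrite e_sym eab.
- by move=> -> ->.
Qed.

(** A disconnected [V] splits into two parts without edges between them; [mu] is subadditive and
    [q * #|V|] additive over the split, so one part is dense again. *)
Lemma dense_cmp q A B V : q * #|V| < mu A B V ->
  exists C, [/\ C \subset V, conn e C, q * #|C| < mu A B C &
    forall a b, a \in C -> b \in V -> e a b -> b \in C].
Proof.
have [n] := ubnP #|V|; elim: n V => // n IHn V Vn dV.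
have [cV|ncV] := EM (conn e V); first by exists V; split.
have [x [D [xV xD clD VD]]] : exists x (D : {set T}), [/\ x \in V, x \in D,
    forall a b, a \in D -> a \in V -> b \in V -> e a b -> b \in D & ~~ (V \subset D)].
  apply: contrapT => H; apply: ncV => x D xV xD clD.
  by apply: contrapT => /negP VD; apply: H; exists x, D; split.
have [z zV zD] := subsetPn VD.
have closed W : (W == D) || (W == ~: D) -> forall a b, a \in V :&: W -> b \in V ->
    e a b -> b \in V :&: W.
  case/orP=> /eqP-> a b; rewrite !inE => /andP[aV aW] bV eab; rewrite bV.
    exact: clD eab.
  by apply: contra aW => bD; apply: clD bD bV aV _; rewrite e_sym.
have lt W : (W == D) || (W == ~: D) -> #|V :&: W| < n.
  move=> WD; rewrite ltnS in Vn; apply: leq_trans Vn; apply: proper_card.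
  rewrite properE subsetIl; apply/subsetPn; case/orP: WD => /eqP->.
    by exists z; rewrite // inE zV.
  by exists x; rewrite // !inE xV xD.
have [W WD dW] : exists2 W, (W == D) || (W == ~: D) & q * #|V :&: W| < mu A B (V :&: W).
  apply: contrapT => H.
  have H1 : mu A B (V :&: D) <= q * #|V :&: D|.
    by rewrite leqNgt; apply/negP=> H1; apply: H; exists D; rewrite ?eqxx.
  have H2 : mu A B (V :&: ~: D) <= q * #|V :&: ~: D|.
    by rewrite leqNgt; apply/negP=> H2; apply: H; exists (~: D); rewrite ?eqxx ?orbT.
  have : mu A B V <= mu A B (V :&: D) + mu A B (V :&: ~: D).
    apply: mu_split; first by rewrite setUCr subsetT.
    move=> a b aD; rewrite inE => bD aV bV; apply: contra bD; exact: clD.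
  move: dV; rewrite -(cardsID D V) mulnDr setDE; lia.
have [C [CW cC dC clC]] := IHn _ (lt W WD) dW.
exists C; split=> //; first by apply: subset_trans CW (subsetIl _ _).
move=> a b aC bV eab; apply: clC (aC) _ (eab); apply: closed WD _ _ _ bV eab.
exact: (subsetP CW).
Qed.

(* If no vertex of [D0] is complete to one side of a dense pair, deleting a
   whole neighbourhood loses only few edges. *)
Section NoDominatingVertex.
Variables (d : nat) (D0 : {set T}) (A B : {set T}).
Definition sparse_nbhds := forall v A' B', v \in D0 -> A' \subset A -> B' \subset B ->
  (forall a, a \in A' -> e v a) \/ (forall b, b \in B' -> e v b) ->
  cnt A' B' <= d * #|A' :|: B'|.
Hypothesis NP : sparse_nbhds.

(** A lost edge has an end adjacent to [v]. The edges with such an end in [A] span a pair with one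
    side complete to [v], so there are at most [d * #|V|] of them; likewise for [B]. This is the
    [2 * d] paid. *)
Lemma mu_del q V v : v \in D0 -> (q + 2 * d) * #|V| < mu A B V ->
  q * #|[set z in V | ~~ e v z]| < mu A B [set z in V | ~~ e v z].
Proof.
move=> vD dV; set V' := [set z in V | _].
have V'V : V' \subset V by apply/subsetP=> z; rewrite inE => /andP[].
pose N := [set z | e v z].
have s1 X Y : (X :&: V :|: Y :&: V) \subset V by rewrite subUset !subsetIr.
have H1 : cnt (A :&: V :&: N) (B :&: V) <= d * #|V|.
  apply: leq_trans (NP vD _ _ _) _; rewrite ?subsetIl //; last first.
  - rewrite leq_mul2l; apply/orP; right; apply: subset_leq_card.
    by apply: subset_trans (setSU _ (subsetIl _ _)) (s1 _ _).
  - by left=> a; rewrite !inE => /andP[].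
  - by apply: subset_trans (subsetIl _ _) (subsetIl _ _).
have H2 : cnt (A :&: V) (B :&: V :&: N) <= d * #|V|.
  apply: leq_trans (NP vD _ _ _) _; rewrite ?subsetIl //; last first.
  - rewrite leq_mul2l; apply/orP; right; apply: subset_leq_card.
    by apply: subset_trans (setUS _ (subsetIl _ _)) (s1 _ _).
  - by right=> a; rewrite !inE => /andP[].
  - by apply: subset_trans (subsetIl _ _) (subsetIl _ _).
have H3 : mu A B V <= mu A B V' +
    (cnt (A :&: V :&: N) (B :&: V) + cnt (A :&: V) (B :&: V :&: N)).
  have := @cnt_cover 'I_3 xpredT (A :&: V) (B :&: V)
    (fun i => if i == 0 :> nat then A :&: V' else if i == 1 :> nat then A :&: V :&: N else A :&: V)
    (fun i => if i == 0 :> nat then B :&: V' else if i == 1 :> nat then B :&: V else B :&: V :&: N).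
  rewrite !big_ord_recl big_ord0 addn0 /=; apply=> a b; rewrite !inE.
  move=> /andP[aA aV] /andP[bB bV] eab.
  have [va|nva] := boolP (e v a).
    by exists (@Ordinal 3 1 isT); rewrite /= !inE aA aV va bB bV.
  have [vb|nvb] := boolP (e v b).
    by exists (@Ordinal 3 2 isT); rewrite /= !inE aA aV vb bB bV.
  by exists (@Ordinal 3 0 isT); rewrite /= !inE aA aV nva nvb bB bV.
have := subset_leq_card V'V; move: dV H1 H2 H3; rewrite mulnDl.
move: (mu _ _ _) (mu _ _ _) (cnt _ _) (cnt _ _) => m1 m2 c1 c2 H H1 H2 H3 le.
have : q * #|V'| <= q * #|V| by rewrite leq_mul2l le orbT.
lia.
Qed.

(** Deleting the neighbours of [v] leaves a dense component [C']. As [C] is connected, some edge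
    leaves [C'] inside [C]; its outer end [p] must have been deleted, so it is adjacent to [v] and
    continues the path. *)
Lemma gyarfas_step q C v : v \in D0 -> conn e C -> v \in nbhd e C ->
  (q + 2 * d) * #|C| < mu A B C ->
  exists C' p, [/\ C' \subset C, conn e C', q * #|C'| < mu A B C',
    (forall c, c \in C' -> ~~ e v c) & [/\ p \in C, e v p & p \in nbhd e C']].
Proof.
move=> vD cC /nbhdP[vC [z zC ezv]] dC.
have [C' [C'V cC' dC' clC']] := dense_cmp (mu_del vD dC).
have C'C : C' \subset C.
  by apply: subset_trans C'V _; apply/subsetP=> w; rewrite inE => /andP[].
have nv c : c \in C' -> ~~ e v c by move=> /(subsetP C'V); rewrite inE => /andP[].
have [c cC'0] : exists c, c \in C'.
  apply/set0Pn; apply/negP=> /eqP C0; move: dC'; rewrite C0 cards0 muln0 /mu !setI0.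
  rewrite /cnt lt0n => /negP[]; rewrite cards_eq0; apply/eqP/setP=> -[a b].
  by rewrite !inE.
have zC' : z \notin C' by apply/negP=> /nv; rewrite e_sym ezv.
have [a [p [aC aC' pC pC' eap]]] := conn_cut cC (subsetP C'C _ cC'0) cC'0 zC zC'.
exists C', p; split=> //; split=> //; last by apply/nbhdP; split=> //; exists a.
apply: contraNT pC' => nvp; apply: clC' (aC') _ eap; by rewrite inE pC.
Qed.

(** The path is induced because each step keeps only non-neighbours of the current vertex, and later
    vertices beyond the next one come from there. *)
Lemma gyarfas_path n q C v : C \subset D0 -> v \in D0 -> conn e C -> v \in nbhd e C ->
  (q + 2 * d * n) * #|C| < mu A B C ->
  exists C' (p : nat -> T), [/\ C' \subset C, conn e C', q * #|C'| < mu A B C',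
    p 0 = v & [/\ ipath e p n, p n \in nbhd e C',
      forall i, 0 < i <= n -> p i \in C :\: C' &
      forall i c, i < n -> c \in C' -> ~~ e (p i) c]].
Proof.
elim: n C v => [|n IHn] C v CD vD cC vC dC.
  exists C, (fun=> v); rewrite muln0 addn0 in dC; split=> //; split=> //; last by case.
  by move=> i j; lia.
have [|C1 [p1 [C1C cC1 dC1 nvC1 [p1C evp1 p1C1]]]] :=
    @gyarfas_step (q + 2 * d * n) C v vD cC vC.
  by move: dC; rewrite mulnS; congr (_ * _ < _); lia.
have [C' [p [C'C1 cC' dC' p0 [ip pn pC pC']]]] :=
  IHn C1 p1 (subset_trans C1C CD) (subsetP CD _ p1C) cC1 p1C1 dC1.
have vnC : v \notin C by case/nbhdP: vC.
have pC1 i : i <= n -> p i \in C :\: C'.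
  case: i => [_|i ni]; first rewrite p0 inE p1C andbT.
    by case/nbhdP: p1C1 => + _; apply: contra; apply: (subsetP C'C1).
  by have := pC i.+1 ni; rewrite !inE => /andP[-> /(subsetP C1C)].
exists C', (fun i => if i is j.+1 then p j else v); split=> //.
  by apply: subset_trans C'C1 C1C.
split=> //.
- case=> [|i] [//|j] /=; last by rewrite !ltnS eqSS => /ip.
  move=> jn; have := pC1 j jn; rewrite inE => /andP[_ pjC].
  split; first by apply: contraNneq vnC => ->.
  case: j jn pjC => [|j] jn pjC; first by rewrite p0 evp1.
  have := pC j.+1 jn; rewrite inE => /andP[_ pj1]; rewrite eqSS.
  by apply/negbTE/nvC1.
- by case=> // i /pC1.
- by case=> [|i] c; [move=> _ /(subsetP C'C1)/nvC1 | rewrite ltnS; apply: pC'].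
Qed.

End NoDominatingVertex.

End Density.

Section DensityCore.
Variables (T : finType) (e : rel T).
Hypothesis e_sym : symmetric e.
Implicit Types (A B C U V W Y P : {set T}) (x y z v : T).

Lemma cnt0 A B : 0 < cnt e A B -> exists a b, [/\ a \in A, b \in B & e a b].
Proof.
rewrite /cnt card_gt0 => /set0Pn[[a b]]; rewrite inE /= => /and3P[aA bB eab].
by exists a, b.
Qed.

Lemma pigeonhole_nbhd l m P Y : 0 < m -> #|P| <= l -> 0 < l -> m * l <= #|Y| ->
  (forall y, y \in Y -> exists2 p, p \in P & e p y) ->
  exists2 p, p \in P & m <= #|[set y in Y | e p y]|.
Proof.
move=> m0 Pl l0 mY YP; apply: contrapT => H.
suff : #|Y| <= m.-1 * l by nia.
apply: (@leq_trans (\sum_(p in P) #|[set y in Y | e p y]|)).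
  apply: (@leq_trans #|\bigcup_(p in P) [set y in Y | e p y]|).
    apply/subset_leq_card/subsetP=> y yY; have [p pP epy] := YP y yY.
    by apply/bigcupP; exists p; rewrite // inE yY.
  exact: card_bigcup_le.
apply: (@leq_trans (\sum_(p in P) m.-1)).
  apply: leq_sum => p pP; rewrite -ltnS (prednK m0) ltnNge.
  by apply/negP=> mp; apply: H; exists p.
by rewrite sum_nat_const mulnC leq_mul2l Pl orbT.
Qed.

(** * A layer with its parents [Y] and the connected set [Tr] behind them *)

Section Core.
Variables (l s d : nat) (A B Tr Y : {set T}).
Hypotheses (l2 : 2 <= l) (s0 : 0 < s).
Hypotheses (HF : hole_free e l) (NK : biclique_free e s).
Hypothesis NP : sparse_nbhds e d (A :|: B :|: Y) A B.
Hypothesis conn_Tr : conn e Tr.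
Hypothesis Tr_away : forall t v, t \in Tr -> v \in A :|: B -> (v != t) && ~~ e v t.
Hypothesis Y_Tr : Y \subset nbhd e Tr.
Hypothesis Y_away : [disjoint Y & A :|: B].
Hypothesis parent : forall a, a \in A -> exists2 y, y \in Y & e y a.

(* Follow an induced path from a parent of [C] into [C], as in Gyarfas' argument;
   a parent of the surviving dense piece [C'] that is not adjacent to the path
   would close a long hole through [C'] and [Tr]. *)
Lemma parents_round q C : C \subset A :|: B -> conn e C ->
  (q + 2 * d * l) * #|C| < mu e A B C ->
  exists C' P, [/\ C' \subset C, conn e C', q * #|C'| < mu e A B C' &
    [/\ P \subset C :\: C', #|P| <= l &
      forall y c, y \in Y -> c \in C' -> e y c -> exists2 p, p \in P & e p y]].
Proof.
move=> CV cC dC; have [a [b [aAC _ _]]] := cnt0 (leq_ltn_trans (leq0n _) dC).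
have [aA aC] := setIP aAC; have [y0 y0Y ey0a] := parent aA.
have YC y : y \in Y -> y \notin C.
  move=> yY; have := disjointFr Y_away yY; apply: contraFN; exact: (subsetP CV).
have y0C : y0 \in nbhd e C by apply/nbhdP; split; [exact: YC | exists a; rewrite // e_sym].
have CD : C \subset A :|: B :|: Y by apply: subset_trans CV (subsetUl _ _).
have y0D : y0 \in A :|: B :|: Y by rewrite inE y0Y orbT.
have [C' [p [C'C cC' dC' p0 [ip pn pC pC']]]] := gyarfas_path e_sym NP CD y0D cC y0C dC.
exists C', [set p i | i : 'I_l & 0 < i]; split=> //; split.
- apply/subsetP=> z /imsetP[i]; rewrite inE => i0 ->; apply: pC; by rewrite i0 ltnW.
- apply: leq_trans (leq_imset_card _ _) _; apply: leq_trans (max_card _) _.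
  by rewrite card_ord.
move=> y c yY cC'0 eyc; apply: contrapT => H.
have [/nbhdP[y0Tr [t0 t0Tr et0]] /nbhdP[yTr [t tTr ety]]] :=
  (subsetP Y_Tr _ y0Y, subsetP Y_Tr _ yY).
have C'V : C' \subset A :|: B := subset_trans C'C CV.
have /nbhdP[plC' [c' c'C' ec']] := pn.
have plV : p l \in A :|: B.
  have : p l \in C :\: C' by apply: pC; rewrite leqnn (leq_trans _ l2).
  by rewrite inE => /andP[_ /(subsetP CV)].
have VY z y' : z \in A :|: B -> y' \in Y -> z != y'.
  by move=> zV y'Y; apply: contraTneq zV => ->; rewrite (disjointFr Y_away).
have y0y : y0 != y.
  apply: contraTneq eyc => <-; rewrite -p0; apply: pC' cC'0; exact: leq_trans l2.
(* This set closes the path: it reaches [y0] through [Tr] and [p l] through [C'], while [y] avoids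
   the interior of the path by assumption. *)
have cW : conn e ((y |: C') :|: Tr).
  apply: (connU e_sym _ conn_Tr (setU11 _ _) tTr); last by right; rewrite e_sym.
  by apply: (conn_add e_sym cC' cC'0); rewrite e_sym.
have [||i w /andP[i0 il] wW|m lm] := ipath_hole e_sym ip l2 cW.
- rewrite p0; apply/nbhdP; split; last by exists t0; rewrite // inE t0Tr orbT.
  rewrite !inE negb_or y0Tr andbT negb_or y0y /=.
  by apply/negP=> /(subsetP C'C); apply/negP/YC.
- apply/nbhdP; split; last by exists c'; rewrite // !inE c'C' orbT.
  rewrite !inE !negb_or plC' (VY _ _ plV yY) /=.
  by apply/negP=> plT; have := Tr_away plT plV; rewrite eqxx.
- have piC : p i \in C :\: C' by apply: pC; rewrite i0 ltnW.
  have [piC1 piC2] := setDP piC; have piV := subsetP CV _ piC1.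
  case/setUP: wW => [/setU1P[->|wC']|wT]; last exact: Tr_away.
    rewrite (VY _ _ piV yY) /=; apply/negP=> epy; apply: H; exists (p i) => //.
    by apply/imsetP; exists (Ordinal il); rewrite ?inE.
  rewrite pC' // andbT; by apply: contraNneq piC2 => ->.
- apply: HF; apply: leq_trans lm; exact: leq_addr.
Qed.

(** A parent that still sees the final [C'] has a neighbour on the path of every round. Each path
    offers at most [l] candidates, so pigeonhole keeps a fraction [1 / l] of the parents with a
    common neighbour, and [s * l ^ n] of them leave [s]. Different rounds give different vertices,
    since each round takes its path from what it discards. *)
Lemma parents_rounds n q C : C \subset A :|: B -> conn e C ->
  (q + n * (2 * d * l)) * #|C| < mu e A B C ->
  exists C', [/\ C' \subset C, conn e C', q * #|C'| < mu e A B C' &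
    forall Y', Y' \subset Y -> (forall y, y \in Y' -> exists2 c, c \in C' & e y c) ->
      s * l ^ n <= #|Y'| ->
      exists P Y'', [/\ P \subset C :\: C', #|P| = n, Y'' \subset Y', s <= #|Y''| &
        forall p y, p \in P -> y \in Y'' -> e p y]].
Proof.
elim: n C => [|n IHn] C CV cC dC.
  exists C; rewrite mul0n addn0 in dC; split=> // Y' Y'Y _; rewrite expn0 muln1 => sY.
  by exists set0, Y'; split; rewrite ?sub0set ?cards0 // => p y; rewrite inE.
have [|C1 [P1 [C1C cC1 dC1 [P1C P1l P1Y]]]] :=
    @parents_round (q + n * (2 * d * l)) C CV cC.
  by move: dC; rewrite mulSn; congr (_ * _ < _); lia.
have [C' [C'C1 cC' dC' HC']] := IHn C1 (subset_trans C1C CV) cC1 dC1.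
have C'C := subset_trans C'C1 C1C.
exists C'; split=> // Y' Y'Y Y'C' sY.
have l0 : 0 < l by apply: ltnW.
have [||y yY0|p pP sp] := @pigeonhole_nbhd l (s * l ^ n) P1 Y' _ P1l l0.
- by rewrite muln_gt0 s0 expn_gt0 l0.
- by rewrite -mulnA -expnSr.
- have [c cC0 eyc] := Y'C' y yY0.
  exact: P1Y (subsetP Y'Y _ yY0) (subsetP C'C1 _ cC0) eyc.
have [||P [Y'' [PC Pn Y''Y sY'' PY'']]] := HC' [set y in Y' | e p y] _ _ sp.
- by apply: subset_trans Y'Y; apply/subsetP=> z; rewrite inE => /andP[].
- by move=> y; rewrite inE => /andP[/Y'C'].
have [pC pC1] := setDP (subsetP P1C _ pP).
exists (p |: P), Y''; split=> //.
- rewrite subUset sub1set inE pC andbT; apply/andP; split.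
    by apply: contra pC1; apply: (subsetP C'C1).
  by apply: subset_trans PC _; apply: setSD.
- rewrite cardsU1 Pn; case: (boolP (p \in P)) => // /(subsetP PC).
  by rewrite inE (negPf pC1) andbF.
- by apply: subset_trans Y''Y _; apply/subsetP=> z; rewrite inE => /andP[].
- move=> p' y /setU1P[->|p'P] yY'; last exact: PY''.
  by have := subsetP Y''Y y yY'; rewrite inE => /andP[].
Qed.

(** The second summand pays for [s] rounds with paths of length [l]. The first is left over, and is
    too much for fewer than [s * l ^ s] parents that account for [d * #|C'|] edges each. *)
Definition core_density := s * l ^ s * d + s * (2 * d * l).

(* Many surviving parents give a [K_{s,s}] with the paths of the [s] rounds, while
   one of few surviving parents is adjacent to too much of the dense piece. *)
Lemma core_not_dense : ~ dense e core_density A B.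
Proof.
move=> dAB; have : core_density * #|A :|: B| < mu e A B (A :|: B).
  by rewrite /mu (setIidPl (subsetUl A B)) (setIidPl (subsetUr A B)).
move=> /(dense_cmp e_sym)[C [CV cC dC _]].
have [C' [C'C cC' dC' HC']] := parents_rounds CV cC dC.
pose Ys := [set y in Y | [exists c in C', e y c]].
have YsY : Ys \subset Y by apply/subsetP=> y; rewrite inE => /andP[].
have YsC' y : y \in Ys -> exists2 c, c \in C' & e y c.
  by rewrite inE => /andP[_ /existsP[c /andP[]]]; exists c.
have [sY|Ys_small] := leqP (s * l ^ s) #|Ys|.
  have [P [Y'' [_ Ps _ sY'' PY'']]] := HC' Ys YsY YsC' sY.
  by apply: (NK (S1 := P) (S2 := Y'')) => //; rewrite Ps.
have : mu e A B C' <= \sum_(y in Ys) cnt e (A :&: C' :&: [set a | e y a]) (B :&: C').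
  apply: cnt_cover => a b aAC bBC eab; have [aA aC] := setIP aAC.
  have [y yY eya] := parent aA; exists y; split=> //; last by rewrite in_setI aAC inE.
  by rewrite inE yY; apply/existsP; exists a; rewrite aC.
have : \sum_(y in Ys) cnt e (A :&: C' :&: [set a | e y a]) (B :&: C') <=
    \sum_(y in Ys) d * #|C'|.
  apply: leq_sum => y /(subsetP YsY) yY.
  have yD : y \in A :|: B :|: Y by rewrite inE yY orbT.
  apply: leq_trans (NP yD _ _ _) _.
  - by rewrite -setIA subsetIl.
  - by rewrite subsetIl.
  - by left=> a; rewrite !inE => /andP[].
  - rewrite leq_mul2l; apply/orP; right; apply: subset_leq_card.
    by rewrite subUset subsetIr -setIA setICA subsetIl.
rewrite sum_nat_const => le1 le2; move: (leq_trans dC' (leq_trans le2 le1)).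
rewrite -mulnA ltnNge => /negP[]; rewrite leq_mul2r (ltnW Ys_small) orbT //.
Qed.

End Core.
End DensityCore.

Section DensityMain.
Variables (T : finType) (e : rel T).
Hypotheses (e_sym : symmetric e) (e_irr : irreflexive e).
Implicit Types (A B C U V W Y P : {set T}) (x y z v : T).
Variables (l s : nat).
Hypotheses (l2 : 2 <= l) (s0 : 0 < s).
Hypotheses (HF : hole_free e l) (NK : biclique_free e s).

Lemma levels C r : conn e C -> r \in C ->
  exists lev : T -> nat, forall y, y \in C ->
    forall i, (y \in ball e C r i) = (lev y <= i).
Proof.
move=> cC rC; suff H : forall y, exists i, y \in C ->
    forall j, (y \in ball e C r j) = (i <= j).
  by have [lev levP] := choice H; exists lev.
move=> y; have [yC|] := boolP (y \in C); last by exists 0.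
have exi := conn_ball_ex cC rC yC; case: (ex_minnP exi) => m yB mmin.
exists m => _ j; apply/idP/idP=> [/mmin//|mj].
exact: (subsetP (ball_mono e _ _ mj)).
Qed.

(** * Distance layers of a connected set *)

Section Layers.
Variables (d : nat) (A B C : {set T}) (r : T) (lev : T -> nat).
Hypothesis rC : r \in C.
Hypothesis levP : forall y, y \in C ->
  forall i, (y \in ball e C r i) = (lev y <= i).

Let L i := [set y in C | lev y == i].
Let H i := [set y in C | (lev y == i) || (lev y == i.+1)].

Lemma lev_edge a b : a \in C -> b \in C -> e a b -> lev b <= (lev a).+1.
Proof.
move=> aC bC eab; rewrite -levP //; apply: ball_step bC eab.
by rewrite levP.
Qed.

Lemma lev_parent y i : y \in C -> lev y = i.+1 ->
  exists2 z, z \in L i & e z y.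
Proof.
move=> yC yi; have : y \in ball e C r i.+1 by rewrite levP // yi.
case/ballSP=> [|[_ [z zB ezy]]]; first by rewrite levP // yi ltnn.
have zC : z \in C by apply: subsetP zB; apply: ball_sub.
exists z => //; rewrite inE zC eqn_leq -[lev z <= i]levP // zB /=.
by have := lev_edge zC yC ezy; rewrite yi.
Qed.

(** For [i >= 2] this is [core_not_dense] with layer [i - 1] as parents and the ball of radius
    [i - 2] as [Tr]. Layer 0 is [{r}], and layer 1 is complete to [r], so that [sparse_nbhds]
    applies directly. *)
Lemma layers_not_dense i : 0 < d -> sparse_nbhds e d C A B ->
  ~ dense e (core_density l s d) (A :&: L i) (B :&: H i).
Proof.
move=> d0 NP dAB; have dcore : d <= core_density l s d.
  rewrite /core_density; have : 0 < s * l by rewrite muln_gt0 s0 ltnW.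
  by move: (s * l ^ s * d) => k; nia.
have LC j : L j \subset C by apply/subsetP=> y; rewrite inE => /andP[].
have HC j : H j \subset C by apply/subsetP=> y; rewrite inE => /andP[].
have levH y : y \in (A :&: L i) :|: (B :&: H i) -> y \in C /\ i <= lev y.
  rewrite !inE => /orP[/and3P[_ yC /eqP->]|/and3P[_ yC /orP[]/eqP->]] //.
case: i dAB levH => [|[|i]] dAB levH.
- have [a [_ [/setIP[aA aL] _ _]]] := cnt0 (leq_ltn_trans (leq0n _) dAB).
  have Lr y : y \in L 0 -> y = r.
    rewrite inE => /andP[yC /eqP y0]; apply/set1P; change (y \in ball e C r 0).
    by rewrite levP // y0.
  have := leq_trans dAB (cnt_leM _ _ _); apply/negP; rewrite -leqNgt.
  have c1 : #|A :&: L 0| <= 1.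
    rewrite -(cards1 r); apply/subset_leq_card/subsetP=> y /setIP[_ /Lr->].
    by rewrite inE.
  apply: leq_trans (leq_mul c1 (leqnn _)) _; apply: leq_mul.
    exact: leq_trans dcore.
  by apply: subset_leq_card; apply: subsetUr.
- have := dAB; apply/negP; rewrite -leqNgt; apply: leq_trans (NP r _ _ rC _ _ _) _.
  + exact: subsetIl.
  + exact: subsetIl.
  + left=> a /setIP[_]; rewrite inE => /andP[aC /eqP a1].
    have [z] := lev_parent aC a1; rewrite inE => /andP[zC /eqP z0] eza.
    suff <- : z = r by [].
    by apply/set1P; change (z \in ball e C r 0); rewrite levP // z0.
  + by rewrite leq_mul2r dcore orbT.
apply: (@core_not_dense _ _ e_sym l s d (A :&: L i.+2) (B :&: H i.+2)
  (ball e C r i) (L i.+1)) => //.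
- move=> v A' B' vD A'A B'B; apply: NP.
  + case/setUP: vD => [/levH[]//|]; exact: (subsetP (LC _)).
  + by apply: subset_trans A'A (subsetIl _ _).
  + by apply: subset_trans B'B (subsetIl _ _).
- exact: conn_ball.
- move=> t v tB /levH[vC iv]; have tC := subsetP (ball_sub _ _ rC) _ tB.
  have ti : lev t <= i by rewrite -levP.
  apply/andP; split; first by apply: contraTneq iv => ->; rewrite -ltnNge ltnS ltnW.
  apply/negP; rewrite e_sym => etv; have := lev_edge tC vC etv; lia.
- apply/subsetP=> y; rewrite inE => /andP[yC /eqP yi]; apply/nbhdP.
  rewrite levP // yi ltnn; split=> //; have [z] := lev_parent yC yi.
  by rewrite inE => /andP[zC /eqP zi] ezy; exists z; rewrite // levP // zi.
- apply/pred0P=> y /=; apply/negbTE/negP=> /andP[yL /levH[_]].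
  by move: yL; rewrite inE => /andP[_ /eqP->]; rewrite ltnn.
- move=> a /setIP[_]; rewrite inE => /andP[aC /eqP ai]; exact: lev_parent.
Qed.

End Layers.

Lemma sparse_nbhdsC d D0 A B : sparse_nbhds e d D0 A B -> sparse_nbhds e d D0 B A.
Proof.
move=> NP v A' B' vD A'B B'A dom; rewrite cntC // setUC; apply: NP vD B'A A'B _.
by case: dom; [right | left].
Qed.

(** One factor 2 is for the two orders of a pair of layers, the other comes from [sum_layers];
    [d.+1] leaves room for removing the dominating vertex from the pair. *)
Definition step_density d := 4 * core_density l s d.+1.

Lemma sum_layers C (lev : T -> nat) n : (forall y, y \in C -> lev y < n) ->
  \sum_(i < n) #|[set y in C | (lev y == i) || (lev y == i.+1)]| <= 2 * #|C|.
Proof.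
move=> levn; rewrite -sum1_card mulnC -[X in _ <= X]/(_ * 2) big_distrl /=.
under eq_bigr do rewrite -sum1_card big_mkcond /=.
rewrite exchange_big /= [X in _ <= X]big_mkcond /=; apply: leq_sum => y _.
rewrite -big_mkcond /= sum1_card.
pose Q := [pred i : 'I_n | (y \in C) && ((lev y == i) || (lev y == i.+1))].
apply: (@leq_trans #|Q|).
  apply/subset_leq_card/subsetP=> i iy.
  have {iy} : y \in [set y0 in C | (lev y0 == i) || (lev y0 == i.+1)] by [].
  by rewrite !inE.
case: (boolP (y \in C)) => yC; last first.
  by rewrite leqn0; apply/eqP; apply: eq_card0 => i; rewrite !inE (negPf yC).
(* Only [lev y] and its predecessor are possible, so one boolean identifies [i]. *)
have inj : {in Q &, injective (fun i : 'I_n => lev y == i)}.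
  move=> i j; rewrite !inE yC /= => iy jy E; apply: val_inj => /=; lia.
apply: (@leq_trans #|{: bool}|); last by rewrite card_bool.
by rewrite -(card_in_image inj); apply: max_card.
Qed.

(** Otherwise [sparse_nbhds] holds. In a dense component every edge stays in a layer or joins
    consecutive ones, hence lies between some [L i] and [H i]; these pairs are not dense, and
    together too small to carry all edges. *)
Lemma density_step d A B : dense e (step_density d) A B ->
  exists v A' B', [/\ v \in A :|: B, A' \subset A, B' \subset B, dense e d A' B' &
    v \notin A' :|: B' /\
    ((forall a, a \in A' -> e v a) \/ (forall b, b \in B' -> e v b))].
Proof.
move=> dAB; apply: contrapT => nex.
have NP : sparse_nbhds e d.+1 (A :|: B) A B.
  move=> v A' B' vD A'A B'B dom; rewrite leqNgt; apply/negP=> dA'B'; apply: nex.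
  (* [v] may lie in the side to which it need not be complete. Removing it loses at most [#|A1|]
     edges, which the drop from [d.+1] to [d] covers. *)
  have step A1 B1 : d.+1 * #|A1 :|: B1| < cnt e A1 B1 -> dense e d A1 (B1 :\ v).
    rewrite /dense => dd; have le1 : cnt e A1 B1 <= cnt e A1 (B1 :\ v) + cnt e A1 [set v].
      apply: cnt_cover2 => a b -> bB _; rewrite !inE bB andbT /=.
      by case: eqP => //=; rewrite ?andbT.
    have le2 : cnt e A1 [set v] <= #|A1 :|: B1|.
      apply: leq_trans (cnt_leM _ _ _) _; rewrite cards1 muln1.
      by apply: subset_leq_card; apply: subsetUl.
    have le3 : #|A1 :|: B1 :\ v| <= #|A1 :|: B1|.
      by apply: subset_leq_card; apply: setUS; apply: subD1set.
    nia.
  have irr W : (forall a, a \in W -> e v a) -> v \notin W.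
    by move=> dW; apply/negP=> /dW; rewrite e_irr.
  case: dom => dom.
    exists v, A', (B' :\ v); split=> //; last 2 first.
    - exact: step.
    - by split; [rewrite !inE eqxx orbF irr | left].
    by apply: subset_trans B'B; apply: subD1set.
  exists v, (A' :\ v), B'; split=> //.
  - by apply: subset_trans A'A; apply: subD1set.
  - by rewrite /dense setUC cntC //; apply: step; rewrite setUC cntC.
  - by split; [rewrite !inE eqxx irr | right].
have : step_density d * #|A :|: B| < mu e A B (A :|: B).
  by rewrite /mu (setIidPl (subsetUl A B)) (setIidPl (subsetUr A B)).
move=> /(dense_cmp e_sym)[C [CV cC dC _]].
have [a [b [/setIP[_ aC] _ _]]] := cnt0 (leq_ltn_trans (leq0n _) dC).
have [lev levP] := levels cC aC.
have NPC : sparse_nbhds e d.+1 C A B.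
  by move=> v A' B' vC; apply: NP; apply: (subsetP CV).
pose n := (\max_(y in C) lev y).+1.
have levn y : y \in C -> lev y < n by move=> yC; rewrite ltnS; apply: leq_bigmax_cond.
pose L i := [set y in C | lev y == i].
pose H i := [set y in C | (lev y == i) || (lev y == i.+1)].
have LH i (D E : {set T}) : #|D :&: L i :|: E :&: H i| <= #|H i|.
  apply: subset_leq_card; rewrite subUset subsetIr andbT.
  by apply/subsetP=> y; rewrite !inE => /and3P[_ -> ->].
pose q := core_density l s d.+1.
have n1 i : cnt e (A :&: L i) (B :&: H i) <= q * #|H i|.
  have := layers_not_dense (d := d.+1) (i := i) aC levP isT NPC.
  move/negP; rewrite -leqNgt => /leq_trans; apply.
  by rewrite leq_mul2l LH orbT.
have n2 i : cnt e (A :&: H i) (B :&: L i) <= q * #|H i|.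
  have := layers_not_dense (d := d.+1) (i := i) aC levP isT (sparse_nbhdsC NPC).
  move/negP; rewrite -leqNgt cntC // => /leq_trans; apply.
  by rewrite leq_mul2l LH orbT.
have : mu e A B C <= \sum_(ib : 'I_n * bool)
   cnt e (A :&: if ib.2 then L ib.1 else H ib.1) (B :&: if ib.2 then H ib.1 else L ib.1).
  apply: cnt_cover => u v /setIP[uA uC] /setIP[vB vC] euv.
  have le1 := lev_edge levP uC vC euv.
  have le2 : lev u <= (lev v).+1 by apply: (lev_edge levP) => //; rewrite e_sym.
  have [uv|vu] := leqP (lev u) (lev v).
    exists (Ordinal (levn u uC), true); rewrite !inE /= uA uC vB vC eqxx; split=> //=.
    lia.
  exists (Ordinal (levn v vC), false); rewrite !inE /= uA uC vB vC eqxx; split=> //=.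
  lia.
rewrite -(pair_bigA _ (fun (i : 'I_n) (b : bool) =>
  cnt e (A :&: if b then L i else H i) (B :&: if b then H i else L i))) /=.
under eq_bigr do rewrite big_bool /=.
apply/negP; rewrite -ltnNge; apply: leq_ltn_trans dC.
apply: (@leq_trans (\sum_(i < n) 2 * q * #|H i|)).
  by apply: leq_sum => i _; have := n1 i; have := n2 i; lia.
have sumH : \sum_(i < n) #|H i| <= 2 * #|C| := sum_layers levn.
rewrite -big_distrr /= /step_density -/q.
apply: leq_trans (leq_mul (leqnn _) sumH) _; lia.
Qed.

Definition density_const := iter (2 * s) step_density s.

(** [P] and [Q] collect the vertices found so far. After [2 * s] steps one of them has [s] elements,
    and the density [s] that remains forces both [#|A|] and [#|B|] above [s], as
    [cnt e A B <= #|A| * #|B|]. *)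
Lemma dense_complete n A B P (Q : {set T}) : dense e (iter n step_density s) A B ->
  (forall p a, p \in P -> a \in A -> e p a) ->
  (forall q b, q \in Q -> b \in B -> e q b) ->
  [disjoint P :|: Q & A :|: B] -> 2 * s <= #|P| + #|Q| + n -> False.
Proof.
elim: n A B P Q => [|n IHn] A B P Q /= dAB PA QB dis sPQ.
  have le := leq_trans dAB (cnt_leM e A B).
  have leA : #|A| <= #|A :|: B| by apply/subset_leq_card/subsetUl.
  have leB : #|B| <= #|A :|: B| by apply/subset_leq_card/subsetUr.
  have [sP|sP] := leqP s #|P|.
    apply: (NK (S1 := P) (S2 := A)) => //; nia.
  apply: (NK (S1 := Q) (S2 := B)) => //; [lia | nia].
have [v [A' [B' [vAB A'A B'B dA'B' [vA'B' dom]]]]] := density_step dAB.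
have sub : A' :|: B' \subset A :|: B by apply: setUSS.
have vPQ : v \notin P :|: Q by apply/negP=> vPQ; rewrite (disjointFr dis vPQ) in vAB.
have dis' W : W \subset v |: (P :|: Q) -> [disjoint W & A' :|: B'].
  move=> WvPQ; apply/pred0P=> z /=; apply/negbTE/negP=> /andP[zW zA'B'].
  case/setU1P: (subsetP WvPQ z zW) => [zv|zPQ]; first by rewrite -zv zA'B' in vA'B'.
  by have := subsetP sub z zA'B'; rewrite (disjointFr dis zPQ).
move: vPQ; rewrite inE negb_or => /andP[vP vQ].
case: dom => dom.
  apply: (IHn A' B' (v |: P) Q) => //.
  - by move=> p a /setU1P[->|pP] aA'; [apply: dom | apply: PA (subsetP A'A _ aA')].
  - by move=> q b qQ bB'; apply: QB (subsetP B'B _ bB').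
  - by apply: dis'; rewrite setUA.
  - by rewrite cardsU1 vP /=; lia.
apply: (IHn A' B' P (v |: Q)) => //.
- by move=> p a pP aA'; apply: PA (subsetP A'A _ aA').
- by move=> p a /setU1P[->|pP] aA'; [apply: dom | apply: QB (subsetP B'B _ aA')].
- by apply: dis'; rewrite setUCA.
- by rewrite cardsU1 vQ /=; lia.
Qed.

Theorem density_bound A B : cnt e A B <= density_const * #|A :|: B|.
Proof.
rewrite leqNgt; apply/negP=> dAB; apply: (dense_complete (P := set0) (Q := set0) dAB).
- by move=> p a; rewrite inE.
- by move=> p a; rewrite inE.
- by rewrite setU0; apply/pred0P=> z; rewrite /= inE.
- by rewrite cards0 addn0.
Qed.

End DensityMain.

(** * Menger's theorem *)

Section Menger.
Variable T : finType.
Implicit Types (e : rel T) (A B S X Y Z : {set T}) (x y : T).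

Definition separates e S A B := forall a b, a \in A -> a \notin S -> b \in B ->
  b \notin S -> b \notin cmp e (~: S) a.

Definition linked e k A B := exists (I : {set T}) (p : T -> {set T}),
  [/\ #|I| = k, forall i, i \in I -> conn e (p i),
    forall i, i \in I -> (exists2 a, a \in A & a \in p i) /\ (exists2 b, b \in B & b \in p i) &
    forall i j, i \in I -> j \in I -> i != j -> [disjoint p i & p j]].

Lemma conn_subrel e e' U : (forall a b, e' a b -> e a b) -> conn e' U -> conn e U.
Proof.
move=> sub cU x C xU xC clC; apply: (cU x) => // a b aC aU bU /sub; exact: clC.
Qed.

Lemma cmp_symP e V a b : symmetric e -> b \in cmp e V a -> a \in cmp e V b.
Proof.
by move=> e_sym; rewrite !inE (sym_connect_sym (rest_sym e_sym V)).
Qed.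

Lemma separatesC e S A B : symmetric e -> separates e S A B -> separates e S B A.
Proof.
move=> e_sym sep a b aB aS bA bS; apply/negP=> /(cmp_symP e_sym).
by apply/negP; apply: sep.
Qed.

(* Plays the role of cutting an [A]-[X] path at its first vertex in [X]. *)
Lemma trim e A S X P v : symmetric e -> conn e P -> S \subset X ->
  P :&: X = [set v] -> (exists2 a, a \in A & a \in P) ->
  exists P' : {set T}, [/\ P' \subset P, conn e P', v \in P',
    exists2 a, a \in A & a \in P' &
    forall w, w \in P' -> w = v \/
      exists a, [/\ a \in A, a \notin S & w \in cmp e (~: S) a]].
Proof.
move=> e_sym cP SX PX [a aA aP].
have /setIP[vP vX] : v \in P :&: X by rewrite PX set11.
have [av|nav] := eqVneq a v.
  exists [set v]; split; rewrite ?set11 ?sub1set //; first exact: conn1.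
    by exists a; rewrite // av set11.
  by move=> w /set1P; left.
have aPv : a \in P :\ v by rewrite !inE nav.
pose K := cmp e (P :\ v) a.
have KP : K \subset P :\ v by apply: cmp_sub.
have vK : v \notin K by apply/negP=> /(subsetP KP); rewrite !inE eqxx.
have aK : a \in K by apply: cmp_id.
have [u [w [uP uK wP wK euw]]] := conn_cut cP aP aK vP vK.
have wv : w = v.
  apply/eqP; apply: contraNT wK => nwv.
  by apply: (cmp_closed aPv uK _ euw); rewrite !inE nwv.
have KS : K \subset ~: S.
  apply/subsetP=> z zK; rewrite inE; apply/negP=> zS.
  have := subsetP KP z zK; rewrite !inE => /andP[/eqP zv zP]; apply: zv.
  by apply/set1P; rewrite -PX inE zP (subsetP SX).
exists (v |: K); split.
- by rewrite subUset sub1set vP; apply: subset_trans KP (subsetDl _ _).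
- by rewrite -wv; apply: (conn_add e_sym _ uK euw); apply: conn_cmp.
- exact: setU11.
- by exists a; rewrite // inE aK orbT.
- move=> z /setU1P[|zK]; [by left | right]; exists a; split=> //.
    by have := subsetP KS a aK; rewrite inE.
  by apply: (subsetP (conn_sub_cmp _ KS aK)) => //; apply: conn_cmp.
Qed.

(** Each of [k] disjoint sets meeting the [k]-element [X] contains exactly one vertex of [X], so it
    can be indexed by this vertex and trimmed there. The clause on components keeps the rest on the
    side of [A]; thus the two linkages in [menger] meet only in [S]. *)
Lemma linked_trim e k A S X : symmetric e -> #|X| = k -> S \subset X ->
  linked e k A X -> exists p : T -> {set T},
    (forall v, v \in X -> [/\ conn e (p v), v \in p v,
      exists2 a, a \in A & a \in p v &
      forall w, w \in p v -> w = v \/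
        exists a, [/\ a \in A, a \notin S & w \in cmp e (~: S) a]]) /\
    (forall v w, v \in X -> w \in X -> v != w -> [disjoint p v & p w]).
Proof.
move=> e_sym Xk SX [I [p [Ik cp pAX dp]]].
have /choice[f fP] : forall i, exists x, i \in I -> x \in X /\ x \in p i.
  move=> i; have [/pAX[_ [x xX xp]]|] := boolP (i \in I); [by exists x | by exists i].
have same i j x : i \in I -> j \in I -> x \in p i -> x \in p j -> i = j.
  move=> iI jI xi xj; apply: contrapT => /eqP /(dp _ _ iI jI) dij.
  by rewrite (disjointFr dij xi) in xj.
have f_inj : {in I &, injective f}.
  move=> i j iI jI E; have [_ fi] := fP i iI; have [_ fj] := fP j jI.
  by apply: same fi _; rewrite // E.
have fI : f @: I = X.
  apply/eqP; rewrite eqEcard card_in_imset // Ik Xk leqnn andbT.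
  by apply/subsetP=> _ /imsetP[i iI ->]; have [] := fP i iI.
have /choice[g gP] : forall v, exists i, v \in X -> i \in I /\ f i = v.
  move=> v; have [|_] := boolP (v \in X); last by exists v.
  by rewrite -fI => /imsetP[i iI ->]; exists i.
have pX v : v \in X -> p (g v) :&: X = [set v].
  move=> vX; have [gI fg] := gP v vX; have [_ vp] := fP _ gI; rewrite fg in vp.
  apply/setP=> w; rewrite !inE; apply/andP/eqP=> [[wp wX]|->]; last by split.
  have [gwI fgw] := gP w wX; have [_ wp'] := fP _ gwI; rewrite fgw in wp'.
  by rewrite -fg -fgw (same _ _ _ gI gwI wp wp').
have /choice[h hP] : forall v, exists P' : {set T}, v \in X -> [/\ P' \subset p (g v), conn e P', v \in P',
    exists2 a, a \in A & a \in P' &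
    forall w, w \in P' -> w = v \/
      exists a, [/\ a \in A, a \notin S & w \in cmp e (~: S) a]].
  move=> v; have [vX|_] := boolP (v \in X); last by exists set0.
  have [gI fg] := gP v vX; have [pA _] := pAX _ gI.
  by have [P' HP'] := trim e_sym (cp _ gI) SX (pX v vX) pA; exists P'.
exists h; split=> [v vX|v w vX wX vw]; first by have [] := hP v vX.
have [hv _ _ _ _] := hP v vX; have [hw _ _ _ _] := hP w wX.
apply: disjointWl hv _; apply: disjointWr hw _.
have [gvI fgv] := gP v vX; have [gwI fgw] := gP w wX.
by apply: dp => //; apply: contraNneq vw => E; rewrite -fgv -fgw E.
Qed.

Definition del_edge e x y : rel T := fun a b =>
  e a b && ~~ ((a == x) && (b == y) || (a == y) && (b == x)).

Lemma del_edge_sym e x y : symmetric e -> symmetric (del_edge e x y).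
Proof. by move=> e_sym a b; rewrite /del_edge e_sym orbC ![(b == _) && _]andbC. Qed.

Lemma del_edgeC e x y : del_edge e x y = del_edge e y x.
Proof. by apply/funext=> a; apply/funext=> b; rewrite /del_edge orbC. Qed.

(* As [y] lies on the side of [B], a path from [A] that avoids [x |: S] does not
   use the deleted edge. *)
Lemma del_edge_separates e x y A B S Z : symmetric e ->
  separates (del_edge e x y) S A B ->
  (exists b, [/\ b \in B, b \notin S & y \in cmp (del_edge e x y) (~: S) b]) ->
  separates (del_edge e x y) Z A (x |: S) -> separates e Z A B.
Proof.
move=> e_sym sepS [b0 [b0B b0S yb0]] sepZ a b aA aZ bB bZ; apply/negP=> bC.
have e'_sym := del_edge_sym x y e_sym.
pose K := cmp (del_edge e x y) (~: Z) a.
have aZ' : a \in ~: Z by rewrite inE.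
have aK : a \in K by apply: cmp_id.
have KZ : K \subset ~: Z by apply: cmp_sub.
have KX : K \subset ~: (x |: S).
  apply/subsetP=> z zK; rewrite inE; apply/negP=> zX.
  have := sepZ a z aA aZ zX; rewrite -/K zK => H; apply: (negP (H _)) => //.
  by have := subsetP KZ z zK; rewrite inE.
have KS : K \subset ~: S by apply: subset_trans KX _; rewrite setCS subsetUr.
have aS : a \notin S by have := subsetP KS a aK; rewrite inE.
have KC : K \subset cmp (del_edge e x y) (~: S) a.
  by apply: conn_sub_cmp => //; apply: conn_cmp.
have xK : x \notin K by apply/negP=> /(subsetP KX); rewrite !inE eqxx.
have yK : y \notin K.
  apply/negP=> /(subsetP KC) ya; have := sepS a b0 aA aS b0B b0S; apply/negP; rewrite negbK.
  have := cmp_symP e'_sym yb0; move: ya; rewrite !inE => /connect_trans; exact.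
have bK : b \notin K.
  apply/negP=> /(subsetP KC) ba; have bS : b \notin S.
    have : b \in ~: S by apply: (subsetP (cmp_sub _ _)) ba; rewrite inE.
    by rewrite inE.
  by have := sepS a b aA aS bB bS; rewrite ba.
have [u [w [uC uK wC wK euw]]] := conn_cut (conn_cmp e_sym aZ') (cmp_id _ _ _) aK bC bK.
have wZ : w \in ~: Z by apply: (subsetP (cmp_sub e aZ')).
have /negP[] := wK; apply: (cmp_closed aZ' uK wZ).
rewrite /del_edge euw /=; apply/norP; split; apply/negP=> /andP[/eqP ux _].
  by rewrite -ux uK in xK.
by rewrite -ux uK in yK.
Qed.

(* Disjoint connected sets stand for disjoint paths.  The proof deletes an edge
   [xy]: if a set [S] of size [k - 1] then separates [A] from [B], linkages from
   [A] to [x |: S] and from [B] to [y |: S] are glued along [S] and [xy]. *)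
Theorem menger e k A B : symmetric e ->
  (forall S, separates e S A B -> k <= #|S|) -> linked e k A B.
Proof.
have [n] := ubnP #|[set p : T * T | e p.1 p.2]|.
elim: n e k A B => // n IHn e k A B en e_sym sepk.
have [e0|] := eqVneq [set p : T * T | e p.1 p.2] set0.
  (* Without edges [A :&: B] is itself a separator, and its single vertices form the linkage. *)
  have : k <= #|A :&: B|.
    apply: sepk => a b aA aS bB bS; apply/negP=> ba.
    suff ab : b \in [set a].
      by move/set1P: ab bB aS => ->; rewrite inE aA => ->.
    move: ba; rewrite [b \in cmp _ _ _]inE => ba; apply: (connect_in_closed ba (set11 a)) => u v _ /and3P[_ _ euv].
    have : (u, v) \in [set p : T * T | e p.1 p.2] by rewrite inE.
    by rewrite e0 in_set0.
  move=> /card_geqP[t [ut st tAB]]; exists [set x in t], (fun x => [set x]); split.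
  - by rewrite cardsE (card_uniqP ut).
  - by move=> i _; apply: conn1.
  - move=> i; rewrite inE => /tAB /setIP[iA iB].
    by split; [exists i | exists i]; rewrite ?set11.
  - by move=> i j _ _ ij; rewrite disjoints1 inE.
case/set0Pn=> -[x y]; rewrite inE /= => exy.
have ltn u v : e u v -> #|[set p : T * T | del_edge e u v p.1 p.2]| < n.
  move=> euv; rewrite ltnS in en; apply: leq_trans en; apply: proper_card.
  apply/properP; split; first by apply/subsetP=> p; rewrite !inE => /andP[].
  by exists (u, v); rewrite !inE //= /del_edge !eqxx /= andbF.
have sub u v a b : del_edge e u v a b -> e a b by case/andP.
have [sep'|nsep] := EM (forall S, separates (del_edge e x y) S A B -> k <= #|S|).
  have [I [p [Ik cp pAB dp]]] := IHn _ k A B (ltn x y exy) (del_edge_sym x y e_sym) sep'.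
  by exists I, p; split=> // i iI; apply: conn_subrel (sub x y) (cp i iI).
have {nsep} [S [sepS Sk]] : exists S, separates (del_edge e x y) S A B /\ #|S| < k.
  apply: contrapT => H; apply: nsep => S sepS; rewrite leqNgt; apply/negP=> Sk.
  by apply: H; exists S.
have [a0 [b0 [a0A a0S b0B b0S b0C]]] : exists a0 b0,
    [/\ a0 \in A, a0 \notin S, b0 \in B, b0 \notin S & b0 \in cmp e (~: S) a0].
  apply: contrapT => H; move: Sk; rewrite ltnNge sepk // => a b aA aS bB bS.
  by apply/negP=> ab; apply: H; exists a, b.
have cross x' y' a b : a \notin S ->
   b \in cmp e (~: S) a -> b \notin cmp (del_edge e x' y') (~: S) a ->
   exists u v, [/\ u \in cmp (del_edge e x' y') (~: S) a, v \notin S, u \notin S,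
     u = x' /\ v = y' \/ u = y' /\ v = x' & e u v].
  move=> aS bC bC'.
  have aV : a \in ~: S by rewrite inE.
  have [u [v [uC uK vC vK euv]]] :=
    conn_cut (conn_cmp e_sym aV) (cmp_id _ _ _) (cmp_id _ _ _) bC bC'.
  have vS : v \in ~: S by apply: (subsetP (cmp_sub e aV)).
  have uS : u \in ~: S by apply: (subsetP (cmp_sub e aV)).
  exists u, v; split=> //; [by rewrite inE in vS | by rewrite inE in uS | ].
  apply: contrapT => H; case/negP: vK; apply: (cmp_closed aV uK vS).
  rewrite /del_edge euv; apply/norP; split; apply/negP=> /andP[/eqP uE /eqP vE].
    by apply: H; left.
  by apply: H; right.
(* The ends of the deleted edge are named so that [x] is on the side of [A]; then [y] is on the side
   of [B]. *)
have {sepS} [x' [y' [{exy} exy sepS [xa0 xS]]]] : exists x' y',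
    [/\ e x' y', separates (del_edge e x' y') S A B &
    x' \in cmp (del_edge e x' y') (~: S) a0 /\ x' \notin S].
  have b0C' := sepS a0 b0 a0A a0S b0B b0S.
  have [u [v [uK vS uS uv euv]]] := cross x y a0 b0 a0S b0C b0C'.
  case: uv => -[uE vE]; [exists x, y | exists y, x].
    by split=> //; move: uK uS; rewrite uE.
  by rewrite e_sym del_edgeC; split=> //; move: uK uS; rewrite uE.
move: {x y} x' y' exy sepS xa0 xS => x y exy sepS xa0 xS.
pose e' := del_edge e x y; have e'_sym : symmetric e' by apply: del_edge_sym.
have sepSC := separatesC e'_sym sepS.
have [yb0 yS] : y \in cmp e' (~: S) b0 /\ y \notin S.
  have a0C := cmp_symP e_sym b0C; have a0C' := sepSC b0 a0 b0B b0S a0A a0S.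
  have [u [v [uK vS uS uv euv]]] := cross x y b0 a0 b0S a0C a0C'.
  case: uv => -[uE vE]; last by rewrite -uE.
  case/negP: (sepS a0 b0 a0A a0S b0B b0S); have := cmp_symP e'_sym uK; rewrite uE.
  by move: xa0; rewrite !inE; apply: connect_trans.
have sepA Z : separates e' Z A (x |: S) -> k <= #|Z|.
  move=> sepZ; apply: sepk; apply: (del_edge_separates e_sym sepS _ sepZ).
  by exists b0.
have sepB Z : separates e' Z B (y |: S) -> k <= #|Z|.
  move=> sepZ; apply: sepk; apply: separatesC => //.
  rewrite /e' del_edgeC in sepZ; apply: (del_edge_separates e_sym _ _ sepZ).
    by rewrite del_edgeC.
  by rewrite del_edgeC; exists a0.
have kX : #|x |: S| = k.
  apply/eqP; rewrite eqn_leq {1}cardsU1 xS add1n Sk sepA //.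
  by move=> a b _ _ bX; rewrite bX.
have kY : #|y |: S| = k by rewrite cardsU1 yS -kX cardsU1 xS.
have := linked_trim e'_sym kX (subsetUr _ _) (IHn _ k A _ (ltn _ _ exy) e'_sym sepA).
move=> [p [pP dp]].
have := linked_trim e'_sym kY (subsetUr _ _) (IHn _ k B _ (ltn _ _ exy) e'_sym sepB).
move=> [q [qP dq]].
(* [m] matches the two linkages: a vertex of [S] with itself, and [x] with [y]. *)
pose m v := if v == x then y else v.
have mY v : v \in x |: S -> m v \in y |: S.
  by rewrite /m => /setU1P[->|vS]; [rewrite eqxx setU11 | case: eqP; rewrite ?setU11 // inE vS orbT].
have RAB w a b : a \in A -> a \notin S -> b \in B -> b \notin S ->
    w \in cmp e' (~: S) a -> w \in cmp e' (~: S) b -> False.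
  move=> aA aS bB bS wa /(cmp_symP e'_sym) wb.
  case/negP: (sepS a b aA aS bB bS); move: wa wb; rewrite !inE; exact: connect_trans.
have xy : x <> y by move=> xy; apply: (RAB x a0 b0) => //; rewrite xy.
have notS w a : a \notin S -> w \in cmp e' (~: S) a -> w \notin S.
  move=> aS wC; suff : w \in ~: S by rewrite inE.
  by apply: (subsetP (cmp_sub e' _)) wC; rewrite inE.
have meet v w z : v \in x |: S -> w \in x |: S -> z \in p v -> z \in q (m w) -> v = w.
  move=> vX wX zp zq; have [_ _ _ /(_ z zp) zv] := pP v vX.
  have [_ _ _ /(_ z zq) zw] := qP _ (mY w wX).
  have mS : m w = y \/ m w \in S by apply/setU1P/mY.
  case: zv zw => [->|[a [aA aS za]]] [zw|[b [bB bS zb]]].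
  - move: zw; rewrite /m; case: eqP => // _ vy.
    by move: vX yS xy; rewrite vy => /setU1P[->|->].
  - case/setU1P: vX zb => [-> xb|vS /notS]; first by case: (RAB x a0 b).
    by rewrite vS => /(_ bS).
  - case: mS => mzS; rewrite -zw in mzS.
      by rewrite mzS in za; case: (RAB y a b0).
    by have := notS z a aS za; rewrite mzS.
  - by case: (RAB z a b).
exists (x |: S), (fun v => p v :|: q (m v)); split=> //.
- move=> v vX; have [cp vp _ _] := pP v vX; have [cq vq _ _] := qP _ (mY v vX).
  apply: (connU e_sym _ _ vp vq).
  + exact: conn_subrel (sub x y) cp.
  + exact: conn_subrel (sub x y) cq.
  + by rewrite /m; case: eqP => [->|_]; [right | left].
- move=> v vX; have [_ _ [a aA ap] _] := pP v vX.
  have [_ _ [b bB bq] _] := qP _ (mY v vX).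
  by split; [exists a | exists b]; rewrite // inE ?ap ?bq ?orbT.
move=> v w vX wX vw; apply/pred0P=> z /=; apply/negbTE/negP=> /andP[].
case/setUP=> zv /setUP[] zw.
- by rewrite (disjointFr (dp v w vX wX vw) zv) in zw.
- by case/eqP: vw; apply: meet zv zw.
- by case/eqP: vw; apply/esym; apply: meet zw zv.
have mvw : m v != m w.
  apply: contra vw; rewrite /m.
  have [->|vx] := eqVneq v x; have [wx|wx] := eqVneq w x => //.
    by move: wX; rewrite !inE (negPf wx) /= => wS /eqP yw; rewrite yw wS in yS.
  by move: vX; rewrite !inE (negPf vx) /= => vS /eqP vy; rewrite -vy vS in yS.
by rewrite (disjointFr (dq _ _ (mY v vX) (mY w wX) mvw) zv) in zw.
Qed.

End Menger.

(** * Short paths between highly connected vertices *)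

Section ShortPath.
Variables (T : finType) (e : rel T).
Hypotheses (e_sym : symmetric e) (e_irr : irreflexive e).
Implicit Types (A B C U V W Y P : {set T}) (x y z v : T).

Lemma cnt_sumr A B : cnt e A B = \sum_(b in B) #|[set a in A | e a b]|.
Proof.
rewrite /cnt -sum1_card (partition_big (fun p : T * T => p.2) (mem B)) /=; last first.
  by move=> p; rewrite inE => /and3P[].
apply: eq_bigr => b bB; rewrite sum1dep_card.
rewrite -(card_imset _ (fun x y (E : (x, b) = (y, b)) => congr1 fst E)).
apply: eq_card => -[a b']; rewrite !inE /=; apply/andP/imsetP => [[/and3P[aA _ eab] /eqP bE]|].
  by exists a; rewrite ?bE // inE aA -bE.
by move=> [a' + [-> ->]]; rewrite inE => /andP[-> ->]; rewrite bB eqxx.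
Qed.

Lemma cnt_bigcupr A (J : T -> {set T}) :
  (forall i j, i != j -> [disjoint J i & J j]) ->
  cnt e A (\bigcup_i J i) = \sum_i cnt e A (J i).
Proof.
move=> dJ; rewrite cnt_sumr partition_disjoint_bigcup //.
by apply: eq_bigr => i _; rewrite cnt_sumr.
Qed.

Lemma cnt_bigcupl (J : T -> {set T}) B :
  (forall i j, i != j -> [disjoint J i & J j]) ->
  cnt e (\bigcup_i J i) B = \sum_i cnt e (J i) B.
Proof.
move=> dJ; rewrite cntC // cnt_bigcupr //.
by apply: eq_bigr => i _; rewrite cntC.
Qed.

Lemma ipath_connect V (f : nat -> T) d : ipath e f d ->
  (forall i, i <= d -> f i \in V) -> forall i, i <= d -> f i \in ball e V (f 0) i.
Proof.
move=> ip fV; elim=> [|i IHi] id; first exact: ball_id.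
apply: ball_step (IHi (ltnW id)) (fV _ id) _.
by have [_ ->] := ip i i.+1 (introT andP (conj (ltnSn i) id)).
Qed.

(** [menger] is applied to the neighbourhoods of [x] and [y] after deletion of these two
    vertices. *)
Lemma menger_vertices k x y : x != y -> ~~ e x y ->
  (forall S : {set T}, x \notin S -> y \notin S -> #|S| < k -> y \in cmp e (~: S) x) ->
  exists (I : {set T}) (p : T -> {set T}), [/\ #|I| = k,
    forall i, i \in I -> [/\ conn e (p i), x \notin p i, y \notin p i,
      exists2 a, e x a & a \in p i & exists2 b, e y b & b \in p i] &
    forall i j, i \in I -> j \in I -> i != j -> [disjoint p i & p j]].
Proof.
move=> xy nexy sep; pose V0 := ~: [set x; y].
have sep' S : separates (rest e V0) S [set a in V0 | e x a] [set b in V0 | e y b] -> k <= #|S|.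
  move=> sepS; rewrite leqNgt; apply/negP=> Sk.
  (* [S] may contain [x] or [y], which the hypothesis on separators excludes. *)
  pose S0 := S :\: [set x; y].
  have yC : y \in cmp e (~: S0) x.
    apply: sep; rewrite ?inE ?eqxx ?orbT //.
    by apply: leq_ltn_trans Sk; apply/subset_leq_card/subsetDl.
  have xS0 : x \in ~: S0 by rewrite !inE eqxx.
  have [d [f [f0 fd ip fC _]]] := conn_ipath (conn_cmp e_sym xS0) (cmp_id _ _ _) yC.
  have inj i j : i < j <= d -> f i <> f j by move=> /ip[/eqP].
  have d2 : 2 <= d.
    case: d fd ip {fC inj} => [|[|d]] // fd ip; first by rewrite -fd f0 eqxx in xy.
    by have [_] := ip 0 1 isT; rewrite f0 fd => E; rewrite E in nexy.
  have fV i : 0 < i < d -> (f i \in V0) && (f i \notin S).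
    move=> /andP[i0 id]; have fx : f i != x.
      by apply/eqP=> fx; apply: (inj 0 i); rewrite ?f0 // i0 ltnW.
    have fy : f i != y by apply/eqP=> fy; apply: (inj i d); rewrite ?fd // id leqnn.
    have : f i \in ~: S0 by apply: (subsetP (cmp_sub e xS0)); apply: fC; apply: ltnW.
    by rewrite !inE !(negPf fx) !(negPf fy) /=.
  have fC1 i : i < d.-1 -> f i.+1 \in cmp (rest e V0) (~: S) (f 1).
    elim: i => [|i IHi] id; first exact: cmp_id.
    have /andP[f1V f1S] := fV 1 (introT andP (conj isT d2)).
    have /andP[fiV fiS] := fV i.+1 ltac:(lia).
    have /andP[fi2V fi2S] := fV i.+2 ltac:(lia).
    apply: (cmp_closed _ (IHi (ltnW id))); rewrite ?inE // /rest fiV fi2V /=.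
    by have [|_ ->] := ip i.+1 i.+2; [lia | rewrite eqxx].
  have /andP[f1V f1S] := fV 1 (introT andP (conj isT d2)).
  have /andP[fdV fdS] := fV d.-1 ltac:(lia).
  have := fC1 d.-2 ltac:(lia); rewrite prednK; last by lia.
  apply/negP; apply: sepS; rewrite // inE ?f1V ?fdV /=.
    by rewrite -f0; have [|_ ->] := ip 0 1; [lia | rewrite eqxx].
  rewrite e_sym -fd; have [|_ ->] := ip d.-1 d; [lia | apply/eqP; lia].
have [I [p [Ik cp pAB dp]]] := menger (rest_sym e_sym V0) sep'.
exists I, p; split=> // i iI; have [[a aA ap] [b bB bp]] := pAB i iI.
move: aA bB; rewrite !inE !negb_or => /andP[/andP[ax ay] exa] /andP[/andP[bx bY] eyb].
have pV : p i \subset V0.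
  apply: (cp i iI a) => //; first by rewrite !inE negb_or ax.
  by move=> u v _ _ _ /and3P[].
split; [|by apply/negP=> /(subsetP pV); rewrite !inE eqxx
  |by apply/negP=> /(subsetP pV); rewrite !inE eqxx orbT
  |by exists a | by exists b].
by apply: conn_subrel (cp i iI) => u v /and3P[].
Qed.

Definition inner (f : nat -> T) d := [set f t.+1 | t : 'I_d.-1].

Lemma innerP f d z : reflect (exists2 t, 0 < t < d & z = f t) (z \in inner f d).
Proof.
apply: (iffP imsetP) => [[t _ ->]|[[|t] //= td ->]].
  by exists t.+1 => //; have := ltn_ord t; lia.
have lt : t < d.-1 by lia.
by exists (Ordinal lt).
Qed.

Section Sparse.
Variables (l D : nat).
Hypotheses (l2 : 2 <= l) (HF : hole_free e l).
Hypothesis sparse : forall A B, cnt e A B <= D * #|A :|: B|.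

(* Otherwise the window closes up to a long hole through the second path. *)
Lemma window x y (f g : nat -> T) d d' a : ipath e f d -> ipath e g d' ->
  f 0 = x -> f d = y -> g 0 = x -> g d' = y ->
  (forall i j, 0 < i < d -> 0 < j < d' -> f i <> g j) ->
  0 < a -> a + l < d -> exists t j, [/\ a < t < a + l, 0 < j < d' & e (f t) (g j)].
Proof.
move=> fp gp f0 fd g0 gd fg a0 ad; apply: contrapT => H.
have injf i j : i < j <= d -> f i <> f j by move=> /fp[/eqP].
have ef i j : i <= d -> j <= d -> e (f i) (f j) = (j == i.+1) || (i == j.+1).
  move=> id jd; have [ij|ji|->] := ltngtP i j.
  - have [|_ ->] := fp i j; first by rewrite ij.
    by rewrite orbC; case: eqP => //; lia.
  - rewrite e_sym; have [|_ ->] := fp j i; first by rewrite ji.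
    by case: (j =P _) => //; lia.
  - by rewrite e_irr; lia.
have inj i j : i <= d -> j <= d -> f i = f j -> i = j.
  move=> id jd E; have [ij|ji|//] := ltngtP i j.
    by case: (injf i j); rewrite ?ij.
  by case: (injf j i); rewrite ?ji.
pose path_set (h : nat -> T) n := [set z | [exists i : 'I_n.+1, z == h i]].
have pathP h n z : reflect (exists2 i, i <= n & z = h i) (z \in path_set h n).
  rewrite inE; apply: (iffP existsP) => [[i /eqP->]|[i ni ->]].
    by exists i; rewrite // -ltnS.
  by exists (Ordinal (ni : i < n.+1)).
(* The window is closed by [f] before [a], all of [g], and [f] after [a + l], which are joined at
   [x] and [y]. *)
pose W1 := path_set f a.-1; pose W2 := path_set g d'.
pose W3 := path_set (fun t => f (a + l + t.+1)) (d - (a + l)).-1.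
have cW1 : conn e W1.
  by apply: conn_ipathU => // i ia; rewrite ef ?eqxx //; lia.
have cW2 : conn e W2.
  by apply: conn_ipathU => // i ia; have [|_ ->] := gp i i.+1; [lia | rewrite eqxx].
have cW3 : conn e W3.
  by apply: conn_ipathU => // i ia; rewrite ef -?addnS ?addnS ?eqxx //; lia.
have yW3 : y \in W3.
  by apply/pathP; exists (d - (a + l)).-1 => //; rewrite -fd; congr f; lia.
have cW : conn e (W1 :|: W2 :|: W3).
  apply: (connU e_sym _ cW3 (x := y) _ yW3); last by left.
    apply: (connU e_sym cW1 cW2 (x := x) (y := x)); last by left.
      by apply/pathP; exists 0.
    by apply/pathP; exists 0.
  by rewrite inE; apply/orP; right; apply/pathP; exists d'.
have Wcase w : w \in W1 :|: W2 :|: W3 ->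
    (exists2 i, i <= d & (i < a) || (a + l < i) /\ w = f i) \/
    (exists2 j, 0 < j < d' & w = g j).
  case/setUP=> [/setUP[]|] /pathP[i ia ->].
  - by left; exists i; first lia; split=> //; lia.
  - have [i0|i0] := posnP i; first by left; exists 0 => //; rewrite i0 g0 -f0 a0.
    have [->|id] := eqVneq i d'; first by left; exists d => //; rewrite gd fd ad orbT.
    by right; exists i => //; rewrite i0 ltn_neqAle id.
  - by left; exists (a + l + i.+1); first lia; split=> //; lia.
have fN i : a <= i <= a + l -> f i \notin W1 :|: W2 :|: W3.
  move=> ai; apply/negP=> /Wcase[[j jd [ja E]]|[j jd E]].
    by have := inj _ _ _ jd E; lia.
  by case: (fg i j) => //; lia.
have ip : ipath e (fun t => f (a + t)) l.
  move=> i j ij; split; first by apply/eqP=> E; have := inj _ _ _ _ E; lia.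
  rewrite ef; [|lia|lia].
  by rewrite -addnS eqn_add2l -addnS eqn_add2l orbC; case: (i =P _) => //; lia.
have [|||m lm hm] := ipath_hole e_sym ip l2 cW.
- rewrite addn0; apply/nbhdP; split; first by apply: fN; lia.
  exists (f a.-1); first by rewrite !in_setU; apply/orP; left; apply/orP; left; apply/pathP; exists a.-1.
  by rewrite ef; lia.
- apply/nbhdP; split; first by apply: fN; lia.
  exists (f (a + l).+1); last by rewrite ef; lia.
  by rewrite inE; apply/orP; right; apply/pathP; exists 0; rewrite // addn1.
- move=> i w il wW; apply/andP; split.
    by apply: contraTneq wW => <-; apply: fN; lia.
  have [[j jd [ja ->]]|[j jd ->]] := Wcase w wW.
    by rewrite ef; lia.
  apply/negP=> eij; apply: H; exists (a + i), j; split=> //; lia.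
- by apply: (HF _ hm); lia.
Qed.

(** The interior of [f] contains [M] disjoint windows of length [l], each with its own edge to [g].
    As [l + 2 <= d], there is at least one, and the factor 2 absorbs the incomplete window at the
    end. *)
Lemma inner_cnt x y (f g : nat -> T) d d' : ipath e f d -> ipath e g d' ->
  f 0 = x -> f d = y -> g 0 = x -> g d' = y -> l + 2 <= d ->
  [disjoint inner f d & inner g d'] ->
  #|inner f d| <= 2 * l * cnt e (inner f d) (inner g d').
Proof.
move=> fp gp f0 fd g0 gd ld dis.
pose M := (d - 2) %/ l; have l0 : 0 < l by apply: ltnW.
have fg i j : 0 < i < d -> 0 < j < d' -> f i <> g j.
  move=> id jd E; have /(disjointFr dis) : f i \in inner f d by apply/innerP; exists i.
  by move/negP; apply; apply/innerP; exists j.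
have /choice[w wP] : forall m : 'I_M, exists p : nat * nat,
    [/\ 1 + m * l < p.1 < 1 + m.+1 * l, p.1 < d, 0 < p.2 < d' & e (f p.1) (g p.2)].
  move=> m; have mM : 1 + m * l + l < d.
    have : m.+1 * l <= d - 2 by rewrite -leq_divRL.
    by rewrite mulSn; clear -ld l2; lia.
  have [t [j [ta jd eft]]] := window fp gp f0 fd g0 gd fg (isT : 0 < 1 + m * l) mM.
  exists (t, j); split=> //=; [rewrite mulSn|]; clear -ta mM; lia.
have inj : injective (fun m => (f (w m).1, g (w m).2)).
  move=> m m' [E _]; have [lm dm _ _] := wP m; have [lm' dm' _ _] := wP m'.
  have E1 : (w m).1 = (w m').1.
    apply: contrapT => ne; have [lt|lt|//] := ltngtP (w m).1 (w m').1.
      by have [/eqP[]] := fp _ _ (introT andP (conj lt (ltnW dm'))).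
    by have [/eqP[]] := fp _ _ (introT andP (conj lt (ltnW dm))).
  apply: val_inj => /=; rewrite E1 in lm; clear -lm lm' l0.
  have q k (u : nat) : 1 + k * l < u < 1 + k.+1 * l -> u.-1 %/ l = k.
    move=> ku; apply/eqP; rewrite eqn_leq leq_divRL // -ltnS ltn_divLR //.
    by rewrite mulSn in ku *; lia.
  by rewrite -(q _ _ lm) -(q _ _ lm').
have MC : M <= cnt e (inner f d) (inner g d').
  rewrite -[X in X <= _]card_ord -(card_imset _ inj); apply/subset_leq_card/subsetP.
  move=> _ /imsetP[m _ ->]; have [lm dm jm em] := wP m; rewrite inE /= em andbT.
  apply/andP; split; apply/innerP; [exists (w m).1 | exists (w m).2] => //.
  by rewrite dm andbT; apply: leq_ltn_trans (leq0n _) (proj1 (andP lm)).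
apply: (@leq_trans d.-1); first by apply: leq_trans (leq_imset_card _ _) _; rewrite card_ord.
apply: leq_trans (leq_mul (leqnn _) MC); rewrite /M.
have := divn_eq (d - 2) l; have := ltn_pmod (d - 2) l0.
have : 0 < (d - 2) %/ l by rewrite divn_gt0 //; clear -ld; lia.
clear -ld; nia.
Qed.

(** Among this many long disjoint paths, each has [2 * l * D + 1] others and sends to each of them
    at least [1 / (2 * l)] edges per inner vertex: more than [D] per vertex in total. *)
Definition path_const := 2 * l * D + 2.

Theorem short_path x y : x != y -> ~~ e x y ->
  (forall S : {set T}, x \notin S -> y \notin S -> #|S| < path_const ->
    y \in cmp e (~: S) x) ->
  y \in ball e setT x (l + 2).
Proof.
move=> xy nexy sep; apply: contrapT => /negP far.
have [I [p [Ik pP dp]]] := menger_vertices xy nexy sep.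
have /choice[q qP] : forall i, exists df : nat * (nat -> T), i \in I ->
    [/\ df.2 0 = x, df.2 df.1 = y, ipath e df.2 df.1, l + 2 <= df.1 &
      inner df.2 df.1 \subset p i].
  move=> i; have [iI|_] := boolP (i \in I); last by exists (0, fun=> x).
  have [cp xp yp [a exa ap] [b eyb bp]] := pP i iI.
  have cU : conn e (x |: (y |: p i)).
    apply: (conn_add e_sym (x := a)); rewrite ?inE ?ap ?orbT // 1?e_sym //.
    by apply: (conn_add e_sym cp bp); rewrite e_sym.
  have [||d [f [f0 fd ip fU _]]] := conn_ipath cU (x := x) (y := y).
  - by rewrite !inE eqxx.
  - by rewrite !inE eqxx orbT.
  exists (d, f) => _; split=> //=.
    rewrite ltnW // ltnNge; apply: contra far => dl; apply: (subsetP (ball_mono e _ _ dl)).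
    by rewrite -{1}fd -f0; apply: (ipath_connect ip) => // i0 _; apply: in_setT.
  apply/subsetP=> z /innerP[t /andP[t0 td] ->].
  have := fU t (ltnW td); rewrite !inE -f0 -fd.
  have [|/negPf ne1 _] := ip 0 t; first by rewrite t0 ltnW.
  have [|/negPf ne2 _] := ip t d; first by rewrite td leqnn.
  by rewrite eq_sym ne1 ne2.
pose J i := if i \in I then inner (q i).2 (q i).1 else set0.
have dJ i j : i != j -> [disjoint J i & J j].
  move=> ij; rewrite /J; case: ifP => iI; last by rewrite -setI_eq0 set0I.
  case: ifP => jI; last by rewrite -setI_eq0 setI0.
  have [_ _ _ _ ip] := qP i iI; have [_ _ _ _ jp] := qP j jI.
  by apply: disjointWl ip _; apply: disjointWr jp _; apply: dp.
pose V := \bigcup_i J i.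
have Vsum : #|V| = \sum_i #|J i|.
  rewrite -sum1_card partition_disjoint_bigcup //.
  by apply: eq_bigr => i _; rewrite sum1_card.
have rowi i : i \in I -> (path_const - 1) * #|J i| <= 2 * l * cnt e (J i) V.
  move=> iI; rewrite cnt_bigcupr // big_distrr /= (bigD1 i) //=.
  apply: (@leq_trans (\sum_(j in I :\ i) 2 * l * cnt e (J i) (J j))).
    apply: (@leq_trans (\sum_(j in I :\ i) #|J i|)).
      by rewrite sum_nat_const leq_mul2r -Ik (cardsD1 i I) iI add1n subn1 leqnn orbT.
    apply: leq_sum => j /setD1P[ji jI]; have := dJ i j; rewrite eq_sym ji /J iI jI => /(_ isT) dij.
    have [i1 i2 i3 i4 _] := qP i iI; have [j1 j2 j3 _ _] := qP j jI.
    exact: inner_cnt i3 j3 i1 i2 j1 j2 i4 dij.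
  apply: leq_trans (leq_addl _ _).
  rewrite [X in _ <= X](bigID (mem I)) /=; apply: leq_trans (leq_addr _ _).
  by rewrite big_mkcond [X in _ <= X]big_mkcond; apply: leq_sum => j _; rewrite !inE.
have : (path_const - 1) * #|V| <= 2 * l * cnt e V V.
  rewrite {1}Vsum [cnt e V V]cnt_bigcupl // !big_distrr /=; apply: leq_sum => i _.
  have [iI|iI] := boolP (i \in I); first exact: rowi.
  by rewrite /J (negPf iI) cards0 muln0.
have V0 : 0 < #|V|.
  have : 0 < #|I| by rewrite Ik /path_const addnS.
  rewrite card_gt0 => /set0Pn[i iI]; have [_ _ _ ld _] := qP i iI.
  rewrite card_gt0; apply/set0Pn; exists ((q i).2 1); apply/bigcupP; exists i => //.
  by rewrite /J iI; apply/innerP; exists 1 => //; clear -ld; lia.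
have := sparse V V; rewrite setUid /path_const; clear -V0; nia.
Qed.

End Sparse.
End ShortPath.

(** * Long holes through highly connected sets *)

(* Overwriting the coordinates in [C] by arbitrary values loses no information as
   long as the witness [p] is remembered. *)
Lemma override_count n m (E : finType) (Bad : {set {ffun 'I_n -> 'I_m}})
    (C : {set 'I_n}) (Ed : {set E}) (R : {ffun 'I_n -> 'I_m} -> E -> Prop) :
  (forall f, f \in Bad -> exists2 p, p \in Ed & R f p) ->
  (forall f g p, R f p -> R g p -> forall i, i \in C -> f i = g i) ->
  #|Bad| * m ^ #|C| <= #|Ed| * m ^ n.
Proof.
move=> BadE Rdet.
have /choice[w wP] : forall f, exists p : option E, f \in Bad ->
    exists2 p', p = Some p' & p' \in Ed /\ R f p'.
  move=> f; have [fB|_] := boolP (f \in Bad); last by exists None.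
  by have [p pE Rp] := BadE f fB; exists (Some p) => _; exists p.
pose over (p : {ffun 'I_n -> 'I_m} * {ffun {i | i \in C} -> 'I_m}) : {ffun 'I_n -> 'I_m} :=
  [ffun i => if insub i is Some c then p.2 c else p.1 i].
pose phi p := (w p.1, over p).
pose A := setX Bad [set: {ffun {i | i \in C} -> 'I_m}].
have inj : {in A &, injective phi}.
  move=> [f h] [f' h']; rewrite !inE !andbT /= => fB fB' [Ew Eo].
  have [p pE [_ Rp]] := wP f fB; have [p' pE' [_ Rp']] := wP f' fB'.
  have {pE pE' Ew} pp' : p = p' by rewrite pE pE' in Ew; case: Ew.
  rewrite -pp' in Rp'; have Ei i := congr1 (fun g : {ffun _} => g i) Eo.
  congr pair; apply/ffunP=> i; last first.
    by have := Ei (val i); rewrite !ffunE valK.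
  have [iC|niC] := boolP (i \in C); first exact: Rdet Rp Rp' i iC.
  by have := Ei i; rewrite !ffunE insubN.
have cA : #|A| = #|Bad| * m ^ #|C|.
  by rewrite cardsX cardsT card_ffun card_ord card_sig.
rewrite -cA -(card_in_imset inj).
have -> : #|Ed| * m ^ n = #|setX [set Some p | p in Ed] [set: {ffun 'I_n -> 'I_m}]|.
  by rewrite cardsX cardsT card_ffun !card_ord card_imset //; apply: Some_inj.
apply/subset_leq_card/subsetP=> _ /imsetP[[f h] + ->]; rewrite !inE !andbT /= => fB.
have [p pE [pEd _]] := wP f fB; rewrite /phi /= pE.
by apply: imset_f.
Qed.

Section Connectors.
Variables (T : finType) (e : rel T).
Hypotheses (e_sym : symmetric e) (e_irr : irreflexive e).
Implicit Types (A B C U V W X Y P F : {set T}) (x y z v : T).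

Lemma greedy_disjoint (K : eqType) (P : K -> {set T} -> Prop) p L (ks : seq K) :
  (forall k F, k \in ks -> #|F| <= p -> exists I, [/\ P k I, #|I| <= L & [disjoint I & F]]) ->
  size ks * L <= p ->
  exists I : K -> {set T},
    (forall k, k \in ks -> P k (I k) /\ #|I k| <= L) /\
    (forall k k', k \in ks -> k' \in ks -> k != k' -> [disjoint I k & I k']).
Proof.
elim: ks => [|k ks IHks] HP; first by exists (fun=> set0); split.
rewrite /= mulSn => sz.
have [||I [IP Id]] := IHks.
- by move=> k' F k'ks; apply: HP; rewrite inE k'ks orbT.
- by apply: leq_trans sz; apply: leq_addl.
have [kks|nkks] := boolP (k \in ks).
  have sub k' : (k' \in k :: ks) = (k' \in ks) by rewrite inE; case: eqP => // ->.
  by exists I; split=> [k'|k' k'']; rewrite !sub; [apply: IP | apply: Id].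
pose F := \bigcup_(k' <- ks) I k'.
have Fsz : #|F| <= p.
  apply: leq_trans sz; apply: leq_trans (leq_addl _ _).
  rewrite /F; elim: (ks) IP => [|k1 ks' IH] IP; first by rewrite big_nil cards0.
  rewrite big_cons /= mulSn; apply: leq_trans (leq_card_setU _ _) (leq_add _ (IH _)).
    by have [] := IP k1 (mem_head _ _).
  by move=> k' k'ks; apply: IP; rewrite inE k'ks orbT.
have [J [PJ JL JF]] := HP k F (mem_head _ _) Fsz.
have IF k' : k' \in ks -> I k' \subset F.
  by move=> k'ks; rewrite /F (big_rem k') //= subsetUl.
exists (fun k' => if k' == k then J else I k'); split=> [k'|k' k''].
  by rewrite inE; case: eqP => [->|_] //=; apply: IP.
rewrite !inE; case: eqP => [->|_]; case: eqP => [->|_] //=; rewrite ?eqxx //.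
- by move=> _ k''ks _; apply: disjointWr (IF _ k''ks) JF.
- by move=> k'ks _ _; rewrite disjoint_sym; apply: disjointWr (IF _ k'ks) JF.
- by move=> k'ks k''ks; apply: Id.
Qed.

Lemma rest_cmp V W x : cmp (rest e V) W x = cmp e (W :&: V) x.
Proof.
apply/setP=> y; rewrite !inE; apply: eq_connect => a b.
by rewrite /rest !inE; case: (a \in W); case: (b \in W); rewrite ?andbF ?andbT.
Qed.

(** With [2 <= l] every vertex of the hole is on an edge, hence in [V], where [rest e V] agrees with
    [e]. *)
Lemma rest_hole_free V l : 2 <= l -> hole_free e l -> hole_free (rest e V) l.
Proof.
move=> l2 HF n ln [c cP]; apply: (HF n ln); exists c.
have cV i : i < n -> c i \in V.
  move=> ni; have [i1n|i1n] := ltnP i.+1 n.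
    by have [|_] := cP i i.+1; [rewrite ltnSn | rewrite eqxx => /and3P[]].
  have i0 : 0 < i by lia.
  by have [|_] := cP i.-1 i; [lia | rewrite prednK // eqxx => /and3P[]].
move=> i j /andP[ij jn]; have [|ne <-] := cP i j; first by rewrite ij.
by rewrite /rest !cV // (ltn_trans ij).
Qed.

Section Connect.
Variables (l D : nat).
Hypotheses (l2 : 2 <= l) (HF : hole_free e l).
Hypothesis sparse : forall A B, cnt e A B <= D * #|A :|: B|.

Definition inseparable k x y := forall S : {set T}, x \notin S -> y \notin S ->
  #|S| < k -> y \in cmp e (~: S) x.

(** This is [short_path] after deletion of [F] and [X] except for [x] and [y]; the summand [p + m]
    pays for the deleted vertices. *)
Lemma connector p m X F x y : #|X| <= m -> #|F| <= p ->
  x != y -> ~~ e x y -> inseparable (p + m + path_const l D) x y ->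
  exists I, [/\ conn e I /\ [disjoint I & X], x \in nbhd e I, y \in nbhd e I,
    #|I| <= l + 1 & [disjoint I & F]].
Proof.
move=> Xm Fp xy nexy insep; pose V := ~: ((F :|: X) :\: [set x; y]).
have xV : x \in V by rewrite !inE eqxx.
have yV : y \in V by rewrite !inE eqxx orbT.
have sparse' A B : cnt (rest e V) A B <= D * #|A :|: B|.
  apply: leq_trans (sparse A B); apply/subset_leq_card/subsetP=> -[a b].
  by rewrite !inE /= => /and3P[-> -> /and3P[]].
have [d dl [f [f0 fd ip]]] : exists2 d, d <= l + 2 & exists f : nat -> T,
    [/\ f 0 = x, f d = y & ipath (rest e V) f d].
  have irr : irreflexive (rest e V) by move=> z; rewrite /rest e_irr !andbF.
  have yB := short_path (rest_sym e_sym V) irr l2 (rest_hole_free l2 HF) sparse' xy.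
  have {yB} yB : y \in ball (rest e V) setT x (l + 2).
    apply: yB; first by rewrite /rest !negb_and nexy !orbT.
    move=> S xS yS Sk; rewrite rest_cmp -[_ :&: _]setCK setCI !setCK; apply: insep.
    - by rewrite !inE (negPf xS) eqxx.
    - by rewrite !inE (negPf yS) eqxx orbT.
    - apply: leq_ltn_trans (leq_card_setU _ _) _; rewrite addnC -addnS leq_add //.
      apply: leq_trans (subset_leq_card (subsetDl _ _)) _.
      by apply: leq_trans (leq_card_setU _ _) _; apply: leq_add.
  have exB : exists i, y \in ball (rest e V) setT x i by exists (l + 2).
  case: (ex_minnP exB) => d yBd dmin.
  have yN i : i < d -> y \notin ball (rest e V) setT x i.
    by move=> id; apply/negP=> /dmin; rewrite leqNgt id.
  have [f [f0 fd ip _]] := ball_ipath (in_setT x) yN yBd.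
  by exists d; [apply: dmin | exists f].
have inj i j : i < j <= d -> f i <> f j by move=> /ip[/eqP].
have ef i : i < d -> rest e V (f i) (f i.+1).
  by move=> id; have [|_ ->] := ip i i.+1; [rewrite ltnSn | rewrite eqxx].
have d2 : 2 <= d.
  case: d {dl inj ip} fd ef => [|[|d]] // fd ef; first by rewrite -fd f0 eqxx in xy.
  by have := ef 0 isT; rewrite f0 fd /rest (negPf nexy) !andbF.
have fV t : 0 < t < d -> (f t \notin F) && (f t \notin X).
  move=> /andP[t0 td]; have /and3P[ftV _ _] := ef t td.
  have fx : f t != x by apply/eqP=> E; apply: (inj 0 t); rewrite ?f0 // t0 ltnW.
  have fy : f t != y by apply/eqP=> E; apply: (inj t d); rewrite ?fd // td leqnn.
  by move: ftV; rewrite !inE (negPf fx) (negPf fy) /= negb_or.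
exists (inner f d); split; [split | | | | ].
- have -> : inner f d = [set z | [exists i : 'I_d.-2.+1, z == f i.+1]].
    apply/setP=> z; rewrite inE; apply/innerP/existsP=> [[[|t] // /andP[_ td] ->]|[i /eqP->]].
      have lt : t < d.-2.+1 by lia.
      by exists (Ordinal lt).
    by exists i.+1 => //; have := ltn_ord i; lia.
  apply: (conn_ipathU e_sym (p := fun i => f i.+1)) => i id.
  by have /and3P[] := ef i.+1 ltac:(lia).
- apply/pred0P=> z /=; apply/negbTE/negP=> /andP[/innerP[t td ->] fX].
  by have := fV t td; rewrite fX andbF.
- apply/nbhdP; split.
    by apply/innerP=> -[t /andP[t0 td] E]; apply: (inj 0 t); rewrite ?f0 // t0 ltnW.
  exists (f 1); first by apply/innerP; exists 1.
  by rewrite e_sym -f0; have /and3P[] := ef 0 ltac:(lia).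
- apply/nbhdP; split.
    by apply/innerP=> -[t /andP[t0 td] E]; apply: (inj t d); rewrite ?fd // td leqnn.
  exists (f d.-1); first by apply/innerP; exists d.-1 => //; lia.
  by rewrite -fd; have /and3P[] := ef d.-1 ltac:(lia); rewrite prednK //; lia.
- by apply: leq_trans (leq_imset_card _ _) _; rewrite card_ord; lia.
- apply/pred0P=> z /=; apply/negbTE/negP=> /andP[/innerP[t td ->] fF].
  by have := fV t td; rewrite fF.
Qed.

(** Connectors are chosen greedily, each avoiding the earlier ones, of which there are at most
    [m * m] with [l + 1] vertices each. Ordered pairs get separate ones, so that a vertex of a
    connector reveals both indices; adjacent pairs get the empty set. *)
Lemma connectors m (x : 'I_m -> T) : injective x ->
  (forall i j, inseparable (m * m * (l + 1) + m + path_const l D) (x i) (x j)) ->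
  exists I : 'I_m -> 'I_m -> {set T}, [/\
    forall i j, i != j -> ~~ e (x i) (x j) ->
      [/\ conn e (I i j), x i \in nbhd e (I i j) & x j \in nbhd e (I i j)],
    forall i j k, x k \notin I i j,
    forall i j, #|I i j| <= l + 1 &
    forall i j i' j' z, z \in I i j -> z \in I i' j' -> i = i' /\ j = j'].
Proof.
move=> x_inj insep; pose X := [set x i | i : 'I_m].
have Xm : #|X| <= m by rewrite -[X in _ <= X]card_ord leq_imset_card.
pose ks := [seq p : 'I_m * 'I_m <- enum {: 'I_m * 'I_m} | (p.1 != p.2) && ~~ e (x p.1) (x p.2)].
pose P (p : 'I_m * 'I_m) I := [/\ conn e I, [disjoint I & X], x p.1 \in nbhd e I & x p.2 \in nbhd e I].
have [||I [IP Id]] := @greedy_disjoint _ P (m * m * (l + 1)) (l + 1) ks.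
- move=> [i j] F; rewrite mem_filter /= => /andP[/andP[ij nij] _] Fp.
  have xij : x i != x j by rewrite (inj_eq x_inj).
  have [I [[cI IX] iI jI Isz IF]] := connector Xm Fp xij nij (insep i j).
  by exists I.
- rewrite leq_mul2r size_filter; apply/orP; right; apply: leq_trans (count_size _ _) _.
  by rewrite -cardT card_prod card_ord.
have ksP i j : ((i, j) \in ks) = (i != j) && ~~ e (x i) (x j).
  by rewrite mem_filter /= mem_enum andbT.
exists (fun i j => if (i, j) \in ks then I (i, j) else set0); split.
- move=> i j ij nij; rewrite ksP ij nij /=.
  by have [|[]] := IP (i, j); first by rewrite ksP ij.
- move=> i j k; case: ifP => [/IP[[_ dX _ _] _]|_]; last by rewrite inE.
  by apply/negP=> /(disjointFr dX); rewrite imset_f.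
- by move=> i j; case: ifP => [/IP[]//|_]; rewrite cards0.
move=> i j i' j' z; case: ifP => [k1|_]; last by rewrite inE.
case: ifP => [k2|_]; last by rewrite inE.
move=> z1 z2; have [[-> ->]//|ne] := eqVneq (i, j) (i', j').
by have := Id _ _ k1 k2 ne => /disjointFr/(_ z1); rewrite z2.
Qed.

End Connect.
End Connectors.

(** * A hole through a cyclic tuple of vertices and connectors *)

Section RandomCycle.
Variables (T : finType) (e : rel T).
Hypotheses (e_sym : symmetric e) (e_irr : irreflexive e).
Implicit Types (A B C U V W X Y P F : {set T}) (z v : T).
Variables (m L : nat) (x : 'I_m -> T) (I : 'I_m -> 'I_m -> {set T}).
Hypothesis x_inj : injective x.
Hypothesis I_conn : forall i j, i != j -> ~~ e (x i) (x j) ->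
  [/\ conn e (I i j), x i \in nbhd e (I i j) & x j \in nbhd e (I i j)].
Hypothesis I_x : forall i j k, x k \notin I i j.
Hypothesis I_size : forall i j, #|I i j| <= L.
Hypothesis I_inj : forall i j i' j' z, z \in I i j -> z \in I i' j' -> i = i' /\ j = j'.

Definition touch A B := [exists a in A, exists b in B, e a b].

Lemma touchP A B : reflect (exists a b, [/\ a \in A, b \in B & e a b]) (touch A B).
Proof.
apply: (iffP existsP) => [[a /andP[aA /existsP[b /andP[bB eab]]]]|[a [b [aA bB eab]]]].
  by exists a, b.
by exists a; rewrite aA; apply/existsP; exists b; rewrite bB.
Qed.

Section Cycle.
Variables (n : nat) (f : {ffun 'I_n.+1 -> 'I_m}).

Definition good_tuple := [/\
  forall a b, a != b -> (f a != f b) && ~~ e (x (f a)) (x (f b)),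
  forall a b, a != b -> a != ordS b -> ~~ touch [set x (f a)] (I (f b) (f (ordS b))) &
  forall b c, b != c -> ~~ touch (I (f b) (f (ordS b))) (I (f c) (f (ordS c)))].

Hypothesis good : good_tuple.

Let y j := x (f (inord j)).
Let K j := I (f (inord j)) (f (ordS (inord j))).

Lemma inord_eq i j : i <= n -> j <= n -> (inord i == inord j :> 'I_n.+1) = (i == j).
Proof. by move=> ni nj; rewrite -val_eqE /= !inordK. Qed.

Lemma ordS_inord j : j < n -> ordS (inord j) = inord j.+1 :> 'I_n.+1.
Proof. by move=> jn; apply: val_inj; rewrite /= !inordK ?modn_small // ltnW. Qed.

Lemma ordS_inordn : ordS (inord n) = inord 0 :> 'I_n.+1.
Proof. by apply: val_inj; rewrite /= !inordK // modnn. Qed.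

Lemma y_good i j : i <= n -> j <= n -> i != j ->
  (f (inord i) != f (inord j)) && ~~ e (y i) (y j).
Proof. by have [g1 _ _] := good; move=> ni nj ij; apply: g1; rewrite inord_eq. Qed.

Lemma y_inj i j : i <= n -> j <= n -> y i = y j -> i = j.
Proof.
move=> ni nj /x_inj E; apply/eqP; apply/negPn/negP=> /(y_good ni nj).
by rewrite E eqxx.
Qed.

Lemma y_adj i j : i <= n -> j <= n -> ~~ e (y i) (y j).
Proof.
move=> ni nj; have [->|ij] := eqVneq i j; first by rewrite e_irr.
by have /andP[] := y_good ni nj ij.
Qed.

Lemma yK_touch i (b : 'I_n.+1) z : i <= n -> inord i != b -> inord i != ordS b ->
  z \in I (f b) (f (ordS b)) -> e (y i) z -> False.
Proof.
have [_ g2 _] := good; move=> ni ib ib1 zK eyz.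
case/negP: (g2 _ _ ib ib1); apply/touchP; exists (y i), z.
by rewrite set11.
Qed.

Lemma yK_adj i j z : i <= n -> j < n -> z \in K j -> e (y i) z -> i = j \/ i = j.+1.
Proof.
move=> ni jn zK eyz; have [->|ij] := eqVneq i j; first by left.
have [->|ij1] := eqVneq i j.+1; first by right.
have ib : inord i != inord j :> 'I_n.+1 by rewrite inord_eq // ltnW.
have ib1 : inord i != ordS (inord j) :> 'I_n.+1 by rewrite ordS_inord // inord_eq.
by case: (yK_touch ni ib ib1 zK eyz).
Qed.

Lemma K_adj i j z w : i <= n -> j <= n -> z \in K i -> w \in K j -> e z w -> i = j.
Proof.
have [_ _ g3] := good; move=> ni nj zK wK ezw; apply/eqP; rewrite -inord_eq //.
by apply/negPn/negP=> /g3/negP; apply; apply/touchP; exists z, w.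
Qed.

Fixpoint chain t := if t is t'.+1 then y t |: (K t' :|: chain t') else [set y 0].

Lemma chainP t z : z \in chain t ->
  (exists2 j, j <= t & z = y j) \/ (exists2 j, j < t & z \in K j).
Proof.
elim: t => [|t IHt] /=; first by move/set1P->; left; exists 0.
case/setU1P=> [->|/setUP[zK|/IHt]]; [by left; exists t.+1 | by right; exists t | ].
by case=> -[j jt zj]; [left | right]; exists j => //; lia.
Qed.

Lemma K_conn j : j < n -> [/\ conn e (K j), y j \in nbhd e (K j) & y j.+1 \in nbhd e (K j)].
Proof.
move=> jn; rewrite /K ordS_inord //.
have jj : j != j.+1 by rewrite neq_ltn ltnSn.
have /andP[ne na] := y_good (ltnW jn) jn jj.
exact: I_conn.
Qed.

Lemma chain_conn t : t <= n -> conn e (chain t) /\ y t \in chain t.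
Proof.
elim: t => [_|t IHt tn] /=; first by split; [apply: conn1 | apply: set11].
have [cC yC] := IHt (ltnW tn); have [cK /nbhdP[_ [u uK uy]] /nbhdP[_ [v vK vy]]] := K_conn tn.
split; last exact: setU11.
apply: (conn_add e_sym (x := v)) => //; last by rewrite inE vK.
by apply: (connU e_sym cK cC uK yC); right.
Qed.

Lemma chain0 t : y 0 \in chain t.
Proof. by elim: t => [|t IHt] /=; rewrite !inE ?eqxx ?IHt ?orbT. Qed.

(** Moving on to the next tuple vertex passes through a connector and takes at least two steps. So
    [y 0] and [y n] are at distance at least [2 * n] in the chain. *)
Lemma chain_ball i z : z \in ball e (chain n) (y 0) i ->
  (exists j, [/\ 2 * j <= i, j <= n & z = y j]) \/
  (exists j, [/\ 2 * j + 1 <= i, j < n & z \in K j]).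
Proof.
move: i z; apply: ball_ind.
- by left; exists 0.
- by move=> i z [[j [ji jn zj]]|[j [ji jn zj]]]; [left | right]; exists j; split=> //; lia.
move=> i z w [[j [ji jn ->]]|[j [ji jn zj]]] wC ezw; case: (chainP wC) => -[k kn wk].
- by rewrite wk (negPf (y_adj jn kn)) in ezw.
- right; exists k; split=> //; have [|] := yK_adj jn kn wk ezw; lia.
- left; exists k; split=> //; rewrite wk e_sym in ezw.
  by have [|] := yK_adj kn jn zj ezw; lia.
- right; exists j; split=> //; first lia.
  by rewrite (K_adj (ltnW jn) (ltnW kn) zj wk ezw).
Qed.

Lemma cycle_hole : 2 <= n -> exists2 k, 2 * n <= k & hole e k.
Proof.
move=> n2; pose U := chain n :\: [set y 0; y n].
have [cC ynC] := chain_conn (leqnn n).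
have UE : y 0 |: (y n |: U) = chain n.
  rewrite setUA /U -[RHS](setID _ [set y 0; y n]); congr setU.
  by apply/esym/setIidPr; rewrite subUset !sub1set chain0 ynC.
have y0n : y 0 != y n by apply/eqP=> /y_inj E; move: n2; rewrite -E.
have [cW yW y0W] : [/\ conn e (K n), y n \in nbhd e (K n) & y 0 \in nbhd e (K n)].
  have n0 : n != 0 by rewrite -lt0n ltnW.
  rewrite /K ordS_inordn; have /andP[ne na] := y_good (leqnn n) (leq0n n) n0.
  exact: I_conn.
have [||||||k k3 hk] := @long_hole _ _ e_sym U (K n) (y 0) (y n) (2 * n - 1) _ cW y0n _ _ _ y0W yW _ _.
- by rewrite UE.
- exact: y_adj.
- by rewrite !inE eqxx.
- by rewrite !inE eqxx orbT.
- move=> u w; rewrite !inE negb_or => /andP[/andP[u0 un] uC] wK; apply/andP.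
  case: (chainP uC) => -[j jn uj].
    split; first by apply: contraTneq wK => <-; rewrite uj I_x.
    apply/negP; rewrite uj => euw; apply: (yK_touch jn _ _ wK euw).
    + by rewrite inord_eq //; apply: contraNneq un => jn'; rewrite uj jn'.
    + by rewrite ordS_inordn inord_eq //; apply: contraNneq u0 => j0; rewrite uj j0.
  split; last by apply/negP=> euw; have := K_adj (ltnW jn) (leqnn n) uj wK euw; lia.
  apply: contraTneq wK => <-; apply/negP=> uK; have [E _] := I_inj uj uK.
  have jn' : j != n by rewrite neq_ltn jn.
  by have := y_good (ltnW jn) (leqnn n) jn'; rewrite E eqxx.
- rewrite UE; apply/negP=> /chain_ball[[j [ji jn /y_inj E]]|[j [ji jn yj]]].
    by have := E (leqnn n) jn; lia.
  by have := I_x (f (inord j)) (f (ordS (inord j))) (f (inord n)); rewrite -/(y n) -/(K j) yj.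
- by exists k => //; lia.
Qed.

End Cycle.

(* By sparsity a random tuple violates each of the boundedly many conditions with
   probability [O(1 / m)]. *)
Section Count.
Variables (n D : nat).
Hypothesis n2 : 2 <= n.
Hypothesis sparse : forall A B, cnt e A B <= D * #|A :|: B|.
Hypothesis m_big : 4 * (n.+1 * n.+1) * (D * (L + 1) + 1) < m.

Let N := n.+1.
Let c := D * (L + 1) + 1.
Let V := \bigcup_(p : 'I_m * 'I_m) I p.1 p.2.
Let X := [set x i | i : 'I_m].
Let edges A B := [set p : T * T | [&& p.1 \in A, p.2 \in B & e p.1 p.2]].

Let N2 : 2 <= N := ltnW (n2 : 2 < N).

Lemma m_gt0 : 0 < m. Proof. exact: leq_ltn_trans (leq0n _) m_big. Qed.

Lemma card_V : #|V| <= m * m * L.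
Proof.
apply: (@leq_trans (\sum_(p : 'I_m * 'I_m) #|I p.1 p.2|)).
  exact: card_bigcup_le.
apply: (@leq_trans (\sum_(p : 'I_m * 'I_m) L)); first by apply: leq_sum => p _.
by rewrite sum_nat_const cardT -cardT card_prod card_ord.
Qed.

Lemma card_X : #|X| = m.
Proof. by rewrite card_imset // card_ord. Qed.

(** A bad tuple has a witness in [Ed] that fixes at least [k] entries. This leaves at most
    [c * m ^ (k - 1)] witnesses and [m ^ (N - k)] tuples for each, a fraction [c / m] of all
    tuples. *)
Lemma bad_count (C : {set 'I_N}) (Ed : {set T * T}) (Bad : pred {ffun 'I_N -> 'I_m})
    (R : {ffun 'I_N -> 'I_m} -> T * T -> Prop) k :
  0 < k -> k <= #|C| -> #|Ed| <= c * m ^ k.-1 ->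
  (forall f, Bad f -> exists2 p, p \in Ed & R f p) ->
  (forall f g p, R f p -> R g p -> forall i, i \in C -> f i = g i) ->
  #|[set f | Bad f]| * m <= c * m ^ N.
Proof.
move=> k0 kC EdC BadE Rdet.
have BadE' f : f \in [set f | Bad f] -> exists2 p, p \in Ed & R f p.
  by rewrite inE; apply: BadE.
have := override_count BadE' Rdet; move: #|[set f | Bad f]| => b H.
have mk : 0 < m ^ k.-1 by rewrite expn_gt0 m_gt0.
rewrite -(leq_pmul2r mk) -mulnA -expnS prednK //.
apply: leq_trans (_ : b * m ^ #|C| <= _).
  by rewrite leq_mul2l leq_pexp2l ?m_gt0 ?orbT.
apply: leq_trans H _; rewrite mulnAC leq_mul2r EdC orbT //.
Qed.

Lemma bad_eq a b : a != b ->
  #|[set f : {ffun 'I_N -> 'I_m} | f a == f b]| * m <= c * m ^ N.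
Proof.
(* No edge is involved here: the witness is the repeated vertex, paired with a dummy. *)
move=> ab; apply: (@bad_count [set a; b] (setX X [set x (Ordinal m_gt0)]) _
  (fun f p => p.1 = x (f a) /\ f a = f b) 2) => //.
- by rewrite cards2 ab.
- rewrite cardsX card_X cards1 muln1 expn1 -{1}[m]mul1n leq_mul2r /c addn1 orbT //.
- move=> f /eqP E; exists (x (f a), x (Ordinal m_gt0)) => //.
  by rewrite !inE eqxx andbT; apply: imset_f.
- move=> f g p [-> E1] [/x_inj E E2] i; rewrite !inE => /orP[]/eqP->; by rewrite // -E1 -E2.
Qed.

Lemma card_edges_le A B k : D * #|A :|: B| <= c * m ^ k -> #|edges A B| <= c * m ^ k.
Proof. exact: leq_trans (sparse A B). Qed.

Lemma degree_V : D * #|V| <= c * m ^ 2.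
Proof.
apply: leq_trans (leq_mul (leqnn D) card_V) _; rewrite /c expnS expn1.
by rewrite mulnA mulnAC; apply: leq_mul => //; nia.
Qed.

Lemma degree_X : D * #|X| <= c * m.
Proof. by rewrite card_X leq_mul2r /c; apply/orP; right; nia. Qed.

Lemma degree_XV : D * #|X :|: V| <= c * m ^ 2.
Proof.
apply: leq_trans (leq_mul (leqnn D) (leq_card_setU _ _)) _.
rewrite card_X; apply: leq_trans (leq_mul (leqnn D) (leq_add (leqnn m) card_V)) _.
have := m_gt0; rewrite /c expnS expn1; move: (m) => M M0; nia.
Qed.

Lemma bad_adj a b : a != b ->
  #|[set f : {ffun 'I_N -> 'I_m} | e (x (f a)) (x (f b))]| * m <= c * m ^ N.
Proof.
move=> ab; apply: (@bad_count [set a; b] (edges X X) _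
  (fun f p => p.1 = x (f a) /\ p.2 = x (f b)) 2) => //.
- by rewrite cards2 ab.
- by rewrite expn1 -[m in c * m]expn1; apply: card_edges_le; rewrite setUid expn1 degree_X.
- move=> f E; exists (x (f a), x (f b)) => //.
  by rewrite !inE /= E !imset_f.
- move=> f g p [-> ->] [/x_inj E1 /x_inj E2] i; by rewrite !inE => /orP[]/eqP->.
Qed.

Lemma mem_V i j z : z \in I i j -> z \in V.
Proof. by move=> zI; apply/bigcupP; exists (i, j). Qed.

Lemma bad_vertex a b : a != b -> a != ordS b ->
  #|[set f : {ffun 'I_N -> 'I_m} | touch [set x (f a)] (I (f b) (f (ordS b)))]| * m <= c * m ^ N.
Proof.
move=> ab ab'; apply: (@bad_count [set a; b; ordS b] (edges X V) _
  (fun f p => p.1 = x (f a) /\ p.2 \in I (f b) (f (ordS b))) 3) => //.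
- rewrite setUC cardsU1 cards2 ab !inE negb_or (ordS_neq _ N2).
  by rewrite eq_sym ab'.
- by apply: card_edges_le; apply: degree_XV.
- move=> f /touchP[z [w [/set1P-> wI ezw]]]; exists (x (f a), w) => //.
  by rewrite !inE /= ezw imset_f // (mem_V wI).
- move=> f g p [-> I1] [/x_inj E1 I2]; have [E2 E3] := I_inj I1 I2.
  by move=> i; rewrite !inE => /orP[/orP[]|]/eqP->.
Qed.

Lemma bad_paths b b' : b != b' ->
  #|[set f : {ffun 'I_N -> 'I_m} |
     touch (I (f b) (f (ordS b))) (I (f b') (f (ordS b')))]| * m <= c * m ^ N.
Proof.
move=> bb'; apply: (@bad_count [set b; ordS b; b'; ordS b'] (edges V V) _
  (fun f p => p.1 \in I (f b) (f (ordS b)) /\ p.2 \in I (f b') (f (ordS b'))) 3) => //.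
(* Consecutive connectors share an index, but even then three distinct positions occur, as the cycle
   has at least three. *)
- have [c' c'b [cb cSb]] : exists2 c', c' \in [set b'; ordS b'] & c' != b /\ c' != ordS b.
    have [bE|bE] := eqVneq b' (ordS b); last by exists b'; rewrite ?set21 // eq_sym bb'.
    by exists (ordS b'); rewrite ?set22 // bE (ordSS_neq _ (n2 : 2 < N)) (ordS_neq _ N2).
  have <- : #|c' |: [set b; ordS b]| = 3.
    by rewrite cardsU1 cards2 !inE negb_or cb cSb eq_sym (ordS_neq _ N2).
  apply/subset_leq_card/subsetP=> i; rewrite !inE => /orP[/eqP->|/orP[]/eqP->].
  + by move: c'b; rewrite !inE => /orP[]->; rewrite !orbT.
  + by rewrite eqxx.
  + by rewrite eqxx !orbT.
- by apply: card_edges_le; rewrite setUid; apply: degree_V.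
- move=> f /touchP[z [w [zI wI ezw]]]; exists (z, w) => //.
  by rewrite !inE /= ezw (mem_V zI) (mem_V wI).
- move=> f g p [I1 J1] [I2 J2]; have [E1 E2] := I_inj I1 I2; have [E3 E4] := I_inj J1 J2.
  by move=> i; rewrite !inE => /orP[/orP[/orP[]|]|]/eqP->.
Qed.

(** Union bound: four kinds of conditions, [N * N] pairs of positions, and a fraction of at most
    [c / m] bad tuples for each. This is the origin of [m_big]. *)
Lemma good_tuple_exists : exists f : {ffun 'I_N -> 'I_m}, good_tuple f.
Proof.
apply: contrapT => nex.
pose bad k (p : 'I_N * 'I_N) (f : {ffun 'I_N -> 'I_m}) := match k with
  | 0 => (p.1 != p.2) && (f p.1 == f p.2)
  | 1 => (p.1 != p.2) && e (x (f p.1)) (x (f p.2))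
  | 2 => [&& p.1 != p.2, p.1 != ordS p.2 & touch [set x (f p.1)] (I (f p.2) (f (ordS p.2)))]
  | _ => (p.1 != p.2) && touch (I (f p.1) (f (ordS p.1))) (I (f p.2) (f (ordS p.2)))
  end.
have badP f : exists q : 'I_4 * ('I_N * 'I_N), bad q.1 q.2 f.
  apply: contrapT => nbad; apply: nex; exists f; split=> a b ab.
  - apply/andP; split; apply/negP=> H; apply: nbad.
      by exists (inord 0, (a, b)); rewrite /= inordK //= ab H.
    by exists (inord 1, (a, b)); rewrite /= inordK //= ab H.
  - move=> ab'; apply/negP=> H; apply: nbad.
    by exists (inord 2, (a, b)); rewrite /= inordK //= ab ab' H.
  - apply/negP=> H; apply: nbad.
    by exists (inord 3, (a, b)); rewrite /= inordK //= ab H.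
have bad_le k p : #|[set f | bad k p f]| * m <= c * m ^ N.
  have set0_le (Q : pred {ffun 'I_N -> 'I_m}) : #|[set f | false && Q f]| * m <= c * m ^ N.
    by rewrite (_ : [set f | _] = set0) ?cards0 //; apply/setP=> f; rewrite !inE.
  case: p => a b; rewrite /bad /=; case: (boolP (a != b)) => ab; last first.
    by case: k => [|[|[|k]]]; apply: set0_le.
  case: k => [|[|[|k]]] /=; [exact: bad_eq | exact: bad_adj | | exact: bad_paths].
  case: (boolP (a != ordS b)) => ab'; [exact: bad_vertex | exact: set0_le].
have : #|[set: {ffun 'I_N -> 'I_m}]| * m <=
    \sum_(q : 'I_4 * ('I_N * 'I_N)) #|[set f | bad q.1 q.2 f]| * m.
  rewrite -big_distrl leq_mul2r /=; apply/orP; right.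
  apply: (@leq_trans #|\bigcup_(q : 'I_4 * ('I_N * 'I_N)) [set f | bad q.1 q.2 f]|).
    apply/subset_leq_card/subsetP=> f _; have [q qf] := badP f.
    by apply/bigcupP; exists q; rewrite ?inE.
  exact: card_bigcup_le.
rewrite cardsT card_ffun !card_ord.
have le2 : \sum_(q : 'I_4 * ('I_N * 'I_N)) #|[set f | bad q.1 q.2 f]| * m <=
    \sum_(q : 'I_4 * ('I_N * 'I_N)) c * m ^ N by apply: leq_sum => q _; apply: bad_le.
move=> /leq_trans/(_ le2).
rewrite sum_nat_const cardT -cardT !card_prod !card_ord mulnA [m ^ N * m]mulnC leq_pmul2r.
  by rewrite leqNgt m_big.
by rewrite expn_gt0 m_gt0.
Qed.

End Count.
End RandomCycle.

Section Block.
Variables (T : finType) (e : rel T) (l D : nat).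
Hypotheses (e_sym : symmetric e) (e_irr : irreflexive e).
Hypotheses (l2 : 2 <= l) (HF : hole_free e l).
Hypothesis sparse : forall A B, cnt e A B <= D * #|A :|: B|.

(** The least [m] that [m_big] allows for [n = l] and connectors of size [L = l + 1]. *)
Definition block_size := (4 * (l.+1 * l.+1) * (D * (l + 1 + 1) + 1)).+1.
Definition block_order := block_size * block_size * (l + 1) + block_size + path_const l D.

Theorem no_block (X : {set T}) : block_size <= #|X| ->
  ~ forall x y, x \in X -> y \in X -> inseparable e block_order x y.
Proof.
move=> mX insep; pose x (i : 'I_block_size) := enum_val (widen_ord mX i).
have xX i : x i \in X by apply: enum_valP.
have x_inj : injective x.
  by move=> i j /enum_val_inj E; apply: val_inj; have := congr1 val E.
have [I [Ic Ix Isz Ii]] := connectors e_sym e_irr l2 HF sparse x_inj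
  (fun i j => insep _ _ (xX i) (xX j)).
have [f gf] := good_tuple_exists x_inj Isz Ii l2 sparse (leqnn _).
have [k lk hk] := cycle_hole e_sym e_irr x_inj Ic Ix Ii gf l2.
by apply: (HF _ hk); apply: leq_trans lk; rewrite mul2n -addnn leq_addr.
Qed.

End Block.

(** * Havens *)

Section Haven.
Variables (T : finType).
Implicit Types (e : rel T) (A B C R S U V W X Z : {set T}) (u v w x y z : T).

(** The first clauses make [b S] a component of the graph without [S]. Monotonicity takes the place
    of the condition that any two values touch. *)
Definition haven e N (b : {set T} -> {set T}) :=
  (forall S, #|S| < N -> [/\ b S != set0, conn e (b S), [disjoint b S & S] &
    nbhd e (b S) \subset S]) /\
  (forall S S', #|S'| < N -> S \subset S' -> b S' \subset b S).

Definition separable (b : {set T} -> {set T}) k v := exists S : {set T}, [/\ #|S| < k, v \notin S & v \notin b S].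

Lemma conn_nbhd e U W : conn e U -> [disjoint U & nbhd e W] ->
  (exists2 z, z \in U & z \in W) -> U \subset W.
Proof.
move=> cU dis [z zU zW]; apply: (cU z) => // a c aW aU cU' eac.
apply: contraT => cW; have cn : c \in nbhd e W by apply/nbhdP; split=> //; exists a.
by rewrite (disjointFr dis cU') in cn.
Qed.

Lemma ball_monoV e V W x i : V \subset W -> ball e V x i \subset ball e W x i.
Proof.
move=> VW; apply/subsetP=> y0; apply: (ball_ind (P := fun j y => y \in ball e W x j)).
- exact: ball_id.
- by move=> j y; apply: (subsetP (ball_mono _ _ _ (leqnSn j))).
- by move=> j y z yB zV eyz; apply: ball_step yB _ eyz; apply: (subsetP VW).
Qed.

Section AllSeparable.
Variables (e : rel T) (l k N : nat) (b : {set T} -> {set T}).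
Hypothesis e_sym : symmetric e.
Hypotheses (l1 : 1 <= l) (HF : hole_free e l).
Hypothesis hav : haven e N b.
Hypothesis sep : forall v, separable b k v.
Hypothesis bigN : 2 * k ^ l < N.

Let hav1 := hav.1.
Let hav2 := hav.2.

Lemma k_gt0 u : 0 < k.
Proof. by have [S [Sk _ _]] := sep u; apply: leq_ltn_trans (leq0n _) Sk. Qed.

(* Iterate [v |-> S_v], where [S_v] is a small set separating [v] from the haven:
   this works although balls are not of bounded size. *)
Lemma far_set u : exists R, [/\ #|R| <= k ^ l & [disjoint ball e setT u l & b R]].
Proof.
have k0 := k_gt0 u; have /choice[Sf SfP] := sep.
pose fix Rs i := if i is j.+1 then Rs j :|: \bigcup_(w in Rs j) Sf w else [set u].
have Rsz i : #|Rs i| <= k ^ i.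
  elim: i => [|i IHi] /=; first by rewrite cards1.
  apply: leq_trans (leq_card_setU _ _) _.
  have : #|\bigcup_(w in Rs i) Sf w| <= #|Rs i| * k.-1.
    apply: (@leq_trans (\sum_(w in Rs i) #|Sf w|)).
      exact: card_bigcup_le.
    rewrite -sum_nat_const; apply: leq_sum => w _; have [Sk _ _] := SfP w.
    by rewrite -ltnS prednK.
  rewrite expnS; move: IHi k0; move: #|Rs i| (k ^ i) #|_| => r ki m; nia.
have Rlt i : i <= l -> #|Rs i| < N.
  move=> il; apply: leq_ltn_trans (Rsz i) (leq_ltn_trans _ bigN).
  by apply: (@leq_trans (k ^ l)); [rewrite leq_pexp2l | lia].
(* If a neighbour [v] of [v'] lay in [b (Rs i.+1)], then [v'] would border [b (Rs i)], hence lie in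
   [Rs i]. But then [Sf v'] has been added, and it keeps the neighbours of [v'] out of the haven as
   well. *)
have dis i : i <= l -> forall v, v \in ball e setT u i -> v \notin b (Rs i).
  elim: i => [|i IHi] il v.
    move=> /set1P->; have [_ _ dR _] := hav1 (Rlt 0 il).
    by rewrite (disjointFl dR) // set11.
  have bS : b (Rs i.+1) \subset b (Rs i) by apply: hav2 (Rlt _ il) (subsetUl _ _).
  case/ballSP=> [vB|[_ [v' vB ev]]].
    by apply: contra (IHi (ltnW il) v vB); apply: (subsetP bS).
  have v'b := IHi (ltnW il) v' vB.
  apply/negP=> vb; have [v'R|v'R] := boolP (v' \in Rs i).
    have [Sk v'S v'bS] := SfP v'; have SR : Sf v' \subset Rs i.+1.
      by apply: subset_trans (subsetUr _ _); apply: bigcup_sup.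
    have SN : #|Sf v'| < N by apply: leq_ltn_trans (subset_leq_card SR) (Rlt _ il).
    have [_ _ _ nS] := hav1 SN; case/negP: v'S; apply: (subsetP nS); apply/nbhdP.
    by split=> //; exists v; rewrite 1?e_sym //; apply: (subsetP (hav2 (Rlt _ il) SR)).
  have [_ _ _ nR] := hav1 (Rlt i (ltnW il)).
  case/negP: v'R; apply: (subsetP nR); apply/nbhdP; split=> //.
  by exists v; rewrite 1?e_sym //; apply: (subsetP bS).
exists (Rs l); split=> //; apply/pred0P=> v /=; apply/negbTE/negP=> /andP[vB vb].
by have := dis l (leqnn l) v vB; rewrite vb.
Qed.

(* [S] is a minimal separator between [U] and the haven.  Since holes are short,
   [S] lies in the [l]-ball of each [u \in S], so [far_set] gives a new bounded
   separator closer to the haven. *)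
Definition full U S := [/\ conn e U, S = nbhd e U, #|S| <= k ^ l,
  S \subset nbhd e (b S) & [disjoint U & b S]].

Lemma b0_closed S u : #|S| < N -> u \in nbhd e (b S) -> u \in b set0.
Proof.
move=> SN /nbhdP[ub [w wb ewu]]; have N0 : #|(set0 : {set T})| < N.
  by apply: leq_ltn_trans SN; rewrite cards0.
have [_ _ _ n0] := hav1 N0; apply: contraT => u0.
suff : u \in (set0 : {set T}) by rewrite inE.
apply: (subsetP n0); apply/nbhdP; split=> //; exists w => //.
exact: (subsetP (hav2 SN (sub0set _))).
Qed.

(** The border of [U] lies in [nbhd e (b S')]; so it is no larger than [R], and each of its vertices
    touches the haven. It is not empty: [U] avoids [b (nbhd e U)], but [u] lies in [b set0]. *)
Lemma full_build u R S' : u \in b set0 -> #|R| <= k ^ l -> R \subset S' -> #|S'| < N ->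
  nbhd e (b S') \subset R -> u \notin b S' -> u \notin nbhd e (b S') ->
  let U := cmp e (~: nbhd e (b S')) u in
  [/\ full U (nbhd e U), nbhd e U != set0, b S' \subset b (nbhd e U) & u \in U].
Proof.
move=> u0 Rk RS' S'N nR ub un U; have uV : u \in ~: nbhd e (b S') by rewrite inE.
have cU : conn e U by apply: conn_cmp.
have uU : u \in U by apply: cmp_id.
have UV : U \subset ~: nbhd e (b S') by apply: cmp_sub.
have nU : nbhd e U \subset nbhd e (b S').
  apply/subsetP=> z zU; apply: contraT => zn; have := disjointFr (cmp_nbhd e uV) zU.
  by rewrite inE zn.
have nUS' : nbhd e U \subset S' by apply: subset_trans nU (subset_trans nR RS').
have nUN : #|nbhd e U| < N by apply: leq_ltn_trans (subset_leq_card nUS') S'N.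
have sub : b S' \subset b (nbhd e U) by apply: hav2.
have [bn0 cb bd bn] := hav1 nUN; have [b'0 cb' b'd b'n] := hav1 S'N.
have dUb : [disjoint U & b (nbhd e U)].
  apply/pred0P=> z /=; apply/negbTE/negP=> /andP[zU zb].
  have bU : b (nbhd e U) \subset U by apply: conn_nbhd cb bd _; exists z.
  have [w wb] := set0Pn _ b'0.
  have wU : w \in U by apply: (subsetP bU); apply: (subsetP sub).
  have [p [q [pU pb qU qb epq]]] := conn_cut cU wU wb uU ub.
  have := subsetP UV q qU; rewrite inE => /nbhdP[]; split=> //; by exists p.
split=> //.
- split=> //; first by apply: leq_trans (subset_leq_card nU) (leq_trans (subset_leq_card nR) Rk).
  apply/subsetP=> z zU; apply/nbhdP; split; first by rewrite (disjointFl bd zU).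
  have /nbhdP[_ [w wb ewz]] := subsetP nU z zU.
  by exists w => //; apply: (subsetP sub).
- apply/eqP=> E; have := disjointFr dUb uU; by rewrite E u0.
Qed.

Lemma all_separable_false : False.
Proof.
have N0 : #|(set0 : {set T})| < N by rewrite cards0; apply: leq_ltn_trans (leq0n _) bigN.
have kN : k ^ l < N by apply: leq_ltn_trans bigN; rewrite mul2n -addnn leq_addr.
have near u R : [disjoint ball e setT u l & b R] -> forall S', b S' \subset b R ->
    (u \notin b S') && (u \notin nbhd e (b S')).
  move=> dR S' sub; have ub v : v \in ball e setT u 1 -> v \notin b S'.
    move=> vB; have /(disjointFr dR) vR := subsetP (ball_mono e setT u l1) v vB.
    by apply: contraFN vR; apply: (subsetP sub).
  have uu := ball_id e setT u 1; rewrite ub //=; apply/nbhdP=> -[_ [w wb ewu]].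
  have wB : w \in ball e setT u 1.
    by apply: ball_step (ball_id _ _ _ _) (in_setT _) _; rewrite e_sym.
  by have := ub w wB; rewrite wb.
have desc n : forall U S, full U S -> S != set0 -> #|b S| < n -> False.
  elim: n => // n IHn U S [cU SE Sk Sb dUb] S0 bn.
  have SN : #|S| < N := leq_ltn_trans Sk kN.
  have [u uS] := set0Pn _ S0; have ub := subsetP Sb u uS.
  have [R [Rk dR]] := far_set u.
  have S'N : #|S :|: R| < N.
    apply: leq_ltn_trans (leq_card_setU _ _) (leq_ltn_trans _ bigN).
    by rewrite mul2n -addnn leq_add.
  have [bS0 cbS dbS nbS] := hav1 SN; have [b'0 cb' db' nb'] := hav1 S'N.
  have RN : #|R| < N := leq_ltn_trans Rk kN.
  have [_ _ _ nbR] := hav1 RN.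
  have sub1 : b (S :|: R) \subset b R by apply: hav2 S'N (subsetUr _ _).
  have sub2 : b (S :|: R) \subset b S by apply: hav2 S'N (subsetUl _ _).
  have /andP[unb unn] := near u R dR _ sub1.
  (* [U] and [b S] are anticomplete and both border on [u] and [z], so a larger distance would give
     a long hole. *)
  have closeS z : z \in S -> z \in ball e setT u l.
    move=> zS; have [->|zu] := eqVneq z u; first exact: ball_id.
    have [euz|neuz] := boolP (e u z).
      apply: (subsetP (ball_mono e setT u l1)).
      exact: ball_step (ball_id _ _ _ _) (in_setT _) euz.
    apply: contraT => zB; move: (uS) (zS); rewrite SE => /nbhdP[uU [p pU epu]] /nbhdP[zU [q qU eqz]].
    have [||||m lm hm] := @long_hole _ _ e_sym U (b S) u z l _ cbS _ neuz uU zU ub (subsetP Sb z zS) _ _.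
    - by apply: (conn_add e_sym (x := p)); rewrite ?inE ?pU ?orbT //; apply: (conn_add e_sym cU qU).
    - by rewrite eq_sym.
    - move=> c w cUu wb; rewrite -negb_or; apply/negP=> cw.
      have cb : c \notin b S by rewrite (disjointFr dUb).
      case/orP: cw => [/eqP cw|ecw]; first by rewrite cw wb in cb.
      have wU : w \notin U by rewrite (disjointFl dUb).
      have wS : w \in S by rewrite SE; apply/nbhdP; split=> //; exists c.
      by rewrite (disjointFl dbS wS) in wb.
    - by apply: contra zB; apply: (subsetP (ball_monoV e u l (subsetT _))).
    - by case: (HF _ hm); apply: leq_trans lm; rewrite leq_addr.
  (* [S] lies in a ball that [b R] avoids, so a vertex of [S] bordering [b (S :|: R)] borders [b R]
     and is in [R]. Hence the new separator again has at most [k ^ l] vertices, not [2 * k ^ l]. *)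
  have nR : nbhd e (b (S :|: R)) \subset R.
    apply/subsetP=> z zn; have := subsetP nb' z zn; rewrite inE => /orP[zS|//].
    have zR := disjointFr dR (closeS z zS); have /nbhdP[_ [w wb ewz]] := zn.
    apply: (subsetP nbR); apply/nbhdP; rewrite zR; split=> //; exists w => //.
    exact: (subsetP sub1).
  have u0 : u \in b set0 := b0_closed SN ub.
  have [fU' S'0 sub3 uU'] := full_build u0 Rk (subsetUr _ _) S'N nR unb unn.
  set U' := cmp _ _ _ in fU' S'0 sub3 uU'; apply: (IHn U' _ fU' S'0).
  have [cU' _ S''k _ dU'] := fU'.
  have S''N := leq_ltn_trans S''k kN; have [b''0 cb'' db'' nb''] := hav1 S''N.
  have UU' : u |: U \subset U'.
    move: (uS); rewrite SE => /nbhdP[_ [p pU epu]].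
    apply: conn_sub_cmp; last exact: setU11; first exact: (conn_add e_sym cU pU).
    apply/subsetP=> z /setU1P[->|zU]; rewrite in_setC //; apply/nbhdP=> -[zb [w wb ewz]].
    have wS := subsetP sub2 w wb.
    have zS : z \in S.
      apply: (subsetP nbS); apply/nbhdP; split; last by exists w.
      by rewrite (disjointFr dUb).
    by rewrite SE in zS; have /nbhdP[] := zS; rewrite zU.
  have subb : b (nbhd e U') \subset b S.
    apply: (conn_nbhd cb''); last first.
      by have [w wb] := set0Pn _ b'0; exists w; [apply: (subsetP sub3) | apply: (subsetP sub2)].
    apply: disjointWr nbS _; apply/pred0P=> z /=; apply/negbTE/negP=> /andP[zb zS].
    move: zS; rewrite SE => /nbhdP[zU [p pU epz]].
    have zU' : z \notin U' by rewrite (disjointFl dU').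
    have zn : z \in nbhd e U'.
      apply/nbhdP; split=> //; exists p => //; apply: (subsetP UU'); by rewrite inE pU orbT.
    by rewrite (disjointFr db'' zb) in zn.
  (* The haven side shrinks strictly: [u] has a neighbour in [b S], and [u] now belongs to [U']. *)
  rewrite ltnS in bn; apply: leq_trans bn; apply: proper_card; apply/properP; split=> //.
  have /nbhdP[_ [w wb ewu]] := ub; exists w => //; apply/negP=> wb''.
  have wU' : w \notin U' by rewrite (disjointFl dU').
  have wn : w \in nbhd e U' by apply/nbhdP; split=> //; exists u; rewrite // e_sym.
  by rewrite (disjointFr db'' wb'') in wn.
have [b00 _ _ _] := hav1 N0; have [u u0] := set0Pn _ b00.
have [R [Rk dR]] := far_set u; have RN : #|R| < N := leq_ltn_trans Rk kN.
have [_ _ _ nR] := hav1 RN; have /andP[unb unn] := near u R dR _ (subxx _).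
have [fU S0 _ _] := full_build u0 Rk (subxx _) RN nR unb unn.
exact: desc fU S0 (ltnSn _).
Qed.

End AllSeparable.

Lemma conn_rest e U V : conn e U -> U \subset V -> conn (rest e V) U.
Proof.
move=> cU UV x A xU xA clA; apply: (cU x) => // a b aA aU bU eab.
by apply: (clA a) => //; rewrite /rest !(subsetP UV).
Qed.

(** * From havens to balanced separators *)

Section NoHaven.
Variables (e : rel T) (l s : nat).
Hypotheses (e_sym : symmetric e) (e_irr : irreflexive e).
Hypotheses (l2 : 2 <= l) (s0 : 0 < s).
Hypotheses (HF : hole_free e l) (NK : biclique_free e s).

Let D := density_const l s.
Let K := block_order l D.

(** [all_separable_false] needs [2 * K ^ l + 1]; the last summand allows adding the fewer than
    [block_size] deleted vertices to each set. *)
Definition haven_order := 2 * block_order l (density_const l s) ^ l + 1 +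
  block_size l (density_const l s).

(** Both vertices lie in the connected set [b S] for every small [S] that avoids them. *)
Lemma inseparable_core b x y : haven e haven_order b ->
  ~ separable b K x -> ~ separable b K y -> inseparable e K x y.
Proof.
move=> [hav _] nx ny S xS yS SK.
have KN : K <= haven_order.
  rewrite /haven_order -/D -/K; apply: (@leq_trans (K ^ l)); last by lia.
  by rewrite -{1}[K]expn1 leq_pexp2l ?(ltnW l2) //; apply: leq_ltn_trans SK.
have [_ cb db _] := hav S (leq_trans SK KN).
have inb z : z \notin S -> ~ separable b K z -> z \in b S.
  by move=> zS nz; apply: contraT => zb; case: nz; exists S.
apply: (subsetP (conn_sub_cmp cb _ (inb x xS nx))); last exact: inb.
by apply/subsetP=> z zb; rewrite inE (disjointFr db).
Qed.

Theorem no_haven b : ~ haven e haven_order b.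
Proof.
move=> hav; have sparse := density_bound e_sym e_irr l2 s0 HF NK.
pose Z := [set v | ~~ `[< separable b K v >]].
have [big|small] := leqP (block_size l D) #|Z|.
  apply: (no_block e_sym e_irr l2 HF sparse big) => x y.
  rewrite !inE => /asboolPn nx /asboolPn ny; exact: inseparable_core hav nx ny.
(* The vertices of [Z] are isolated rather than removed. As [b1] avoids them, the empty set
   separates them from the new haven. *)
pose e1 := rest e (~: Z); pose b1 S := b (S :|: Z).
have [hav1 hav2] := hav.
have SZ S : #|S| < 2 * K ^ l + 1 -> #|S :|: Z| < haven_order.
  move=> Sk; apply: leq_ltn_trans (leq_card_setU _ _) _.
  by rewrite /haven_order -/D -/K; clear -Sk small; lia.
have e1_sym : symmetric e1 := rest_sym e_sym _.
have e1_irr : irreflexive e1 by move=> v; rewrite /e1 /rest e_irr !andbF.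
have hav' : haven e1 (2 * K ^ l + 1) b1.
  split=> [S Sk|S S' Sk SS']; last first.
    by apply: hav2; [apply: SZ | apply: setSU].
  have [b0 cb db nb] := hav1 _ (SZ S Sk).
  have bZ : b1 S \subset ~: Z.
    by apply/subsetP=> z zb; have := disjointFr db zb; rewrite !inE => /norP[].
  split=> //; first exact: conn_rest.
  - by apply: disjointWr db; apply: subsetUl.
  - apply/subsetP=> z /nbhdP[zb [w wb /and3P[_ zZ ewz]]].
    have : z \in S :|: Z by apply: (subsetP nb); apply/nbhdP; split=> //; exists w.
    by case/setUP=> // zZ'; rewrite inE zZ' in zZ.
apply: (all_separable_false e1_sym (ltnW l2) (rest_hole_free l2 HF) hav' (k := K)).
  move=> v; have [vZ|vZ] := boolP (v \in Z).
    have [b0 cb db nb] := hav1 _ (SZ set0 ltac:(rewrite cards0 addn1 //)).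
    exists set0; rewrite cards0 inE; split=> //; first by rewrite /K /block_order /path_const; lia.
    by rewrite /b1 (disjointFl db) // inE vZ orbT.
  move: (vZ); rewrite inE negbK => /asboolP[S [Sk vS vb]]; exists S; split=> //.
  apply: contra vb; apply: (subsetP (hav2 _ _ _ (subsetUl _ _))); apply: SZ.
  apply: leq_trans Sk _; rewrite -{1}[K]expn1.
  have : K ^ 1 <= K ^ l by rewrite leq_pexp2l ?(ltnW l2) // /K /block_order /path_const addnS.
  by rewrite expn1; clear; lia.
by rewrite addn1.
Qed.

Lemma balanced_separator W : exists S : {set T}, #|S| < haven_order /\
  forall x, x \notin S -> 2 * #|cmp e (~: S) x :&: W| <= #|W|.
Proof.
apply: contrapT => nex.
have /choice[f fP] : forall S : {set T}, exists x : T, #|S| < haven_order ->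
    x \notin S /\ #|W| < 2 * #|cmp e (~: S) x :&: W|.
  move=> S; have [SN|] := boolP (#|S| < haven_order); last first.
    have [x0 _|noT] := pickP T; first by exists x0.
    by move=> /negP[]; rewrite (leq_ltn_trans (max_card _)) // eq_card0 // /haven_order addnS.
  apply: contrapT => nx; apply: nex; exists S; split=> // x xS.
  by rewrite leqNgt; apply/negP=> xW; apply: nx; exists x.
pose b S := cmp e (~: S) (f S); apply: (@no_haven b); split.
  move=> S SN; have [fS _] := fP S SN; have fS' : f S \in ~: S by rewrite inE.
  split.
  - by apply/set0Pn; exists (f S); apply: cmp_id.
  - exact: conn_cmp.
  - apply/pred0P=> z /=; apply/negbTE/negP=> /andP[/(subsetP (cmp_sub e fS'))].
    by rewrite inE => /negP.
  - apply/subsetP=> z zn; have := disjointFr (cmp_nbhd e fS') zn.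
    by rewrite inE => /negbFE.
move=> S S' S'N SS'; have SN := leq_ltn_trans (subset_leq_card SS') S'N.
have [fS WS] := fP S SN; have [fS' WS'] := fP S' S'N.
have fSV : f S \in ~: S by rewrite inE.
have fSV' : f S' \in ~: S' by rewrite inE.
(* Two sets that each hold more than half of [W] intersect; this yields the monotonicity. *)
have [z zS zS'] : exists2 z, z \in b S & z \in b S'.
  apply: contrapT => nz.
  have dis : [disjoint b S :&: W & b S' :&: W].
    apply/pred0P=> z /=; apply/negbTE/negP=> /andP[/setIP[zS _] /setIP[zS' _]].
    by apply: nz; exists z.
  have : #|b S :&: W| + #|b S' :&: W| <= #|W|.
    rewrite -cardsUI (_ : _ :&: (_ :&: _) = set0); last by apply/eqP; rewrite setI_eq0.
    by rewrite cards0 addn0; apply/subset_leq_card; rewrite subUset !subsetIr.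
  by move: WS WS'; rewrite -/(b S) -/(b S'); clear; lia.
have zSV : z \in ~: S by apply: (subsetP (cmp_sub e fSV)).
have bz : cmp e (~: S) z \subset b S.
  apply: conn_sub_cmp; [exact: conn_cmp | exact: cmp_sub | exact: cmp_symP].
apply: subset_trans bz; apply: conn_sub_cmp => //; first exact: conn_cmp.
by apply: subset_trans (cmp_sub e fSV') _; rewrite setCS.
Qed.

End NoHaven.

End Haven.

(** * Tree decompositions *)

Section BagSequences.
Variables (T : finType) (e : rel T).
Hypothesis e_sym : symmetric e.
Implicit Types (B C R S U V W : {set T}) (u v x y z : T) (bs : seq {set T}).

Local Notation bag bs i := (nth (set0 : {set T}) bs i).

(* The running intersection property: the tree is recovered by letting each
   bag other than the first one hang from an earlier bag. *)
Definition bag_sequence V bs :=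
  [/\ 0 < size bs,
    forall i, i < size bs -> bag bs i \subset V,
    forall v, v \in V -> exists2 i, i < size bs & v \in bag bs i,
    forall u v, u \in V -> v \in V -> e u v ->
      exists i, [/\ i < size bs, u \in bag bs i & v \in bag bs i] &
    forall i, 0 < i < size bs -> exists2 p, p < i &
      forall j v, j < i -> v \in bag bs i -> v \in bag bs j -> v \in bag bs p].

Lemma bag_sequence1 V : bag_sequence V [:: V].
Proof.
split=> //; first by case.
- by move=> v vV; exists 0.
- by move=> u v uV vV _; exists 0.
- by case.
Qed.

(** The first bag of [bs2] hangs from the first bag of [bs1]; all common vertices lie in both of
    them, so the running intersection survives. *)
Lemma bag_sequence_cat V1 V2 bs1 bs2 : bag_sequence V1 bs1 -> bag_sequence V2 bs2 ->
  V1 :&: V2 \subset bag bs1 0 -> V1 :&: V2 \subset bag bs2 0 ->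
  (forall u v, u \in V1 -> v \in V2 -> e u v -> v \in V1 \/ u \in V2) ->
  bag_sequence (V1 :|: V2) (bs1 ++ bs2).
Proof.
move=> [n1 b1 v1 e1 r1] [n2 b2 v2 e2 r2] s1 s2 cross.
have nthl i : i < size bs1 -> bag (bs1 ++ bs2) i = bag bs1 i by rewrite nth_cat => ->.
have nthr i : bag (bs1 ++ bs2) (size bs1 + i) = bag bs2 i.
  by rewrite nth_cat ltnNge leq_addr /= addKn.
have lt_cat i : i < size bs1 -> i < size bs1 + size bs2 by move/leq_trans; apply; apply: leq_addr.
split; rewrite ?size_cat.
- by rewrite addn_gt0 n1.
- move=> i ib; have [i1|i1] := ltnP i (size bs1).
    by rewrite nthl //; apply: subset_trans (b1 i i1) (subsetUl _ _).
  rewrite -(subnKC i1) nthr; apply: subset_trans (b2 _ _) (subsetUr _ _).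
  by rewrite -(ltn_add2l (size bs1)) subnKC.
- move=> v /setUP[/v1|/v2] [i ib vi]; first by exists i; rewrite ?nthl // lt_cat.
  by exists (size bs1 + i); rewrite ?nthr // ltn_add2l.
- move=> u v uV vV euv.
  have [[uV1 vV1]|[uV2 vV2]] : (u \in V1 /\ v \in V1) \/ (u \in V2 /\ v \in V2).
    case/setUP: uV => uV; case/setUP: vV => vV; [by left| | |by right].
      by have [] := cross u v uV vV euv; [left | right].
    by have [] := cross v u vV uV; [rewrite e_sym|left|right].
  + have [i [ib ui vi]] := e1 u v uV1 vV1 euv.
    by exists i; rewrite nthl // lt_cat.
  + have [i [ib ui vi]] := e2 u v uV2 vV2 euv.
    by exists (size bs1 + i); rewrite nthr ltn_add2l.
move=> i /andP[i0 ib]; have [i1|i1] := ltnP i (size bs1).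
  have [|p pi Hp] := r1 i; first by rewrite i0.
  exists p => // j v ji; have j1 := ltn_trans ji i1; have p1 := ltn_trans pi i1.
  by rewrite !nthl //; apply: Hp.
have [i' iE] : exists i', i = size bs1 + i' by exists (i - size bs1); rewrite subnKC.
have ib' : i' < size bs2 by rewrite -(ltn_add2l (size bs1)) -iE.
have in12 j v : j < size bs1 -> v \in bag bs1 j -> v \in bag bs2 i' -> v \in V1 :&: V2.
  by move=> j1 vj vi; rewrite inE (subsetP (b1 j j1)) //= (subsetP (b2 i' ib')).
have [i'0|i'0] := posnP i'.
  exists 0; first by rewrite (leq_trans n1).
  move=> j v ji; have j1 : j < size bs1 by move: ji; rewrite iE i'0 addn0.
  rewrite iE nthr !nthl // => vi vj; exact: (subsetP s1) (in12 j v j1 vj vi).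
have [|p pi Hp] := r2 i'; first by rewrite i'0.
exists (size bs1 + p); first by rewrite iE ltn_add2l.
move=> j v ji; rewrite iE !nthr; move=> vi vj; have [j1|j1] := ltnP j (size bs1).
  rewrite nthl // in vj; have v0 := subsetP s2 v (in12 j v j1 vj vi).
  by apply: (Hp 0).
rewrite -(subnKC j1) nthr in vj; apply: Hp vi vj.
by rewrite -(ltn_add2l (size bs1)) subnKC // -iE.
Qed.

Lemma superset_card U V n : U \subset V -> #|U| <= n -> n <= #|V| ->
  exists W, [/\ U \subset W, W \subset V & #|W| = n].
Proof.
elim: n => [|n IHn] UV Un nV.
  by exists U; split=> //; apply/eqP; rewrite -leqn0.
move: Un; rewrite leq_eqVlt => /predU1P[Un|Un]; first by exists U.
have [W [UW WV Wn]] := IHn UV Un (ltnW nV).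
have /properP[_ [x xV xW]] : W \proper V by rewrite properEcard WV Wn.
exists (x |: W); split; last by rewrite cardsU1 xW Wn.
  by apply: subset_trans UW (subsetUr _ _).
by rewrite subUset sub1set xV.
Qed.

Variable k : nat.
Hypothesis balanced : forall W, exists S : {set T}, #|S| < k /\
  forall x, x \notin S -> 2 * #|cmp e (~: S) x :&: W| <= #|W|.

Definition narrow bs := forall i, i < size bs -> #|bag bs i| <= 4 * k.

(** The border consists of vertices of [S] and vertices of [W] in the component of [x] outside [S]:
    fewer than [k] and at most half of [3 * k]. So it misses some vertex of [W], and the new piece
    is smaller than [V]. *)
Lemma component_border V W S C x : W \subset V -> #|W| = 3 * k -> #|S| < k ->
  (forall x, x \notin S -> 2 * #|cmp e (~: S) x :&: W| <= #|W|) ->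
  x \notin W :|: S -> C = cmp e (V :\: (W :|: S)) x -> x \in V ->
  #|nbhd e C :&: V| <= 3 * k /\ #|C :|: (nbhd e C :&: V)| < #|V|.
Proof.
move=> WV Wk Sk bal xWS CE xV; have xC0 : x \in V :\: (W :|: S) by rewrite inE xWS.
have CV : C \subset V :\: (W :|: S) by rewrite CE; apply: cmp_sub.
have cC : conn e C by rewrite CE; apply: conn_cmp.
have xC : x \in C by rewrite CE; apply: cmp_id.
have CS : C \subset ~: S.
  by apply/subsetP=> z /(subsetP CV); rewrite !inE negb_or => /andP[/andP[_ ->]].
have xS : x \notin S by have := subsetP CS x xC; rewrite inE.
have xS' : x \in ~: S by rewrite inE.
have nC : nbhd e C :&: V \subset S :|: (cmp e (~: S) x :&: W).
  apply/subsetP=> z /setIP[zn zV]; have /nbhdP[zC [w wC ewz]] := zn.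
  have zWS : z \in W :|: S.
    apply: contraT => zWS; have zV' : z \in V :\: (W :|: S) by rewrite inE zWS.
    by rewrite CE in zn; rewrite (disjointFr (cmp_nbhd e xC0) zn) in zV'.
  rewrite !in_setU; have [//|zS] := boolP (z \in S); rewrite /= inE.
  have zW : z \in W by move: zWS; rewrite inE (negPf zS) orbF.
  rewrite zW andbT; apply: (cmp_closed xS' _ _ ewz); last by rewrite inE.
  by apply: (subsetP (conn_sub_cmp cC CS xC)).
have b1 := bal x xS.
have le1 : #|nbhd e C :&: V| <= #|S| + #|cmp e (~: S) x :&: W|.
  by apply: leq_trans (subset_leq_card nC) (leq_card_setU _ _).
have le2 : #|nbhd e C :&: V| < 3 * k by move: b1 le1; rewrite Wk; clear -Sk; lia.
split; first exact: ltnW.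
apply: proper_card; apply/properP; split.
  by rewrite subUset subsetIr andbT; apply: subset_trans CV (subsetDl _ _).
have [w wW wn] : exists2 w, w \in W & w \notin nbhd e C :&: V.
  apply: contrapT => nw; move: le2; rewrite ltnNge -Wk => /negP[].
  apply/subset_leq_card/subsetP=> w wW; apply: contraT => wn; by case: nw; exists w.
exists w; first exact: (subsetP WV).
rewrite in_setU (negPf wn) orbF; apply/negP=> /(subsetP CV).
by rewrite !inE wW.
Qed.

(** The root bag is [W], padded, with a balanced separator of it; each remaining component is
    decomposed together with its border, which takes over the role of [W]. *)
Lemma bag_sequence_exists V W : W \subset V -> #|W| <= 3 * k ->
  exists bs, [/\ bag_sequence V bs, narrow bs & W \subset bag bs 0].
Proof.
have [n] := ubnP #|V|; elim: n V W => // n IHn V W Vn WV Wk.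
have [Vk|Vk] := leqP #|V| (4 * k).
  by exists [:: V]; split=> //; [apply: bag_sequence1 | case].
(* Padding to exactly [3 * k] vertices guarantees that the pieces get smaller. *)
have [W1 [WW1 W1V W1k]] : exists W1, [/\ W \subset W1, W1 \subset V & #|W1| = 3 * k].
  by apply: superset_card => //; clear -Vk; lia.
have [S [Sk bal]] := balanced W1.
pose root := (W1 :|: S) :&: V.
have rootk : #|root| <= 4 * k.
  apply: leq_trans (subset_leq_card (subsetIl _ _)) _.
  by apply: leq_trans (leq_card_setU _ _) _; rewrite W1k; clear -Sk; lia.
(* Components are attached one at a time: [R] is a union of components, and the sequence keeps
   starting with the root bag, which contains every border. *)
suff main m R : #|R| < m -> R \subset V :\: (W1 :|: S) ->
    (forall u v, u \in R -> v \in V :\: (W1 :|: S) -> e u v -> v \in R) ->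
    exists bs, [/\ bag_sequence (root :|: R) bs, narrow bs & bag bs 0 = root].
  have [|||bs [b1 b2 b3]] := main #|V|.+1 (V :\: (W1 :|: S)) => //.
    by rewrite ltnS; apply/subset_leq_card/subsetDl.
  exists bs; split=> //; last first.
    rewrite b3 subsetI WV andbT; apply: subset_trans WW1 (subsetUl _ _).
  by rewrite /root setIC setID in b1.
elim: m R => // m IHm R Rm RV clR.
have [->|[x xR]] := set_0Vmem R.
  by exists [:: root]; split; [rewrite setU0; apply: bag_sequence1 | case | ].
pose C := cmp e (V :\: (W1 :|: S)) x; have xV := subsetP RV x xR.
have [xWS xV'] : x \notin W1 :|: S /\ x \in V by case/setDP: xV.
have [Ck CV] := component_border W1V W1k Sk bal xWS (erefl C) xV'.
have CR : C \subset R.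
  apply: (conn_cmp e_sym xV (x := x)) ; [exact: cmp_id | exact: xR | ].
  by move=> a b aR _ bC eab; apply: clR aR _ eab; apply: (subsetP (cmp_sub e xV)).
have CVV : C \subset V :\: (W1 :|: S) by apply: cmp_sub.
have xC : x \in C by apply: cmp_id.
have nCroot : nbhd e C :&: V \subset root.
  apply/subsetP=> z /setIP[zn zV]; rewrite inE zV andbT; apply: contraT => zWS.
  have := disjointFr (cmp_nbhd e xV) zn; by rewrite inE zWS zV.
have [bs2 [b2 n2 W2]] := IHn (C :|: (nbhd e C :&: V)) (nbhd e C :&: V)
  (leq_trans CV Vn) (subsetUr _ _) Ck.
have [||u v /setDP[uR uC] vV euv|bs1 [b1 n1 W1']] := IHm (R :\: C).
- rewrite ltnS in Rm; apply: leq_trans Rm; apply: proper_card; apply/properP.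
  by split; [apply: subsetDl | exists x; rewrite // inE xC].
- by apply: subset_trans (subsetDl _ _) RV.
- rewrite inE (clR u v) // andbT; apply: contra uC => vC.
  by apply: (cmp_closed xV vC _ _); rewrite 1?e_sym // (subsetP RV).
have b10 : 0 < size bs1 by case: b1.
exists (bs1 ++ bs2); split.
- have -> : root :|: R = (root :|: R :\: C) :|: (C :|: (nbhd e C :&: V)).
    apply/setP=> z; rewrite 3!in_setU in_setD in_setU.
    have zR := subsetP CR z; have zr := subsetP nCroot z; apply/idP/idP.
      by case/orP=> [->//|->]; rewrite andbT; case: (z \in C); rewrite ?orbT.
    by case/orP=> [/orP[->//|/andP[_ ->]]|/orP[/zR->|/zr->//]]; rewrite ?orbT.
  apply: bag_sequence_cat => //.
  + rewrite W1'; apply/subsetP=> z /setIP[/setUP[//|/setDP[zR zC]]].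
    by case/setUP=> [zC'|/(subsetP nCroot)//]; rewrite zC' in zC.
  + apply: subset_trans W2; apply/subsetP=> z /setIP[zl /setUP[zC|//]].
    case/setUP: zl => [|/setDP[_ /negP//]]; rewrite inE => /andP[zWS _].
    by have := subsetP CVV z zC; rewrite inE zWS.
  + move=> u v ul /setUP[vC|/(subsetP nCroot) vr] euv; last by left; rewrite inE vr.
    right; rewrite inE; have [//|uC] := boolP (u \in C).
    rewrite inE /=; apply/andP; split; last first.
      case/setUP: ul => [/setIP[]//|/setDP[uR _]].
      by have /setDP[] := subsetP RV u uR.
    by apply/nbhdP; split=> //; exists v; rewrite // e_sym.
- move=> i; rewrite size_cat nth_cat => ib; case: ltnP => i1; first exact: (n1 i i1).
  by apply: n2; rewrite -(ltn_add2l (size bs1)) subnKC.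
- by rewrite nth_cat b10.
Qed.

End BagSequences.

(** * The tree of a parent function, and the treewidth of a bag sequence *)

Section ParentTree.
Variables (n : nat) (par : 'I_n.+1 -> 'I_n.+1).
Hypothesis parP : forall i : 'I_n.+1, 0 < i -> par i < i.

Definition ptree_adj : rel 'I_n.+1 := fun i j =>
  (0 < i) && (par i == j) || (0 < j) && (par j == i).

Fact ptree_sym : symmetric ptree_adj.
Proof. by move=> i j; rewrite /ptree_adj orbC. Qed.

Fact ptree_irr : irreflexive ptree_adj.
Proof.
move=> i; rewrite /ptree_adj orbb; apply/negbTE/negP=> /andP[/parP + /eqP E].
by rewrite E ltnn.
Qed.

Definition ptree : sgraph := SGraph ptree_sym ptree_irr.

Lemma ptree_lt (i j : 'I_n.+1) : ptree_adj i j -> j < i -> j = par i.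
Proof.
case/orP=> /andP[i0 /eqP <-] //; have := parP i0 => ji ij.
by have := ltn_trans ji ij; rewrite ltnn.
Qed.

Lemma ptree_par (i : 'I_n.+1) : 0 < i -> ptree_adj i (par i).
Proof. by move=> i0; rewrite /ptree_adj i0 eqxx. Qed.

(* The largest node of a cycle would have two distinct smaller neighbours, but
   its only smaller neighbour is its parent. *)
Lemma ptree_acyclic : acyclic ptree.
Proof.
move=> s us; rewrite ltnNge; apply/negP=> s3.
have [m ms mmax] : exists2 m, m \in s & forall i : 'I_n.+1, i \in s -> i <= m.
  have [x xs] : exists x, x \in s by case: (s) s3 => // x s' _; exists x; rewrite mem_head.
  by case: (@arg_maxnP _ x (mem s) (@nat_of_ord n.+1) xs) => m ms mmax; exists m.
have [i s' Es] := rot_to ms; move: us; rewrite -(rot_ucycle i) Es.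
have sz : 2 < size (m :: s') by rewrite -Es size_rot.
have mmax' j : j \in m :: s' -> j <= m by rewrite -Es mem_rot; apply: mmax.
case: s' sz mmax' {Es} => [|a s'] //; case/lastP: s' => [|s' z] // _ mmax'.
case/andP=> /=; rewrite rcons_path last_rcons => /and3P[ma _ zm].
case/and3P=> mN aN _; move: mN aN.
rewrite inE !mem_rcons !inE !negb_or => /and3P[nma nmz _] /andP[naz _].
have lt j : j \in [:: m, a & rcons s' z] -> m != j -> j < m.
  by move=> /mmax'; rewrite leq_eqVlt => /predU1P[/val_inj->|//]; rewrite eqxx.
have Ea : a = par m by apply: ptree_lt => //; apply: lt; rewrite // !inE eqxx orbT.
have Ez : z = par m.
  apply: ptree_lt; first by rewrite ptree_sym.
  by apply: lt; rewrite // !inE mem_rcons mem_head !orbT.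
by rewrite Ea Ez eqxx in naz.
Qed.

Lemma ptree_tree : tree ptree.
Proof.
split; [by rewrite card_ord | | exact: ptree_acyclic].
have to0 : forall i : 'I_n.+1, connect ptree_adj i ord0.
  move=> i; have [k] := ubnP (i : nat); elim: k i => // k IHk i ik.
  have [i0|i0] := posnP i; first by rewrite (_ : i = ord0) ?connect0 //; apply: val_inj.
  apply: connect_trans (connect1 (ptree_par i0)) (IHk _ _).
  by rewrite ltnS in ik; apply: leq_trans (parP i0) ik.
move=> i j; apply: connect_trans (to0 i) _.
by rewrite (sym_connect_sym ptree_sym); apply: to0.
Qed.

End ParentTree.

Lemma bag_sequence_treewidth (G : sgraph) bs w :
  bag_sequence (@adj G) [set: G] bs ->
  (forall i, i < size bs -> #|nth set0 bs i| <= w) -> treewidth G <= w.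
Proof.
move=> [b0 _ cover edge rip] bw.
case E : (size bs) => [|n]; first by rewrite E in b0.
pose bag (i : 'I_n.+1) := nth (set0 : {set G}) bs i.
have ibs (i : 'I_n.+1) : i < size bs by rewrite E.
have /choice[par parP] : forall i : 'I_n.+1, exists p : 'I_n.+1, 0 < i -> p < i /\
    forall (j : 'I_n.+1) v, j < i -> v \in bag i -> v \in bag j -> v \in bag p.
  move=> i; have [i0|i0] := posnP i; first by exists i; rewrite i0.
  have [|p pi Hp] := rip i; first by rewrite i0 ibs.
  exists (Ordinal (ltn_trans pi (ltn_ord i))) => _; split=> // j v; exact: Hp.
have par_lt (i : 'I_n.+1) : 0 < i -> par i < i by case/parP.
pose Tr := ptree par_lt.
have vertexP v : exists i : Tr, v \in bag i.
  have [i ib vi] := cover v (in_setT v); rewrite E in ib.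
  by exists (Ordinal ib).
have edgeP (u v : G) : adj u v -> exists i : Tr, (u \in bag i) && (v \in bag i).
  move=> uv; have [i [ib ui vi]] := edge u v (in_setT u) (in_setT v) uv.
  by rewrite E in ib; exists (Ordinal ib); rewrite /bag /= ui.
have connP v : connected (induced [set i : Tr | v \in bag i]).
  pose I := [set i : Tr | v \in bag i].
  have [i0 vi0] := vertexP v.
  (* Every node with [v] in its bag is joined to the first such node [f]: by running intersection
     with [f], the parent of a later one also has [v] in its bag. *)
  case: (@arg_minnP _ i0 (fun i : 'I_n.+1 => v \in bag i) (@nat_of_ord n.+1) vi0) => f vf fmin.
  have fI : f \in I by rewrite inE.
  have tof (x : induced I) : connect (@adj (induced I)) x (exist _ f fI).
    have [k] := ubnP (nat_of_ord (val x)); elim: k x => // k IHk [i iI] /= ik.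
    have vi : v \in bag i by have := iI; rewrite inE.
    have := fmin i vi; rewrite leq_eqVlt => /predU1P[fi|fi].
      rewrite (_ : exist _ i iI = exist _ f fI) ?connect0 //.
      by apply: val_inj; apply: val_inj.
    have i_gt0 : 0 < i by apply: leq_ltn_trans fi.
    have [pi Hp] := parP i i_gt0.
    have pI : par i \in I by rewrite inE (Hp f v).
    apply: connect_trans (IHk (exist _ (par i) pI) _); last first.
      by rewrite ltnS in ik; apply: leq_trans pi ik.
    by apply: connect1; apply: ptree_par.
  move=> x y; apply: connect_trans (tof x) _.
  rewrite (sym_connect_sym (@adj_sym (induced I))); exact: tof.
pose TD := @TreeDecomposition G Tr bag (ptree_tree par_lt) vertexP edgeP connP.
rewrite /treewidth; case: ex_minnP => m _ /(_ (width TD)) mw.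
apply: leq_trans (mw _) _; first by apply/asboolP; exists TD.
apply: leq_trans (leq_pred _) _; apply/bigmax_leqP=> i _; exact: bw.
Qed.

(** * Cycles, Ramsey's theorem and the main result *)

Section CycleGraph.
Variable n : nat.

Definition cycle_adj : rel 'I_n := fun i j => (i != j) && ((j == ordS i) || (i == ordS j)).

Fact cycle_sym : symmetric cycle_adj.
Proof. by move=> i j; rewrite /cycle_adj eq_sym orbC. Qed.

Fact cycle_irr : irreflexive cycle_adj.
Proof. by move=> i; rewrite /cycle_adj eqxx. Qed.

Definition cycle_graph : sgraph := SGraph cycle_sym cycle_irr.
End CycleGraph.

Lemma hole_induced (G : sgraph) n : 3 <= n -> hole (@adj G) n ->
  induced_subgraph (cycle_graph n) G.
Proof.
move=> n3 [c cP]; have n0 : 0 < n by apply: leq_trans n3.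
have adjE (i j : 'I_n) : i < j ->
    cycle_adj i j = (j == i.+1 :> nat) || ((i == 0 :> nat) && (j == n.-1 :> nat)).
  move=> ij; rewrite /cycle_adj neq_ltn ij /= -!val_eqE /= -[_ %% n]/(nat_of_ord (ordS i)).
  rewrite -[j.+1 %% n]/(nat_of_ord (ordS j)) !ordS_val.
  have := ltn_ord i; have := ltn_ord j; move: ij n3; case: (i =P n.-1 :> nat); case: (j =P n.-1 :> nat); lia.
apply/induced_subgraphP; exists (fun i : 'I_n => c i); split=> [i j E|i j].
  have [ij|ji|/val_inj//] := ltngtP i j.
    by have [|/eqP[]] := cP i j; first by rewrite ij ltn_ord.
  by have [|/eqP[]] := cP j i; first by rewrite ji ltn_ord.
change (adj (c i) (c j) = cycle_adj i j).
have [ij|ji|/val_inj->] := ltngtP i j; last by rewrite adj_irr cycle_irr.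
  by have [|_ ->] := cP i j; [rewrite ij ltn_ord | rewrite adjE].
by rewrite adj_sym cycle_sym; have [|_ ->] := cP j i; [rewrite ji ltn_ord | rewrite adjE].
Qed.

Lemma iter_ordS m (v : 'I_m) k : iter k (@ordS m) v = (v + k) %% m :> nat.
Proof.
elim: k => [|k IHk] /=; first by rewrite addn0 modn_small.
by rewrite IHk -addn1 modnDml addn1 addnS.
Qed.

(** The two neighbours of a vertex go to distinct neighbours of its image, hence to both. So the
    image is closed under [ordS] and is the whole cycle. *)
Lemma cycle_graph_antichain n m : 3 <= n -> 3 <= m ->
  induced_subgraph (cycle_graph n) (cycle_graph m) -> n = m.
Proof.
move=> n3 m3 /induced_subgraphP[f [f_inj f_adj]].
pose A := [set f i | i in [set: 'I_n]].
have closed v : v \in A -> ordS v \in A.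
  case/imsetP=> i _ ->.
  have aS : cycle_adj i (ordS i) by rewrite /cycle_adj eq_sym ordS_neq ?eqxx // ltnW.
  have aP : cycle_adj i (ord_pred i).
    rewrite /cycle_adj ord_predK eqxx orbT andbT.
    by apply: contraNneq (ordS_neq (ord_pred i) (ltnW n3)) => E; rewrite ord_predK {1}E.
  have fS : cycle_adj (f i) (f (ordS i)) by have /= -> := f_adj i (ordS i).
  have fP : cycle_adj (f i) (f (ord_pred i)) by have /= -> := f_adj i (ord_pred i).
  have [/eqP<-|nS] := boolP (f (ordS i) == ordS (f i)); first exact: imset_f.
  have [/eqP<-|nP] := boolP (f (ord_pred i) == ordS (f i)); first exact: imset_f.
  move: fS fP; rewrite /cycle_adj (negPf nS) (negPf nP) /=.
  move=> /andP[_ /eqP E1] /andP[_ /eqP E2]; case/eqP: (ordSS_neq i n3).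
  rewrite -[RHS]ord_predK; congr ordS; apply: f_inj.
  by apply: (can_inj (@ordSK m)); rewrite -E1 -E2.
have AT : A = [set: 'I_m].
  apply/setP=> w; rewrite in_setT; pose i0 : 'I_n := Ordinal (ltn_trans (isT : 0 < 2) n3).
  have cl k : iter k (@ordS m) (f i0) \in A.
    by elim: k => [|k IHk] /=; [apply: imset_f | apply: closed].
  rewrite (_ : w = iter (m - f i0 + w) (@ordS m) (f i0)) ?cl //.
  apply: val_inj; rewrite /= iter_ordS addnA subnKC; last exact: ltnW.
  by rewrite modnDl modn_small.
by have := card_imset [set: 'I_n] f_inj; rewrite -/A AT !cardsT !card_ord.
Qed.

Lemma hereditary_induced (X : sgraph -> Prop) (H G : sgraph) :
  hereditary X -> X G -> induced_subgraph H G -> X H.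
Proof.
move=> [isoX indX] XG [S [f [[g fK gK] fadj]]].
apply: isoX (indX G S XG); exists g; split; first by exists f.
by move=> x y; rewrite -fadj !gK.
Qed.

Lemma wqo_hole_free (X : sgraph -> Prop) : hereditary X ->
  well_quasi_ordered induced_subgraph X ->
  exists l, forall G : sgraph, X G -> hole_free (@adj G) l.
Proof.
move=> hX [_ noanti]; apply: contrapT => nl.
have big l : exists n, [/\ 3 <= n, l <= n & X (cycle_graph n)].
  (* The maximum with 3 discards the degenerate values of [hole]. *)
  apply: contrapT => nn; apply: nl; exists (maxn l 3) => G XG n ln hn.
  rewrite geq_max in ln; have [ln1 n3] := andP ln.
  by apply: nn; exists n; split=> //; apply: hereditary_induced XG (hole_induced n3 hn).
have [g gP] := choice big.
pose fix f k := if k is k'.+1 then g (f k').+1 else g 0.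
have fP k : 3 <= f k /\ X (cycle_graph (f k)).
  by case: k => [|k] /=; [have [] := gP 0 | have [] := gP (f k).+1].
have f_lt i j : i < j -> f i < f j.
  elim: j => // j IHj; rewrite ltnS leq_eqVlt => /predU1P[->|/IHj ij] /=.
    by have [] := gP (f j).+1.
  by apply: ltn_trans ij _; have [] := gP (f j).+1.
have f_inj : injective f.
  by move=> i j E; have [/f_lt|/f_lt|//] := ltngtP i j; rewrite E ltnn.
apply: noanti; exists (fun G => exists k, G = cycle_graph (f k)); split.
- by move=> _ [k ->]; have [] := fP k.
- exists (fun k => cycle_graph (f k)); split=> [i j E|k]; last by exists k.
  apply: f_inj; have /= := congr1 (fun G : sgraph => #|G|) E.
  by rewrite !card_ord.
move=> _ _ [i ->] [j ->] ne; have [[i3 _] [j3 _]] := (fP i, fP j).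
split=> ind; apply: ne; congr cycle_graph.
  exact: cycle_graph_antichain ind.
by apply/esym; exact: cycle_graph_antichain ind.
Qed.

(** The power of 2 fits the induction: apart from [v], at least [2 ^ (a + b) - 1] vertices remain,
    so the neighbours or the non-neighbours of [v] number at least half of [2 ^ (a + b)]. *)
Lemma ramsey (T : finType) (e : rel T) (a b : nat) (A : {set T}) : symmetric e ->
  irreflexive e -> 2 ^ (a + b) <= #|A| ->
  (exists C : {set T}, [/\ C \subset A, #|C| = a &
     forall x y, x \in C -> y \in C -> e x y = (x != y)]) \/
  (exists I : {set T}, [/\ I \subset A, #|I| = b &
     forall x y, x \in I -> y \in I -> e x y = false]).
Proof.
move=> e_sym e_irr; have [n] := ubnP (a + b); elim: n a b A => // n IHn a b A abn.
case: a abn => [|a] abn; first by left; exists set0; rewrite sub0set cards0; split=> // x; rewrite inE.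
case: b abn => [|b] abn; first by right; exists set0; rewrite sub0set cards0; split=> // x; rewrite inE.
move=> sA; have /card_gt0P[v vA] : 0 < #|A| by apply: leq_trans sA; rewrite expn_gt0.
pose N := [set w in A :\ v | e v w]; pose M := [set w in A :\ v | ~~ e v w].
have cNM : #|N| + #|M| = #|A :\ v|.
  rewrite -(cardsID [set w | e v w] (A :\ v)); congr (_ + _); apply: eq_card => w.
    by rewrite !inE.
  by rewrite !inE andbC.
have NA : N \subset A by apply/subsetP=> w; rewrite !inE => /andP[/andP[]].
have MA : M \subset A by apply/subsetP=> w; rewrite !inE => /andP[/andP[]].
have ext (P Q : {set T}) k r : P \subset Q -> Q \subset A -> v \notin Q ->
    #|P| = k -> (forall w, w \in Q -> e v w = r) ->
    (forall x y, x \in P -> y \in P -> e x y = r && (x != y)) ->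
    [/\ v |: P \subset A, #|v |: P| = k.+1 &
      forall x y, x \in v |: P -> y \in v |: P -> e x y = r && (x != y)].
  move=> PQ QA vQ Pk vr Pr; have vP : v \notin P by apply: contra vQ; apply: (subsetP PQ).
  split; first by rewrite subUset sub1set vA (subset_trans PQ).
    by rewrite cardsU1 vP Pk.
  have vx x : x \in P -> e v x = r && (v != x).
    move=> xP; rewrite (vr _ (subsetP PQ x xP)); case: eqP => [E|_]; last by rewrite andbT.
    by rewrite E xP in vP.
  move=> x y /setU1P[->|xP] /setU1P[->|yP]; first by rewrite e_irr eqxx andbF.
  - exact: vx.
  - by rewrite e_sym eq_sym vx.
  - exact: Pr.
have vN : v \notin N by rewrite !inE eqxx.
have vM : v \notin M by rewrite !inE eqxx.
have Nv w : w \in N -> e v w = true by rewrite inE => /andP[].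
have Mv w : w \in M -> e v w = false by rewrite inE => /andP[_ /negbTE].
have [sN|sN] := leqP (2 ^ (a + b.+1)) #|N|.
  have [|[C [CN Ca Cc]]|[I [IN Ib Ii]]] := IHn a b.+1 N _ sN.
  - by move: abn; rewrite addSn.
  - left; exists (v |: C).
    by have [] := ext C N a true CN NA vN Ca Nv Cc.
  - by right; exists I; split=> //; apply: subset_trans NA.
have sM : 2 ^ (a.+1 + b) <= #|M|.
  move: sA cNM sN; rewrite (cardsD1 v A) vA /= !addSn !addnS !expnS.
  by move: (2 ^ (a + b)) #|N| #|M| #|A :\ v|; clear; lia.
have [|[C [CM Ca Cc]]|[I [IM Ib Ii]]] := IHn a.+1 b M _ sM.
- by move: abn; rewrite addnS.
- by left; exists C; split=> //; apply: subset_trans MA.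
- right; exists (v |: I).
  have [//|vI1 vI2 vI3] := ext I M b false IM MA vM Ib Mv.
  by split.
Qed.

Lemma set_complete (G : sgraph) (C : {set G}) :
  (forall x y, x \in C -> y \in C -> adj x y = (x != y)) ->
  induced_subgraph (complete #|C|) G.
Proof.
move=> Cc; apply/induced_subgraphP; exists (fun i => enum_val i); split.
  exact: enum_val_inj.
move=> i j; rewrite Cc ?enum_valP // (inj_eq (@enum_val_inj _ _)) //.
Qed.

Lemma set_biclique (G : sgraph) (I J : {set G}) :
  (forall x y, x \in I -> y \in I -> adj x y = false) ->
  (forall x y, x \in J -> y \in J -> adj x y = false) ->
  (forall x y, x \in I -> y \in J -> adj x y) ->
  induced_subgraph (biclique #|I| #|J|) G.
Proof.
move=> Ii Ji IJ; apply/induced_subgraphP.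
pose h (z : biclique #|I| #|J|) : G := match z with
  | inl i => enum_val i | inr j => enum_val j end.
exists h; split; last first.
  move=> [i|i] [j|j] /=.
  - by rewrite Ii ?enum_valP.
  - by rewrite IJ ?enum_valP.
  - by rewrite adj_sym IJ ?enum_valP.
  - by rewrite Ji ?enum_valP.
have IJne (i : 'I_#|I|) (j : 'I_#|J|) : enum_val i <> enum_val j.
  by move=> E; have := IJ _ _ (enum_valP i) (enum_valP j); rewrite E adj_irr.
move=> [i|i] [j|j] /= E.
- by rewrite (enum_val_inj E).
- by case: (IJne i j).
- by case: (IJne j i).
- by rewrite (enum_val_inj E).
Qed.

(** Without [K_t], each side contains an independent set of size [q] by [ramsey], and two such sets
    would induce [K_{q,q}]. *)
Lemma free_biclique_free (G : sgraph) t q :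
  ~ induced_subgraph (complete t) G -> ~ induced_subgraph (biclique q q) G ->
  biclique_free (@adj G) (2 ^ (t + q)).
Proof.
move=> nK nB S1 S2 s1 s2 S12.
have indep (S : {set G}) : 2 ^ (t + q) <= #|S| -> exists I : {set G}, [/\ I \subset S, #|I| = q &
    forall x y, x \in I -> y \in I -> adj x y = false].
  move=> sS; case: (ramsey (@adj_sym G) (@adj_irr G) sS) => // -[C [_ Ct Cc]].
  by case: nK; rewrite -Ct; apply: set_complete.
have [I [IS Iq Ii]] := indep S1 s1; have [J [JS Jq Ji]] := indep S2 s2.
apply: nB; rewrite -{1}Iq -Jq; apply: set_biclique => // x y xI yJ.
by apply: S12; [apply: (subsetP IS) | apply: (subsetP JS)].
Qed.

Theorem theorem3 (t q : nat) (X : sgraph -> Prop)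
  (X_hereditary : hereditary X)
  (X_free : forall G : sgraph, X G ->
     ~ induced_subgraph (complete t) G /\ ~ induced_subgraph (biclique q q) G)
  (X_wqo : well_quasi_ordered induced_subgraph X) :
  exists c : nat, forall G : sgraph, X G -> treewidth G <= c.
Proof.
have [l0 HF0] := wqo_hole_free X_hereditary X_wqo.
(* Adding 2 secures [2 <= l]; [s] is the bound of [free_biclique_free]. *)
pose l := l0 + 2; pose s := 2 ^ (t + q).
exists (4 * haven_order l s) => G XG.
have HF : hole_free (@adj G) l.
  by move=> n ln; apply: HF0 => //; apply: leq_trans ln; apply: leq_addr.
have [nK nB] := X_free G XG; have NK := free_biclique_free nK nB.
have l2 : 2 <= l by apply: leq_addl.
have s0 : 0 < s by rewrite expn_gt0.
have bal := balanced_separator (@adj_sym G) (@adj_irr G) l2 s0 HF NK.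
have W0 : #|(set0 : {set G})| <= 3 * haven_order l s by rewrite cards0.
have [bs [bsP nbs _]] := bag_sequence_exists (@adj_sym G) bal (sub0set [set: G]) W0.
exact: bag_sequence_treewidth bsP nbs.
Qed.
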